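(* Let $\Omega\subset\mathbb{R}^2$ be a bounded simply connected domain with Lipschitz boundary, and let $\epsilon\in L^2(\mathcal{S}^2;\Omega)$ be an elastic strain field, under plane-strain or plane-stress conditions, satisfying equilibrium and the zero boundary traction condition. Extend $\epsilon$ by zero to $\mathbb{R}^2$ and let $\epsilon=d\omega+{}^s\epsilon$ be its Helmholtz decomposition on $\mathbb{R}^2$. Then $\omega$ satisfies the elliptic boundary value problem $$\mathrm{Div}(C:d\omega)=b\ \text{ in }\Omega,\qquad \omega=0\ \text{ on }\partial\Omega,\qquad\text{where } b=-\mathrm{Div}(C:{}^s\epsilon).$$ In the plane-stress case, $$b_1=-\frac{E}{1-\nu^2}\Big(\frac{\partial\,{}^s\epsilon_{11}}{\partial x_1}+\nu\frac{\partial\,{}^s\epsilon_{22}}{\partial x_1}+(1-\nu)\frac{\partial\,{}^s\epsilon_{12}}{\partial x_2}\Big),$$ $$b_2=-\frac{E}{1-\nu^2}\Big(\nu\frac{\partial\,{}^s\epsilon_{11}}{\partial x_2}+\frac{\partial\,{}^s\epsilon_{22}}{\partial x_2}+(1-\nu)\frac{\partial\,{}^s\epsilon_{12}}{\partial x_1}\Big).$$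
   Context: All indices run over $\{1,2\}$; repeated indices are summed. $L^2(\mathcal{S}^2;U)$ is the space of square-integrable symmetric $2$-tensor fields on $U$. $(\mathrm{Div}\,f)_i=\partial_jf_{ij}$, and all derivatives are distributional; $\omega=0$ on $\partial\Omega$ means that the restriction of $\omega$ to $\Omega$ lies in $H^1_0(\Omega;\mathbb{R}^2)$. $E>0$ (Young's modulus) and $\nu\in(-1,\tfrac12)$ (Poisson's ratio) are constants; $(C:f)_{ij}=C_{ijkl}f_{kl}$, with $$C_{ijkl}=\frac{E}{1+\nu}\Big(\frac{\nu}{1-2\nu}\delta_{ij}\delta_{kl}+\tfrac12(\delta_{ik}\delta_{jl}+\delta_{il}\delta_{jk})\Big)\ \text{(plane-strain)},$$ $$C_{ijkl}=\frac{E}{1+\nu}\Big(\frac{\nu}{1-\nu}\delta_{ij}\delta_{kl}+\tfrac12(\delta_{ik}\delta_{jl}+\delta_{il}\delta_{jk})\Big)\ \text{(plane-stress)}.$$ With stress $\sigma=C:\epsilon$, equilibrium ($\mathrm{Div}\,\sigma=0$ in $\Omega$) and zero boundary traction ($\sigma\cdot n=0$ on $\partial\Omega$, $n$ the outward normal) are understood together weakly: $\int_\Omega\sigma_{ij}\,\partial_j\varphi_i\,dx=0$ for all $\varphi\in H^1(\Omega;\mathbb{R}^2)$. Helmholtz decomposition on $\mathbb{R}^2$: every $\epsilon\in L^2(\mathcal{S}^2;\mathbb{R}^2)$ is uniquely $\epsilon=d\omega+{}^s\epsilon$ with $(d\omega)_{ij}=\tfrac12(\partial_j\omega_i+\partial_i\omega_j)$,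 $\omega$ in the closure of smooth compactly supported vector fields in the norm $\|d\omega\|_{L^2}$, and ${}^s\epsilon\in L^2(\mathcal{S}^2;\mathbb{R}^2)$ with $\mathrm{Div}({}^s\epsilon)=0$ in the distributional sense on $\mathbb{R}^2$. *)

(* Defs.v *)
From HB Require Import structures.
From mathcomp Require Export all_boot all_order all_algebra.
From mathcomp Require Export all_classical all_reals all_analysis.
Set Implicit Arguments.
Unset Strict Implicit.
Unset Printing Implicit Defensive.
Export Order.TTheory GRing.Theory Num.Theory.
Export numFieldNormedType.Exports.
Global Open Scope classical_set_scope.
Global Open Scope ring_scope.

(* Components are indexed by ['I_2]: index 1 of the usual notation is
   [0 : 'I_2], index 2 is [1 : 'I_2]. *)
Notation plane R := (R * R)%type.
Notation field R := (plane R -> R).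
Notation vfield R := ('I_2 -> field R).
Notation tfield R := ('I_2 -> 'I_2 -> field R).

(* [distr R] contains all functionals on [field R]; they are only ever
   evaluated at, and compared on, test functions (see [eq_distr]). Sums and
   scalar multiples of functionals are those of the function space. *)
Notation distr R := (field R -> R).

Section Plane.
Variable R : realType.

Definition basis (j : 'I_2) : plane R := if j == 0 then (1, 0) else (0, 1).

Definition leb2 : {measure set (measurableTypeR R * measurableTypeR R) -> \bar R} :=
  (lebesgue_measure \x lebesgue_measure)%E.

Definition domain (U : set (plane R)) : Prop :=
  [/\ open U, connected U & U !=set0].

Definition loop (U : set (plane R)) (c : R -> plane R) : Prop :=
  [/\ {within `[0, 1], continuous c}, c @` `[0, 1] `<=` U & c 0 = c 1].

Definition null_homotopic (U : set (plane R)) (c : R -> plane R) : Prop :=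
  exists H : plane R -> plane R,
    [/\ {within `[0, 1] `*` `[0, 1], continuous H},
        H @` (`[0, 1] `*` `[0, 1]) `<=` U,
        forall s, s \in `[0, 1] -> H (0, s) = c s,
        forall s, s \in `[0, 1] -> H (1, s) = c 0 &
        forall t, t \in `[0, 1] -> H (t, 0) = c 0 /\ H (t, 1) = c 0].

Definition path_connected (U : set (plane R)) : Prop :=
  forall x y, U x -> U y -> exists c : R -> plane R,
    [/\ {within `[0, 1], continuous c}, c @` `[0, 1] `<=` U, c 0 = x & c 1 = y].

Definition simply_connected (U : set (plane R)) : Prop :=
  path_connected U /\ forall c, loop U c -> null_homotopic U c.

(* Near each boundary point, after a rotation of angle with cosine [c] and
   sine [s], [U] is the strict epigraph of a Lipschitz function. Reflections
   need not be allowed: they amount to replacing [h y] by [h (- y)]. *)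
Definition lipschitz_boundary (U : set (plane R)) : Prop :=
  forall p, (closure U `\` U°) p ->
    exists (c s : R) (h : R -> R),
      [/\ c ^+ 2 + s ^+ 2 = 1, lipschitz h &
          \forall x \near p,
            U x <-> h (c * x.1 + s * x.2) < - s * x.1 + c * x.2].

Definition partial (j : 'I_2) (f : field R) : field R := 'D_(basis j) f.

Definition smooth (f : field R) : Prop :=
  forall js : seq 'I_2, let g := foldr partial f js in
    continuous g /\ forall j x, derivable g x (basis j).

Definition test_function (U : set (plane R)) (f : field R) : Prop :=
  let supp := closure [set x | f x != 0] in
  [/\ smooth f, compact supp & supp `<=` U].

Definition zero_ext (U : set (plane R)) (f : field R) : field R :=
  patch (fun=> 0) U f.

Definition L2 (U : set (plane R)) (f : field R) : Prop :=
  zero_ext U f \in Lfun leb2 2%:E.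

Definition L2norm (U : set (plane R)) (f : field R) : \bar R :=
  ('N[leb2]_2%:E[EFin \o zero_ext U f])%E.

Definition L2loc (f : field R) : Prop := forall K, compact K -> L2 K f.

Definition L2sym (U : set (plane R)) (f : tfield R) : Prop :=
  (forall i j, L2 U (f i j)) /\ (forall i j x, U x -> f i j x = f j i x).

Definition eq_distr (U : set (plane R)) (S T : distr R) : Prop :=
  forall psi, test_function U psi -> S psi = T psi.

Definition distr_of (U : set (plane R)) (f : field R) : distr R :=
  fun psi => \int[leb2]_(x in U) (f x * psi x).

Definition tdistr_of (U : set (plane R)) (f : tfield R) :
    'I_2 -> 'I_2 -> distr R := fun i j => distr_of U (f i j).

Definition dpartial (j : 'I_2) (T : distr R) : distr R :=
  fun psi => - T (partial j psi).

Definition Div (T : 'I_2 -> 'I_2 -> distr R) (i : 'I_2) : distr R :=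
  \sum_(j < 2) dpartial j (T i j).

Definition symgrad (U : set (plane R)) (w : vfield R) (i j : 'I_2) : distr R :=
  2^-1 *: (dpartial j (distr_of U (w i)) + dpartial i (distr_of U (w j))).

(* [u] is in H^1(U) with weak gradient [du]. *)
Definition H1 (U : set (plane R)) (u : field R) (du : vfield R) : Prop :=
  [/\ L2 U u, forall j, L2 U (du j) &
      forall j, eq_distr U (dpartial j (distr_of U u)) (distr_of U (du j))].

(* The closure of the test functions on [U] in H^1(U). *)
Definition H10 (U : set (plane R)) (u : field R) : Prop :=
  exists2 du, H1 U u du & exists phi : nat -> field R,
    [/\ forall n, test_function U (phi n),
        L2norm U (phi n - u) @[n --> \oo] --> 0%E &
        forall j, L2norm U (partial j (phi n) - du j) @[n --> \oo] --> 0%E].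

Definition test_symgrad (phi : vfield R) (i j : 'I_2) : field R :=
  2^-1 *: (partial j (phi i) + partial i (phi j)).

(* The closure of the test vector fields in the norm |d w|_(L^2). This is a
   norm on test fields, but on the plane its completion consists of classes of
   fields modulo its kernel (infinitesimal rigid motions): in dimension two,
   suitably cut-off constants tend to zero in that norm. Members are
   represented here by locally square-integrable fields, and [same_potential]
   identifies the representatives of one element of the closure. *)
Definition potential (w : vfield R) : Prop :=
  (forall i, L2loc (w i)) /\
  exists g : tfield R,
    [/\ L2sym setT g,
        forall i j, eq_distr setT (symgrad setT w i j) (distr_of setT (g i j)) &
        exists phi : nat -> vfield R,
          (forall n i, test_function setT (phi n i)) /\
          forall i j, L2norm setT (test_symgrad (phi n) i j - g i j)
            @[n --> \oo] --> 0%E].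

Definition same_potential (w w' : vfield R) : Prop :=
  [/\ potential w, potential w' &
      forall i j, eq_distr setT (symgrad setT w i j) (symgrad setT w' i j)].

(* [e = d w + se] is the Helmholtz decomposition of [e] on the plane. *)
Definition helmholtz (e : tfield R) (w : vfield R) (se : tfield R) : Prop :=
  [/\ potential w,
      L2sym setT se,
      forall i, eq_distr setT (Div (tdistr_of setT se) i) 0 &
      forall i j, eq_distr setT (distr_of setT (e i j))
                    (symgrad setT w i j + distr_of setT (se i j))].

End Plane.

Inductive plane_case := PlaneStrain | PlaneStress.

Definition stiffness (R : realType) (pc : plane_case) (E nu : R)
    (i j k l : 'I_2) : R :=
  let lam := match pc with
             | PlaneStrain => nu / (1 - 2 * nu)
             | PlaneStress => nu / (1 - nu)
             end in
  let delta (a b : 'I_2) : R := (a == b)%:R in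
  E / (1 + nu) * (lam * delta i j * delta k l
    + 2^-1 * (delta i k * delta j l + delta i l * delta j k)).

(* [C : T], for tensors whose entries are functions or distributions. *)
Definition contract (R : realType) (V : lmodType R)
    (C : 'I_2 -> 'I_2 -> 'I_2 -> 'I_2 -> R) (T : 'I_2 -> 'I_2 -> V)
    (i j : 'I_2) : V :=
  \sum_(k < 2) \sum_(l < 2) C i j k l *: T k l.

(* Equilibrium and zero boundary traction of the stress [sigma] on [U], in
   weak form: the test fields range over all of H^1(U). *)
Definition equilibrium_zero_traction (R : realType) (U : set (plane R))
    (sigma : tfield R) : Prop :=
  forall (phi : vfield R) (dphi : tfield R),
    (forall i, H1 U (phi i) (dphi i)) ->
    \sum_(i < 2) \sum_(j < 2)
      \int[leb2 R]_(x in U) (sigma i j x * dphi i j x) = 0.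

(* Main.v *)
(* A row of the stress is an L^2 field G on Omega, orthogonal to the gradients of all
   H^1 functions. Minimise the L^2 distance from G to the rotated gradients of test
   functions. The residual N of the infimum is weakly curl free and divergence free,
   hence smooth by Weyl's lemma, hence a gradient since Omega is simply connected.
   So N is orthogonal to G and to all rotated gradients of test functions, and N = 0:
   G is the rotated gradient of an element of H^1_0(Omega). The two stream functions
   form a displacement w with d w = (tr sigma) I - sigma, and inverting Hooke's law
   gives eps = alpha sigma - beta d w. The zero extension of sigma is divergence free
   on the plane, so - beta w is the potential of eps by uniqueness of the Helmholtz
   decomposition, and the equation in Omega is Div sigma = 0. *)
Require Import Defs.
From HB Require Import structures.
From mathcomp Require Import measurable_realfun ring lra.
Set Implicit Arguments.
Unset Strict Implicit.
Unset Printing Implicit Defensive.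

(** The zero traction condition enters as the freedom to test with all of H^1(Omega). Restrictions
    of test functions of the plane are among these fields, so the zero extension of each stress row
    is divergence free across the boundary. Primitives of harmonic residuals are among them too,
    after a truncation; this excludes such a residual and leaves a stream function that vanishes at
    the boundary. Since the approximation uses test functions only, membership in H^1_0 needs no
    trace theory: Poincare's inequality turns convergence of the gradients into convergence of the
    functions. The potential omega is determined on the plane only modulo infinitesimal rigid
    motions, so the boundary condition is proved for the representative built from the stream
    functions, which vanishes outside Omega. *)

Notation mplane R := (measurableTypeR R * measurableTypeR R)%type.
Notation itg f := ((leb2 _).-integrable setT (EFin \o f)).

(** * Measurability and integrability on the plane *)

Section PlaneMeasure.
Variable R : realType.
Implicit Types (f g : field R) (U : set (plane R)).

Lemma measurable_setX_plane (A B : set R) : measurable A -> measurable B ->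
  measurable (A `*` B : set (mplane R)).
Proof. by move=> mA mB; exact: measurableX. Qed.

(** [leb2] lives on the product sigma-algebra, so openness does not give measurability by
    definition: an open set is the union of the countably many boxes with rational centre and radius
    that it contains. *)
Lemma open_measurable_plane U : open U -> measurable (U : set (mplane R)).
Proof.
move=> oU.
pose box (q : rat * rat * rat) : set (plane R) :=
  `]ratr q.1.1 - ratr q.2, ratr q.1.1 + ratr q.2[%classic `*`
  `]ratr q.1.2 - ratr q.2, ratr q.1.2 + ratr q.2[%classic.
pose F q : set (mplane R) := if `[< box q `<=` U >] then box q else set0.
have -> : U = \bigcup_q F q :> set (mplane R).
  apply/seteqP; split=> [[x y] /= Uxy|z [q _]]; last first.
    by rewrite /F; case: asboolP => // + bz; exact.
  have := open_nbhs_nbhs (conj oU Uxy) => /nbhs_ballP[e /= e0 be].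
  have [r rin] : exists r : rat, 0 < (ratr r : R) < e / 2.
    have [r] := @rat_in_itvoo R 0 (e / 2) ltac:(by rewrite divr_gt0).
    by rewrite in_itv /= => ?; exists r.
  have /andP[r0 re] := rin.
  have H (a : R) : exists q : rat, `|ratr q - a| < ratr r.
    have [q] := @rat_in_itvoo R (a - ratr r) (a + ratr r)
      ltac:(by rewrite ltrD2l gtrN).
    by rewrite in_itv /= -ltr_distl => ?; exists q.
  have [qx hx] := H x; have [qy hy] := H y.
  exists (qx, qy, r) => //.
  rewrite /F asboolT.
    rewrite /box /=; split; rewrite /= in_itv /= -ltr_distl.
      by rewrite distrC.
    by rewrite distrC.
  rewrite /box => -[a b] /=; rewrite !in_itv /= -!ltr_distl => -[ha hb].
  apply: be; split; rewrite /ball /=.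
    rewrite (le_lt_trans (ler_distD (ratr qx) _ _))//.
    rewrite (splitr e) ltrD// (lt_trans _ re)//.
      by rewrite distrC.
    by rewrite distrC.
  rewrite (le_lt_trans (ler_distD (ratr qy) _ _))//.
  rewrite (splitr e) ltrD// (lt_trans _ re)//.
    by rewrite distrC.
  by rewrite distrC.
apply: countable_bigcupT_measurable => [|q]; first exact: countableP.
rewrite /F; case: asboolP => // _; exact: measurable_setX_plane.
Qed.

Lemma continuous_measurable_plane f : continuous f ->
  measurable_fun setT (f : mplane R -> R).
Proof.
move=> cf; apply: (measurability _ (RGenOInfty.measurableE R)).
move=> /= _ [_ [a ->]] <-; rewrite setTI.
apply: open_measurable_plane; rewrite -(@setTI _ (f @^-1` _)).
by move/continuousP : cf; rewrite setTI; apply; exact: interval_open.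
Qed.

Lemma open_continuous_measurable_plane U f : open U ->
  {in U, continuous f} -> measurable_fun (U : set (mplane R)) (f : mplane R -> R).
Proof.
move=> oU cf; apply: (measurability _ (RGenOInfty.measurableE R)).
move=> /= _ [_ [a ->]] <-.
apply: open_measurable_plane.
rewrite openE => x [Ux fx]; apply: filterI.
  exact: open_nbhs_nbhs.
apply: cf; first exact/mem_set.
by apply: open_nbhs_nbhs; split => //; exact: interval_open.
Qed.

Definition cbox (M : R) : set (plane R) := `[- M, M] `*` `[- M, M].

Lemma measurable_cbox M : measurable (cbox M : set (mplane R)).
Proof. exact: measurable_setX_plane. Qed.

Lemma leb2_cbox M : (leb2 R (cbox M) < +oo)%E.
Proof.
have -> : leb2 R (cbox M) = (lebesgue_measure `[(- M)%R, M] *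
    lebesgue_measure `[(- M)%R, M])%E.
  by rewrite /leb2 /cbox -product_measure1E.
by rewrite lebesgue_measure_itv /=; case: ifPn => _; rewrite ?mule0 ?ltry// -EFinD -EFinM ltry.
Qed.

Lemma bounded_sub_cbox U : bounded_set U -> exists2 M, 0 < M & U `<=` cbox M.
Proof.
move=> [M [_ HM]]; exists (`|M| + 1); first by rewrite ltr_wpDl.
move=> [x y] /= Uxy.
have M1 : M < `|M| + 1 by rewrite (le_lt_trans (ler_norm _)) ?ltrDl.
have : `|(x, y)| <= `|M| + 1 by exact: HM Uxy.
by rewrite prod_normE /= ge_max => /andP[? ?]; split; rewrite /= in_itv /= -ler_norml.
Qed.

Lemma itg_bounded_cbox f M B : measurable_fun setT (f : mplane R -> R) ->
  (forall x, `|f x| <= B) -> (forall x, ~ cbox M x -> f x = 0) -> itg f.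
Proof.
move=> mf fB f0.
have -> : EFin \o f = (EFin \o f) \_ (cbox M).
  by apply/funext => x; rewrite /patch; case: ifPn => //; rewrite notin_setE => /f0 /= ->.
apply/(integrable_mkcond _ _).1 => //; first exact: measurable_cbox.
apply: measurable_bounded_integrable => //.
- exact: measurable_cbox.
- exact: leb2_cbox.
- exact: measurable_funTS.
- exists B; split; first exact: num_real.
  by move=> C BC x _ /=; apply: le_trans (fB x) _; exact: ltW.
Qed.

End PlaneMeasure.

(** * Partial derivatives and their integrals *)

Section Partial.
Variable R : realType.
Implicit Types (f g : field R) (U : set (plane R)).

(** Along a basis vector the difference quotients are those of a one-variable slice, so [partial]
    inherits one-variable calculus. *)
Lemma slice0E f x y : (fun h : R => h^-1 *: ((f \o shift (x, y)) (h *: basis R 0) - f (x, y)))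
  = (fun h => h^-1 *: (((fun t => f (t, y)) \o shift x) (h *: 1) - f (x, y))).
Proof.
apply/funext => h /=; congr (_ *: (f _ - _)).
by rewrite /basis /= /shift /=; congr pair => /=; rewrite /GRing.scale /= mulr0 add0r.
Qed.

Lemma slice1E f x y : (fun h : R => h^-1 *: ((f \o shift (x, y)) (h *: basis R 1) - f (x, y)))
  = (fun h => h^-1 *: (((fun t => f (x, t)) \o shift y) (h *: 1) - f (x, y))).
Proof.
apply/funext => h /=; congr (_ *: (f _ - _)).
by rewrite /basis /= /shift /=; congr pair => /=; rewrite /GRing.scale /= mulr0 add0r.
Qed.

Lemma derivable0E f x y :
  derivable f (x, y) (basis R 0) <-> derivable (fun t => f (t, y)) x 1.
Proof. by rewrite /derivable slice0E. Qed.

Lemma derivable1E f x y :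
  derivable f (x, y) (basis R 1) <-> derivable (fun t => f (x, t)) y 1.
Proof. by rewrite /derivable slice1E. Qed.

Lemma partial0E f x y : partial 0 f (x, y) = derive1 (fun t => f (t, y)) x.
Proof. by rewrite derive1E /partial /derive slice0E. Qed.

Lemma partial1E f x y : partial 1 f (x, y) = derive1 (fun t => f (x, t)) y.
Proof. by rewrite derive1E /partial /derive slice1E. Qed.

Lemma continuous_pairP (T : topologicalType) (f g : T -> R) (x : T) :
  {for x, continuous f} -> {for x, continuous g} ->
  {for x, continuous (fun t => (f t, g t) : plane R)}.
Proof.
move=> cf cg; apply: (@cvg_pair _ _ _ (nbhs x) (nbhs (f x)) (nbhs (g x))) => //.
Qed.

Lemma continuous_slice0 f x y : {for (x, y), continuous f} -> {for x, continuous (fun t => f (t, y))}.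
Proof.
move=> cf; apply: (@continuous_comp _ _ _ (fun t : R => (t, y) : plane R) f) => //.
by apply: continuous_pairP; [exact: cvg_id|exact: cvg_cst].
Qed.

Lemma continuous_slice1 f x y : {for (x, y), continuous f} -> {for y, continuous (fun t => f (x, t))}.
Proof.
move=> cf; apply: (@continuous_comp _ _ _ (fun t : R => (x, t) : plane R) f) => //.
by apply: continuous_pairP; [exact: cvg_cst|exact: cvg_id].
Qed.

Lemma FTC_compact_support (F : R -> R) (M : R) : (forall x, derivable F x 1) -> continuous (derive1 F) ->
  (forall x, M < `|x| -> F x = 0) -> (\int[lebesgue_measure]_x (derive1 F x)%:E = 0)%E.
Proof.
move=> dF cF' F0.
have cF : continuous F by move=> x; apply/differentiable_continuous/derivable1_diffP.
(* [N] exceeds [M] strictly, so that [F] vanishes at both endpoints of the integration interval and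
   near every point beyond it. *)
pose N : R := `|M| + 1; have N0 : 0 < N by rewrite ltr_wpDl.
have MN : M < N by rewrite (le_lt_trans (ler_norm _)) ?ltrDl.
have F'0 x : N < `|x| -> derive1 F x = 0.
  move=> Nx; rewrite derive1E -(derive_cst (0 : R) x (1 : R)).
  apply: near_eq_derive => //.
  have : \forall y \near x, N < `|y|.
    have /cvgr_gt := @norm_continuous _ _ x; exact.
  by apply: filterS => y Ny; apply: F0; exact: lt_trans Ny.
have -> : (\int[lebesgue_measure]_x (derive1 F x)%:E =
    \int[lebesgue_measure]_(x in `[(- N)%R, N]) (derive1 F x)%:E)%E.
  rewrite [RHS]integral_mkcond; apply: eq_integral => x _.
  rewrite /patch; case: ifPn => //.
  rewrite notin_setE /= in_itv /= -ler_norml => /negP.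
  by rewrite -ltNge => /F'0 ->.
have NN : - N < N by rewrite (lt_trans _ N0) // oppr_lt0.
have dFN : derivable_oo_LRcontinuous F (- N) N.
  split=> [x _||]; first exact: dF.
  + exact/cvg_at_right_filter/cF.
  + exact/cvg_at_left_filter/cF.
rewrite (continuous_FTC2 NN (continuous_subspaceT cF') dFN (fun _ _ => erefl)).
by rewrite F0 ?gtr0_norm// F0 ?subee// normrN gtr0_norm.
Qed.

(** By Fubini the variable of differentiation is integrated first; each inner integral is that of
    the derivative of a compactly supported function. *)
Lemma integral_partial_eq0 (j : 'I_2) f (M : R) : (forall z, derivable f z (basis R j)) ->
  continuous f -> continuous (partial j f) -> (forall z, ~ cbox M z -> f z = 0) ->
  \int[leb2 R]_z partial j f z = 0.
Proof.
move=> df cf cdf f0.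
have f00 x y : M < `|x| \/ M < `|y| -> f (x, y) = 0.
  move=> Mxy; apply: f0 => -[] /=; rewrite !in_itv /= -!ler_norml => h1 h2.
  by move: Mxy; rewrite !ltNge h1 h2 => -[].
have pf0 z : ~ cbox (M + 1) z -> partial j f z = 0.
  move=> zM; rewrite /partial -(derive_cst (0 : R) z (basis R j)).
  have zM' : M < `|z|.
    rewrite ltNge; apply/negP => zM'; apply: zM; case: z zM' => x y.
    rewrite prod_normE /= ge_max => /andP[xM yM]; split; rewrite /= in_itv /= -ler_norml;
    by rewrite (le_trans xM, le_trans yM) // lerDl.
  apply: near_eq_derive => //.
  have : \forall y \near z, M < `|y| by have /cvgr_gt := @norm_continuous _ _ z; exact.
  apply: filterS => -[x y]; rewrite prod_normE /= lt_max => /orP Mxy; exact: f00.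
have ipf : itg (partial j f).
  have [B HB] : exists B, forall z, `|partial j f z| <= B.
    have /compact_bounded [B [_ HB]] : compact (partial j f @` cbox (M + 1)).
      apply: continuous_compact; first exact: continuous_subspaceT.
      by apply: compact_setX; exact: segment_compact.
    exists (`|B| + 1) => z; have [zM|/pf0 ->] := pselect (cbox (M + 1) z); last first.
      by rewrite normr0 addr_ge0.
    apply: (HB (`|B| + 1)); first by rewrite (le_lt_trans (ler_norm _)) ?ltrDl.
    by exists z.
  apply: (itg_bounded_cbox _ HB pf0); exact: continuous_measurable_plane.
rewrite /Rintegral.
have cdfs (z : plane R) : {for z, continuous (partial j f)} by exact: cdf.
have [j0|j1] : j = 0 \/ j = 1 by case: j {df cf cdf pf0 ipf cdfs}; case=> [|[|//]] ?;
  [left|right]; exact: val_inj.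
  subst j; rewrite -(integral21_prod_meas1 ipf) [X in fine X]integral0_eq //.
  move=> y _; rewrite /fubini_G /=.
  under eq_integral do rewrite partial0E.
  apply: (@FTC_compact_support (fun t => f (t, y)) M) => //.
  - by move=> x; apply/derivable0E.
  - move=> x. rewrite (_ : derive1 _ = fun t => partial 0 f (t, y)); last first.
      by apply/funext => t; rewrite partial0E.
    exact: (@continuous_slice0 (partial 0 f)).
  - by move=> x Mx; apply: f00; left.
subst j; rewrite -(integral12_prod_meas1 ipf) [X in fine X]integral0_eq //.
move=> x _; rewrite /fubini_F /=.
under eq_integral do rewrite partial1E.
apply: (@FTC_compact_support (fun t => f (x, t)) M) => //.
- by move=> y; apply/derivable1E.
- move=> y. rewrite (_ : derive1 _ = fun t => partial 1 f (x, t)); last first.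
    by apply/funext => t; rewrite partial1E.
  exact: (@continuous_slice1 (partial 1 f)).
- by move=> y My; apply: f00; right.
Qed.

End Partial.

(** * Square-integrable functions *)

Section SquareIntegrable.
Context d (T : measurableType d) (R : realType).
Variable mu : {measure set T -> \bar R}.
Implicit Types f g h : T -> R.

Local Notation itgT f := (mu.-integrable setT (EFin \o f)).

(** Functions are not identified modulo null sets: [ip f f = 0] does not give [f = 0], and null
    functions are handled by [CauchySchwarz] instead. *)
Definition sqint f : Prop := measurable_fun setT f /\ itgT (fun x => f x ^+ 2).

Definition ip f g : R := \int[mu]_x (f x * g x).

Lemma itg_le f g : measurable_fun setT f -> itgT g -> (forall x, `|f x| <= g x) -> itgT f.
Proof.
move=> mf ig fg; apply: le_integrable ig => //; first exact/measurable_EFinP.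
by move=> x _ /=; rewrite lee_fin (le_trans (fg x))// ler_norm.
Qed.

Lemma itgD f g : itgT f -> itgT g -> itgT (fun x => f x + g x).
Proof. by move=> hf hg; have := integrableD measurableT hf hg; apply: eq_integrable. Qed.

Lemma itgB f g : itgT f -> itgT g -> itgT (fun x => f x - g x).
Proof. by move=> hf hg; have := integrableB measurableT hf hg; apply: eq_integrable. Qed.

Lemma itgZ (a : R) f : itgT f -> itgT (fun x => a * f x).
Proof. by move=> hf; have := integrableZl measurableT a hf; apply: eq_integrable. Qed.

Lemma sqintM f g : sqint f -> sqint g -> itgT (fun x => f x * g x).
Proof.
move=> [mf f2] [mg g2]; apply: (itg_le _ (itgD f2 g2)) => [|x].
  exact: measurable_funM.
rewrite normrM -(real_normK (num_real (f x))) -(real_normK (num_real (g x))).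
have := sqr_ge0 (`|f x| - `|g x|); have := normr_ge0 (f x); have := normr_ge0 (g x).
nra.
Qed.

Lemma sqintZ (a : R) f : sqint f -> sqint (fun x => a * f x).
Proof.
move=> [mf f2]; split; first exact: measurable_funM.
by have := itgZ (a ^+ 2) f2; apply: eq_integrable => // x _ /=; rewrite exprMn.
Qed.

Lemma sqintD f g : sqint f -> sqint g -> sqint (fun x => f x + g x).
Proof.
move=> hf hg; split; first by case: hf => mf _; case: hg => mg _; exact: measurable_funD.
have := itgD (itgD hf.2 hg.2) (itgZ 2 (sqintM hf hg)).
by apply: eq_integrable => // x _ /=; congr EFin; ring.
Qed.

Lemma sqintB f g : sqint f -> sqint g -> sqint (fun x => f x - g x).
Proof.
move=> hf hg; have := sqintD hf (sqintZ (-1) hg); congr sqint.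
by apply/funext => x; rewrite mulN1r.
Qed.

Lemma ipC f g : ip f g = ip g f.
Proof. by rewrite /ip; apply: eq_Rintegral => x _; rewrite mulrC. Qed.

Lemma ipDl f g h : sqint f -> sqint g -> sqint h ->
  ip (fun x => f x + g x) h = ip f h + ip g h.
Proof.
move=> hf hg hh; rewrite /ip -RintegralD//; [|exact: sqintM..].
by apply: eq_Rintegral => x _; rewrite mulrDl.
Qed.

Lemma ipZl a f h : sqint f -> sqint h -> ip (fun x => a * f x) h = a * ip f h.
Proof.
move=> hf hh; rewrite /ip -RintegralZl//; last exact: sqintM.
by apply: eq_Rintegral => x _; rewrite mulrA.
Qed.

Lemma ipBl f g h : sqint f -> sqint g -> sqint h ->
  ip (fun x => f x - g x) h = ip f h - ip g h.
Proof.
move=> hf hg hh; rewrite /ip -RintegralB//; [|exact: sqintM..].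
by apply: eq_Rintegral => x _; rewrite mulrBl.
Qed.

Lemma ipDr f g h : sqint f -> sqint g -> sqint h ->
  ip h (fun x => f x + g x) = ip h f + ip h g.
Proof. by move=> *; rewrite ipC ipDl// !(ipC h). Qed.

Lemma ipBr f g h : sqint f -> sqint g -> sqint h ->
  ip h (fun x => f x - g x) = ip h f - ip h g.
Proof. by move=> *; rewrite ipC ipBl// !(ipC h). Qed.

Lemma ipZr a f h : sqint f -> sqint h -> ip h (fun x => a * f x) = a * ip h f.
Proof. by move=> *; rewrite ipC ipZl// (ipC h). Qed.

Lemma ip_ge0 f : 0 <= ip f f.
Proof. by apply: Rintegral_ge0 => x _; rewrite -expr2 sqr_ge0. Qed.

Lemma ip_subZ t f g : sqint f -> sqint g ->
  ip (fun x => f x - t * g x) (fun x => f x - t * g x) =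
  ip f f - 2 * t * ip f g + t ^+ 2 * ip g g.
Proof.
move=> hf hg; have hg' := sqintZ t hg; have hfg := sqintB hf hg'.
rewrite ipBl// !ipBr// !ipZl// !ipZr// (ipC g f); ring.
Qed.

Lemma CauchySchwarz f g : sqint f -> sqint g -> ip f g ^+ 2 <= ip f f * ip g g.
Proof.
move=> hf hg; have [g0|g0] := eqVneq (ip g g) 0.
  have H t : 0 <= ip f f - 2 * t * ip f g.
    have := ip_ge0 (fun x => f x - t * g x).
    by rewrite ip_subZ// g0 mulr0 addr0.
  have [->|fg0] := eqVneq (ip f g) 0; first by rewrite expr0n mulr_ge0// ip_ge0.
  (* With [ip g g = 0] the quadratic in [t] is affine; at this [t] it would equal -1. *)
  have := H ((ip f f + 1) / (2 * ip f g)).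
  rewrite (_ : 2 * _ * _ = ip f f + 1); last by field.
  by rewrite opprD addrA subrr add0r oppr_ge0 ler10.
have gp : 0 < ip g g by rewrite lt_neqAle eq_sym g0 ip_ge0.
have := ip_ge0 (fun x => f x - (ip f g / ip g g) * g x).
rewrite ip_subZ// => H.
have : 0 <= (ip f f - ip f g ^+ 2 / ip g g) * ip g g.
  rewrite mulr_ge0 ?(ltW gp)//; apply: le_trans H _; rewrite le_eqVlt; apply/orP; left.
  move: (ip f f) (ip f g) (ip g g) g0 => a b c c0; apply/eqP; field; exact: c0.
by rewrite mulrBl divfK// subr_ge0.
Qed.

(** By Cauchy-Schwarz, norm convergence implies weak convergence; this is how identities for test
    functions pass to limits. *)
Lemma ip_cvg (f : nat -> T -> R) f' g : (forall n, sqint (f n)) -> sqint f' -> sqint g ->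
  ip (fun x => f n x - f' x) (fun x => f n x - f' x) @[n --> \oo] --> 0 ->
  ip (f n) g @[n --> \oo] --> ip f' g.
Proof.
move=> hf hf' hg H; apply/cvgrPdist_lt => e e0.
pose c := ip g g + 1; have c0 : 0 < c by rewrite ltr_wpDl// ip_ge0.
have /cvgrPdist_lt/(_ (e ^+ 2 / c)) := H.
rewrite divr_gt0 ?exprn_gt0// => /(_ isT); apply: filterS => n.
rewrite sub0r normrN ger0_norm ?ip_ge0// => Hn.
rewrite distrC -ipBl// -ltr_sqr ?nnegrE ?(ltW e0)// real_normK ?num_real//.
apply: (le_lt_trans (CauchySchwarz (sqintB (hf n) hf') hg)).
rewrite ltr_pdivlMr // in Hn; apply: le_lt_trans Hn.
by rewrite ler_wpM2l ?ip_ge0// lerDl.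
Qed.


Lemma ae_fin_integrable (F : T -> \bar R) : mu.-integrable setT F ->
  {ae mu, forall x, F x \is a fin_num}.
Proof. by move=> /integrable_ae -/(_ measurableT); apply: filterS => x; exact. Qed.

(* Riesz-Fischer for a fast Cauchy sequence: [sum_n 4^n (f_(n+1) - f_n)^2] has a finite
   integral, hence is finite almost everywhere. *)
Lemma sqint_fast_cvg (f : nat -> T -> R) : (forall n, sqint (f n)) ->
  (forall n, ip (fun x => f n.+1 x - f n x) (fun x => f n.+1 x - f n x) <= (8^-1) ^+ n) ->
  exists2 g : T -> R, measurable_fun setT g & {ae mu, forall x, f n x @[n --> \oo] --> g x}.
Proof.
move=> hf Hf; pose h n x := f n.+1 x - f n x.
have hh n : sqint (h n) by exact: sqintB.
pose S x : \bar R := (\sum_(n <oo) (4 ^+ n * h n x ^+ 2)%:E)%E.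
have mS : measurable_fun setT S.
  apply: ge0_emeasurable_sum => [k x _ _|k _].
    by rewrite lee_fin mulr_ge0 ?sqr_ge0 ?exprn_ge0.
  apply/measurable_EFinP; apply: measurable_funM => //.
  by apply: measurable_funX; case: (hh k).
have S0 x : (0 <= S x)%E.
  by apply: nneseries_ge0 => n _ _; rewrite lee_fin mulr_ge0 ?sqr_ge0 ?exprn_ge0.
have iS : mu.-integrable setT S.
  apply/integrableP; split=> //.
  under eq_integral do rewrite gee0_abs//.
  rewrite /S integral_nneseries//; last 2 first.
    move=> n; apply/measurable_EFinP; apply: measurable_funM => //.
    by apply: measurable_funX; case: (hh n).
    by move=> n x _; rewrite lee_fin mulr_ge0 ?sqr_ge0 ?exprn_ge0.
  have H n : (\int[mu]_x (4 ^+ n * h n x ^+ 2)%:E <= ((2^-1) ^+ n)%:E)%E.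
    under eq_integral do rewrite EFinM.
    rewrite integralZl//; last by case: (hh n).
    rewrite -[X in (_ * X)%E]fineK; last by apply: integrable_fin_num => //; case: (hh n).
    rewrite -EFinM lee_fin.
    have := Hf n; rewrite /ip /Rintegral; under eq_integral do rewrite -expr2.
    move=> /(ler_wpM2l (exprn_ge0 n (ler0n R 4))) /le_trans; apply.
    by rewrite -exprMn (_ : 4 * 8^-1 = 2^-1) //; field.
  apply: (@le_lt_trans _ _ (\sum_(n <oo) ((2^-1) ^+ n)%:E)%E).
    apply: lee_nneseries => [n _ _|n _]; last exact: H.
    by apply: integral_ge0 => x _; rewrite lee_fin mulr_ge0 ?sqr_ge0 ?exprn_ge0.
  suff : (\sum_(n <oo) ((2^-1) ^+ n)%:E <= 2%:E :> \bar R)%E by move/le_lt_trans; apply; rewrite ltry.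
  apply: lime_le; first by apply: is_cvg_nneseries => n _ _; rewrite lee_fin exprn_ge0.
  apply: nearW => n; rewrite sumEFin lee_fin big_mkord.
  suff -> : \sum_(i < n) (2^-1) ^+ i = 2 - 2 * (2^-1) ^+ n :> R.
    by rewrite lerBlDr lerDl mulr_ge0// exprn_ge0.
  elim: n => [|n IH]; first by rewrite big_ord0 expr0 mulr1 subrr.
  by rewrite big_ord_recr /= IH exprS; field.
have cf : {ae mu, forall x, cvgn (f ^~ x)}.
  apply: filterS (ae_fin_integrable iS) => x Sx.
  pose C := fine (S x); have C0 : 0 <= C by exact: fine_ge0.
  (* Each term of the series is at most its sum [C], that is [4^n h_n^2 <= C]; the increments are
     then dominated by a geometric series. *)
  have hC n : `|h n x| <= geometric (Num.sqrt C) 2^-1 n.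
    rewrite /geometric /= -ler_sqr ?nnegrE ?mulr_ge0 ?sqrtr_ge0 ?exprn_ge0//.
    rewrite exprMn sqr_sqrtr// real_normK ?num_real// -exprM mulnC exprM.
    have -> : (2^-1) ^+ 2 = 4^-1 :> R by field.
    rewrite exprVn ler_pdivlMr ?exprn_gt0// mulrC -lee_fin fineK//.
    apply: (le_trans _ (nneseries_lim_ge n.+1 _)) => /=.
      rewrite big_mkord big_ord_recr /= leeDr//.
      by apply: sume_ge0 => i _; rewrite lee_fin mulr_ge0 ?sqr_ge0 ?exprn_ge0.
    by move=> i _ _; rewrite lee_fin mulr_ge0 ?sqr_ge0 ?exprn_ge0.
  have cs : cvgn (series (h ^~ x)).
    apply: normed_cvg; apply: (series_le_cvg (v_ := geometric (Num.sqrt C) 2^-1)) => [n|n|n|].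
    - exact: normr_ge0.
    - by rewrite /geometric /= mulr_ge0 ?sqrtr_ge0 ?exprn_ge0.
    - exact: hC.
    by apply: is_cvg_geometric_series; rewrite gtr0_norm ?invr_gt0// invf_lt1// ltr1n.
  have -> : f ^~ x = (fun n => f 0 x + series (h ^~ x) n).
    apply/funext => n; rewrite /series /= telescope_sumr//.
    by rewrite addrC subrK.
  by apply: is_cvgD => //; exact: is_cvg_cst.
(* The limit superior is measurable everywhere; [fine] gives it a real value also where the sequence
   diverges. *)
have mlim : measurable_fun setT (fun x => fine (limn_esup (fun n => (f n x)%:E))).
  apply: measurableT_comp => //; apply: measurable_fun_limn_esup => n.
  by apply/measurable_EFinP; case: (hf n).
exists (fun x => fine (limn_esup (fun n => (f n x)%:E))) => //.
apply: filterS cf => x cx.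
have cxE : (f n x)%:E @[n --> \oo] --> (limn (f ^~ x))%:E by apply: cvg_EFin => //; exact: nearW.
by rewrite (cvg_limn_einf_sup cxE).2.
Qed.

(** A subsequence with increments below [8^-k] in squared norm converges almost everywhere; Fatou's
    lemma then bounds the distance of the whole sequence to its limit. *)
Lemma sqint_complete (f : nat -> T -> R) : (forall n, sqint (f n)) ->
  (forall e, 0 < e -> exists N, forall m n, (N <= m)%N -> (N <= n)%N ->
     ip (fun x => f m x - f n x) (fun x => f m x - f n x) < e) ->
  exists2 g, sqint g & ip (fun x => f n x - g x) (fun x => f n x - g x) @[n --> \oo] --> 0.
Proof.
move=> hf Hf.
have /choice[N HN] : forall k : nat, exists N, forall m n, (N <= m)%N -> (N <= n)%N ->
   ip (fun x => f m x - f n x) (fun x => f m x - f n x) < (8^-1) ^+ k.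
  by move=> k; apply: Hf; rewrite exprn_gt0// invr_gt0.
(* [s k] dominates [N k] for the speed of the subsequence, and [k] so that it tends to infinity; it
   is nondecreasing by construction. *)
pose s := fix s k := if k is k'.+1 then maxn (s k') (maxn (N k) k) else N 0%N.
have sN k : (N k <= s k)%N by case: k => //= k; rewrite !leq_max leqnn orbT.
have sk k : (k <= s k)%N by case: k => //= k; rewrite !leq_max leqnn !orbT.
have sS k : (s k <= s k.+1)%N by rewrite /= leq_max leqnn.
have [g mg cg] := @sqint_fast_cvg (fun k => f (s k)) (fun k => hf _)
  (fun k => ltW (HN k _ _ (leq_trans (sN k) (sS k)) (sN k))).
have H e m : 0 < e -> (forall n, (m <= n)%N -> ip (fun x => f m x - f n x) (fun x => f m x - f n x) < e) ->
    (\int[mu]_x ((f m x - g x) ^+ 2)%:E <= e%:E)%E.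
  move=> e0 He.
  have : (\int[mu]_x (limn_einf (fun k => ((f m x - f (s k) x) ^+ 2)%:E)) <= e%:E)%E.
    apply: le_trans (fatou mu measurableT _ _) _.
    - move=> n; apply/measurable_EFinP; apply: measurable_funX.
      by apply: measurable_funB; [case: (hf m)|case: (hf (s n))].
    - by move=> n x _; rewrite lee_fin sqr_ge0.
    rewrite limn_einf_lim; apply: lime_le; first exact: is_cvg_einfs.
    exists m => // k /= mk; apply: ereal_inf_le.
    exists (\int[mu]_x ((f m x - f (s k) x) ^+ 2)%:E)%E; first by exists k => /=.
    rewrite -[leLHS]fineK; last by apply: integrable_fin_num => //; case: (sqintB (hf m) (hf (s k))).
    rewrite lee_fin; under eq_integral do rewrite expr2.
    by apply/ltW/He; rewrite (leq_trans mk).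
  apply: le_trans; rewrite le_eqVlt; apply/orP; left; apply/eqP.
  apply: ge0_ae_eq_integral => //.
  - apply/measurable_EFinP; apply: measurable_funX.
    by apply: measurable_funB => //; case: (hf m).
  - rewrite (_ : (fun x => _) = (fun x => - limn_esup (fun k => - ((f m x - f (s k) x) ^+ 2)%:E))%E).
      apply: measurableT_comp => //; apply: measurable_fun_limn_esup => n.
      apply: measurableT_comp => //; apply/measurable_EFinP; apply: measurable_funX.
      by apply: measurable_funB; [case: (hf m)|case: (hf (s n))].
    apply/funext => x; by rewrite [limn_esup _](limn_esupN (fun k => ((f m x - f (s k) x) ^+ 2)%:E)) oppeK.
  - by move=> x _; rewrite lee_fin sqr_ge0.
  - move=> x _; rewrite limn_einf_lim; apply: lime_ge; first exact: is_cvg_einfs.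
    by apply: nearW => n; apply: le_ereal_inf_tmp => _ [k _ <-]; rewrite lee_fin sqr_ge0.
  apply: filterS cg => x cx _; apply/esym.
  have c2 : ((f m x - f (s k) x) ^+ 2)%:E @[k --> \oo] --> ((f m x - g x) ^+ 2)%:E.
    apply: cvg_EFin; first exact: nearW.
    rewrite expr2; under eq_fun do rewrite expr2.
    by apply: cvgM; apply: cvgB => //; exact: cvg_cst.
  exact: (cvg_limn_einf_sup c2).1.
have hfg n : measurable_fun setT (fun x => f n x - g x).
  by apply: measurable_funB => //; case: (hf n).
have sg : sqint g.
  (* [g] is [f M] minus a difference whose squared norm is at most 1. *)
  have [M HM] := Hf 1 ltr01.
  have sM : sqint (fun x => f M x - g x).
    split=> //; apply/integrableP; split.
      by apply/measurable_EFinP; exact: measurable_funX.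
    under eq_integral do rewrite /= ger0_norm ?sqr_ge0//.
    apply: (@le_lt_trans _ _ 1%:E); last exact: ltry.
    by apply: H => // n Mn; exact: HM.
  have := sqintB (hf M) sM; congr sqint; apply/funext => x; ring.
exists g => //; apply/cvgr0Pnorm_le => e e0.
have [M HM] := Hf e e0; exists M => // m /= Mm.
rewrite ger0_norm ?ip_ge0// -lee_fin /ip /Rintegral fineK; last first.
  by apply: integrable_fin_num => //; apply: sqintM; exact: sqintB.
under eq_integral do rewrite -expr2.
by apply: H => // n mn; apply: HM => //; exact: leq_trans mn.
Qed.

End SquareIntegrable.

(** * Monodromy *)

Section Monodromy.
Variable R : realType.
Variables (U : set (plane R)) (delta : plane R -> plane R -> R).

(** [delta a b] models the increment from [a] to [b] of a potential that exists only locally; this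
    is the cocycle identity of such increments. *)
Definition additive_on (B : set (plane R)) : Prop :=
  forall a b c, B a -> B b -> B c -> delta a b + delta b c = delta a c.

Hypothesis delta_loc :
  forall z, U z -> exists2 r : R, 0 < r & additive_on (ball z r).

Lemma additive_on_refl B a : additive_on B -> B a -> delta a a = 0.
Proof. by move=> H Ba; apply: (@addrI _ (delta a a)); rewrite addr0; exact: H. Qed.

Lemma additive_on_sym B a b : additive_on B -> B a -> B b -> delta a b = - delta b a.
Proof.
move=> H Ba Bb; have := H a b a Ba Bb Ba; rewrite (additive_on_refl H Ba).
by move/eqP; rewrite addr_eq0 => /eqP.
Qed.

Lemma additive_on_chain B (q : nat -> plane R) m : additive_on B ->
  (forall i, (i <= m)%N -> B (q i)) ->
  \sum_(i < m) delta (q i) (q i.+1) = delta (q 0%N) (q m).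
Proof.
move=> H; elim: m => [|m IH] Bq.
  by rewrite big_ord0 (additive_on_refl H)//; exact: Bq.
rewrite big_ord_recr /= IH => [|i im]; last by apply: Bq; exact: leqW.
by apply: H; exact: Bq.
Qed.

(** A Lebesgue number: by compactness, one radius [e] serves at all points of [K]. The space [V] is
    the line for paths and the plane for homotopies. *)
Lemma additive_on_uniform (V : normedModType R) (K : set V) (H : V -> plane R) :
  compact K -> {within K, continuous H} -> H @` K `<=` U ->
  exists2 e : R, 0 < e & forall v, K v -> additive_on (H @` (K `&` ball v e)).
Proof.
move=> /compact_near_coveringP cK cH HU.
pose P (e : R) v := additive_on (H @` (K `&` ball v e)).
have : \forall e \near (0 : R)^'+, K `<=` P e.
  apply: cK => x Kx.
  have [r r0 ar] := delta_loc (HU _ (imageP _ Kx)).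
  have /subspace_continuousP/(_ x Kx) := cH.
  move/cvg_ballP/(_ r r0); rewrite near_withinE => /nbhs_ballP[s /= s0 bs].
  exists (ball x (s / 2), [set e | 0 < e < s / 2]) => /=.
    split; first by apply: nbhsx_ballx; rewrite divr_gt0.
    near=> e; apply/andP; split; near: e; first exact: nbhs_right_gt.
    by apply: nbhs_right_lt; rewrite divr_gt0.
  move=> [v e] /= [xv /andP[e0 es]] _ _ _ [a [Ka va] <-] [b [Kb vb] <-] [c [Kc vc] <-].
  have close y : ball v e y -> ball x s y.
    move=> vy; rewrite (splitr s); apply: ball_triangle xv _.
    by apply: le_ball vy; exact: ltW.
  by apply: ar; apply: bs => //; exact: close.
move=> KP; near (0 : R)^'+ => e; exists e; first by near: e; exact: nbhs_right_gt.
by near: e.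
Unshelve. all: by end_near. Qed.

Lemma sum_ord_mul (F : nat -> R) n m :
  \sum_(i < n * m) F i = \sum_(k < n) \sum_(j < m) F (k * m + j)%N.
Proof.
elim: n => [|n IH]; first by rewrite !big_ord0.
rewrite big_ord_recr /= -IH mulSnr -!(big_mkord xpredT F) (big_cat_nat (n := n * m)) ?leq_addr//=.
congr (_ + _); rewrite -{1}(add0n (n * m)%N) big_addn addKn big_mkord.
by apply: eq_bigr => j _; rewrite addnC.
Qed.

(** A discrete line integral, over equal steps of the parameter. *)
Definition path_sum (n : nat) (c : R -> plane R) : R :=
  \sum_(k < n) delta (c (k%:R / n%:R)) (c (k.+1%:R / n%:R)).

Definition path_in (c : R -> plane R) : Prop :=
  {within `[0, 1], continuous c} /\ c @` `[0, 1] `<=` U.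

Lemma div_itv01 (k n : nat) : (k <= n)%N -> (k%:R / n%:R : R) \in `[0, 1].
Proof.
move=> kn; rewrite in_itv /= divr_ge0//=.
have [->|n0] := posnP n; first by rewrite invr0 mulr0.
by rewrite ler_pdivrMr ?ltr0n// mul1r ler_nat.
Qed.

(** In a fine subdivision each step, with all its refinement points, lies in one additive set. The
    refinement into [m] pieces serves to compare two subdivisions; [m = 1] serves to reverse a
    single step. *)
Lemma path_uniform c : path_in c -> exists N : nat, forall n m k, (N <= n)%N -> (k < n)%N ->
  (0 < m)%N ->
  exists2 B, additive_on B & forall j, (j <= m)%N -> B (c ((k * m + j)%:R / (n * m)%:R)).
Proof.
move=> [cc cU].
have [e e0 He] := additive_on_uniform (segment_compact (a := 0) (b := 1)) cc cU.
have [N HN] : exists N : nat, e^-1 < N%:R.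
  by exists (Num.truncn e^-1).+1; rewrite truncnS_gt.
exists N => n m k Nn kn m0.
have n0 : (0 < n%:R :> R) by rewrite ltr0n (leq_ltn_trans _ kn).
have mR0 : (0 < m%:R :> R) by rewrite ltr0n.
have ne : n%:R^-1 < e.
  by rewrite invf_plt ?posrE// (lt_le_trans HN)// ler_nat.
exists (c @` (`[0, 1] `&` ball (k%:R / n%:R : R) e)).
  by apply: He; apply: div_itv01; exact: ltnW.
move=> j jm; exists ((k * m + j)%:R / (n * m)%:R : R) => //; split.
  apply: div_itv01; rewrite (@leq_trans (k * m + m))%N ?leq_add2l//.
  by rewrite -mulSnr leq_mul2r kn orbT.
rewrite /ball /= natrM natrD natrM.
have -> : k%:R / n%:R - (k%:R * m%:R + j%:R) / (n%:R * m%:R) = - (j%:R / m%:R / n%:R) :> R.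
  by field; rewrite ?gt_eqF.
rewrite normrN ger0_norm ?divr_ge0 ?ler0n//.
apply: le_lt_trans ne; rewrite ler_piMl ?invr_ge0 ?(ltW n0)//.
by rewrite ler_pdivrMr// mul1r ler_nat.
Qed.

Lemma path_sum_stable c : path_in c ->
  exists N : nat, exists v, forall n, (N <= n)%N -> path_sum n c = v.
Proof.
move=> pc; have [N HN] := path_uniform pc.
have H n m : (N <= n)%N -> (0 < m)%N -> path_sum (n * m) c = path_sum n c.
  move=> Nn m0; rewrite /path_sum.
  pose F i := delta (c (i%:R / (n * m)%:R)) (c (i.+1%:R / (n * m)%:R)).
  rewrite (sum_ord_mul F); apply: eq_bigr => k _.
  have [B aB HB] := HN n m k Nn (ltn_ord k) m0.
  rewrite /F; under eq_bigr do rewrite -addnS.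
  rewrite (additive_on_chain (q := fun j => c ((k * m + j)%:R / (n * m)%:R)) aB HB).
  have mu : m%:R != 0 :> R by rewrite pnatr_eq0 -lt0n.
  rewrite addn0 -mulSnr; congr (delta (c _) (c _)).
    by rewrite !natrM invfM mulrACA divff ?mulr1.
  by rewrite !natrM invfM mulrACA divff ?mulr1.
(* Subdivisions into [n] and [N.+1] steps have the common refinement [n * N.+1]; the successor makes
   both counts positive. *)
exists N.+1, (path_sum N.+1 c) => n Nn.
have n0 : (0 < n)%N by exact: leq_ltn_trans Nn.
have e1 := H n N.+1 (ltnW Nn) (ltn0Sn N); have e2 := H N.+1 n (leqnSn N) n0.
by rewrite -e1 -e2 [(n * _)%N]mulnC.
Qed.

(** The homotopy square is cut into [n * n] cells, each mapped into one additive set. Adjacent rows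
    then have equal sums; the first row is the loop and the last row is constant. *)
Lemma homotopic_path_sum0 c : null_homotopic U c ->
  exists N : nat, forall n, (N <= n)%N -> path_sum n c = 0.
Proof.
move=> [H [cH HU H0 H1 Hend]].
have cK : compact (`[0, 1] `*` `[0, 1] : set (plane R)).
  by apply: compact_setX; exact: segment_compact.
have [e e0 He] := additive_on_uniform cK cH HU.
have [N HN] : exists N : nat, e^-1 < N%:R.
  by exists (Num.truncn e^-1).+1; rewrite truncnS_gt.
exists N.+1 => n Nn.
have n0 : (0 < n)%N by rewrite (leq_ltn_trans _ Nn).
have nR0 : (0 < n%:R :> R) by rewrite ltr0n.
have ne : n%:R^-1 < e.
  by rewrite invf_plt ?posrE// (lt_le_trans HN)// ler_nat ltnW.
pose q (i k : nat) := H (i%:R / n%:R, k%:R / n%:R).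
have cell i k : (i < n)%N -> (k < n)%N -> exists2 B, additive_on B &
    forall i' k', (i' < 2)%N -> (k' < 2)%N -> B (q (i + i')%N (k + k')%N).
  move=> i_n k_n; exists (H @` ((`[0, 1] `*` `[0, 1]) `&` ball ((i%:R / n%:R, k%:R / n%:R) : plane R) e)).
    by apply: He; split; apply: div_itv01; exact: ltnW.
  move=> i' k' i'2 k'2; exists ((i + i')%:R / n%:R, (k + k')%:R / n%:R : R) => //; split.
    by split; apply: div_itv01; move: i'2 k'2; case: i' => [|[|//]]; case: k' => [|[|//]] _ _;
      rewrite ?addn0 ?addn1 //; exact: ltnW.
  have close (l l' : nat) : (l' < 2)%N -> `|l%:R / n%:R - (l + l')%:R / n%:R : R| < e.
    move=> l'2; rewrite -mulrBl natrD opprD addrA subrr add0r mulNr normrN.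
    rewrite ger0_norm ?divr_ge0 ?ler0n//; apply: le_lt_trans ne.
    by rewrite ler_piMl ?invr_ge0 ?(ltW nR0)// lern1 -ltnS.
  by split; rewrite /ball /=; exact: close.
have sq i : (i < n)%N -> \sum_(k < n) delta (q i.+1 k) (q i.+1 k.+1) =
    \sum_(k < n) delta (q i k) (q i k.+1).
  move=> i_n.
  (* The increments from one row to the next telescope, and both ends of every row are the base
     point [c 0]. *)
  have : \sum_(0 <= k < n) (delta (q i k.+1) (q i.+1 k.+1) - delta (q i k) (q i.+1 k)) = 0.
    rewrite (telescope_sumr (fun k => delta (q i k) (q i.+1 k)))//.
    rewrite /q divff ?gt_eqF// mul0r.
    have [E1 E2] := Hend _ (div_itv01 (ltnW i_n)); have [E3 E4] := Hend _ (div_itv01 i_n).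
    by rewrite E1 E2 E3 E4 subrr.
  rewrite big_mkord => s0; apply/eqP; rewrite -subr_eq0 -sumrB; apply/eqP.
  apply: etrans s0; apply: eq_bigr => k _.
  have [B aB HB] := cell i k i_n (ltn_ord k).
  have B00 : B (q i k) by rewrite -(addn0 i) -(addn0 k); exact: HB.
  have B01 : B (q i k.+1) by rewrite -(addn0 i) -(addn1 k); exact: HB.
  have B10 : B (q i.+1 k) by rewrite -(addn1 i) -(addn0 k); exact: HB.
  have B11 : B (q i.+1 k.+1) by rewrite -(addn1 i) -(addn1 k); exact: HB.
  have h1 := aB _ _ _ B00 B01 B11; have h2 := aB _ _ _ B00 B10 B11.
  lra.
have row i : (i <= n)%N -> \sum_(k < n) delta (q i k) (q i k.+1) =
    \sum_(k < n) delta (q 0%N k) (q 0%N k.+1).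
  by elim: i => // i IH i_n; rewrite sq// IH// ltnW.
have c0U : U (c 0).
  have [<- _] := Hend 0 ltac:(by rewrite in_itv /= lexx ler01).
  by apply: HU; exists (0, 0) => //; split; rewrite /= in_itv /= lexx ler01.
have [r r0 ar] := delta_loc c0U.
have -> : path_sum n c = \sum_(k < n) delta (q 0%N k) (q 0%N k.+1).
  apply: eq_bigr => k _; rewrite /q mul0r !H0//; apply: div_itv01 => //.
  exact: ltnW.
rewrite -(row n)// big1// => k _; rewrite /q divff ?gt_eqF// !H1; last 2 first.
- by apply: div_itv01.
- by apply: div_itv01; exact: ltnW.
by apply: (additive_on_refl ar); exact: ballxx.
Qed.


(** A path is continuous only within the unit interval; clamping its parameter makes it continuous
    on the line, so that paths can be joined by a formula. *)
Lemma continuous_clamp (c : R -> plane R) : {within `[0, 1], continuous c} ->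
  continuous (fun t : R => c (Num.max 0 (Num.min 1 t))).
Proof.
move=> /subspace_continuousP cc t.
have c01 (s : R) : Num.max 0 (Num.min 1 s) \in `[0, 1].
  by rewrite in_itv /= le_max lexx /= ge_max ler01 ge_min lexx.
have ct : {for t, continuous (fun s : R => Num.max 0 (Num.min 1 s))}.
  by apply: continuous_max; [exact: cvg_cst|apply: continuous_min; [exact: cvg_cst|exact: cvg_id]].
apply: cvg_trans (cc _ (c01 t)).
move=> A HA.
pose cl (s : R) : R := Num.max 0 (Num.min 1 s).
have HB : nbhs (cl t) (fun y => y \in `[0, 1] -> A (c y)) := HA.
have HC : \forall s \near t, cl s \in `[0, 1] -> A (c (cl s)) := ct _ HB.
have : \forall s \near t, A (c (cl s)).
  by move: HC; apply: filterS => s; apply; exact: c01.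
exact.
Qed.

(** The loop runs along [c], then along the segment from [a] to [b], then back along [c'], one third
    of the parameter each; with [3 * n] steps its subdivision points are those of the three
    pieces. *)
Lemma concat_paths (c c' : R -> plane R) (a b : plane R) :
  path_in c -> path_in c' -> c 0 = c' 0 -> c 1 = a -> c' 1 = b ->
  (forall t, t \in `[0, 1] -> U (a + t *: (b - a))) ->
  exists2 g, loop U g & forall n k : nat, (0 < n)%N -> (k <= n)%N ->
    [/\ g (k%:R / (3 * n)%:R) = c (k%:R / n%:R),
        g ((n + k)%:R / (3 * n)%:R) = a + (k%:R / n%:R) *: (b - a) &
        g ((n + n + k)%:R / (3 * n)%:R) = c' ((n - k)%:R / n%:R)].
Proof.
move=> [cc cU] [cc' cU'] c0 c1 c1' sU.
pose cl (t : R) : R := Num.max 0 (Num.min 1 t).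
have cl01 (s : R) : cl s \in `[0, 1].
  by rewrite in_itv /= le_max lexx /= ge_max ler01 ge_min lexx.
have clid (s : R) : 0 <= s -> s <= 1 -> cl s = s.
  by move=> s0 s1; rewrite /cl (min_r s1) (max_r s0).
have cl0 (s : R) : s <= 0 -> cl s = 0.
  by move=> s0; rewrite /cl min_r ?max_l// (le_trans s0).
have cl1 (s : R) : 1 <= s -> cl s = 1 by move=> s1; rewrite /cl min_l// max_r.
(* On each third only one of the three summands varies; the constant values of the others cancel. *)
pose g t := c (cl (3 * t)) + cl (3 * t - 1) *: (b - a) + (c' (cl (3 - 3 * t)) - b).
have gA t : t <= 3^-1 -> g t = c (cl (3 * t)).
  move=> t3; rewrite /g (cl0 (3 * t - 1)) ?scale0r ?addr0; last by lra.
  by rewrite (cl1 (3 - 3 * t)) ?c1' ?subrr ?addr0//; lra.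
have gB t : 3^-1 <= t <= 2 / 3 -> g t = a + cl (3 * t - 1) *: (b - a).
  move=> t3; rewrite /g (cl1 (3 * t)) ?c1; last by lra.
  by rewrite (cl1 (3 - 3 * t)) ?c1' ?subrr ?addr0//; lra.
have gC t : 2 / 3 <= t -> g t = c' (cl (3 - 3 * t)).
  move=> t3; rewrite /g (cl1 (3 * t)) ?c1; last by lra.
  rewrite (cl1 (3 * t - 1)) ?scale1r; last by lra.
  by rewrite [a + _]addrC subrK addrC subrK.
have cg : continuous g.
  have cA (f : R -> R) (k : R -> plane R) : {within `[0, 1], continuous k} ->
      continuous f -> continuous (fun t => k (cl (f t))).
    by move=> ck cf t; apply: (@continuous_comp _ _ _ f (fun s => k (cl s)) t (cf t)); exact: continuous_clamp.
  have c3 : continuous (fun t : R => 3 * t).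
    by move=> t; apply: cvgM; [exact: cvg_cst|exact: cvg_id].
  move=> t; apply: cvgD; first apply: cvgD.
  - exact: (cA (fun t => 3 * t)).
  - apply: cvgZr_tmp; rewrite /cl; apply: (@continuous_max R R (fun=> 0) (fun t => Num.min 1 (3 * t - 1))).
      exact: cvg_cst.
    apply: (@continuous_min R R (fun=> 1) (fun t => 3 * t - 1)); first exact: cvg_cst.
    by apply: cvgB; [exact: c3|exact: cvg_cst].
  - apply: cvgB; last exact: cvg_cst.
    apply: (cA (fun t => 3 - 3 * t)) => // s.
    by apply: cvgB; [exact: cvg_cst|exact: c3].
exists g.
  split; first exact: continuous_subspaceT.
    move=> _ [t _ <-]; case: (leP t 3^-1) => t3.
      by rewrite gA//; apply: cU; exists (cl (3 * t)) => //; exact: cl01.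
    case: (leP t (2 / 3)) => t23; first by rewrite gB ?(ltW t3)//; exact/sU/cl01.
    rewrite gC ?ltW//; apply: cU'; exists (cl (3 - 3 * t)) => //; exact: cl01.
  rewrite gA ?invr_ge0// gC; last by lra.
  by rewrite mulr0 mulr1 subrr cl0.
move=> n k n0 kn; have nR : (0 < n%:R :> R) by rewrite ltr0n.
have k0 : 0 <= k%:R / n%:R :> R by rewrite divr_ge0.
have k1 : k%:R / n%:R <= 1 :> R by rewrite ler_pdivrMr// mul1r ler_nat.
have n3 m : (n * m + k)%:R / (3 * n)%:R = (m%:R + k%:R / n%:R) / 3 :> R.
  by rewrite natrD !natrM; field; rewrite gt_eqF.
split.
- have := n3 0%N; rewrite muln0 add0n add0r => ->.
  rewrite gA; last by lra.
  by rewrite [3 * _]mulrC divfK ?pnatr_eq0// clid.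
- have := n3 1%N; rewrite muln1 => ->; rewrite gB; last by lra.
  by rewrite [3 * _]mulrC divfK ?pnatr_eq0// [1 + _]addrC addrK clid.
have := n3 2%N; rewrite mulnC mul2n -addnn => ->.
rewrite gC; last by lra.
rewrite [3 * _]mulrC divfK ?pnatr_eq0// natrB// mulrBl divff ?gt_eqF//.
rewrite (_ : 3 - _ = 1 - k%:R / n%:R); last by ring.
by rewrite clid //; lra.
Qed.

Hypothesis openU : open U.
Hypothesis scU : simply_connected U.

Lemma segment_ball (z a b : plane R) r : ball z r a -> ball z r b ->
  forall t : R, t \in `[0, 1] -> ball z r (a + t *: (b - a)).
Proof.
move=> za zb t; rewrite in_itv /= => /andP[t0 t1].
have H (z' a' b' : R) : `|z' - a'| < r -> `|z' - b'| < r -> `|z' - (a' + t * (b' - a'))| < r.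
  move=> Xr Yr; pose m := Num.max `|z' - a'| `|z' - b'|.
  apply: (@le_lt_trans _ _ m); last by rewrite gt_max Xr.
  have : `|z' - a'| <= m by rewrite le_max lexx.
  have : `|z' - b'| <= m by rewrite le_max lexx orbT.
  by rewrite !ler_norml => /andP[? ?] /andP[? ?]; apply/andP; split; nra.
by case: za zb => /= za1 za2 [/= zb1 zb2]; split; exact: H.
Qed.

(** [p x] is the stable value of the path sums along a chosen path from [x0] to [x]. The loop
    through [a] and [b] is null-homotopic, so its sum [p a + delta a b - p b] vanishes. *)
Lemma global_potential : exists p : plane R -> R,
  forall z, U z -> exists2 r : R, 0 < r & ball z r `<=` U /\
    forall a b, ball z r a -> ball z r b -> p b - p a = delta a b.
Proof.
have [U0|/set0P[x0 Ux0]] := eqVneq U set0.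
  by exists (fun=> 0) => z; rewrite U0.
have /choice[cc Hcc] : forall x, exists c, U x -> [/\ path_in c, c 0 = x0 & c 1 = x].
  move=> x; have [Ux|] := pselect (U x); last by exists (fun=> x0).
  by have [c [c1 c2 c3 c4]] := scU.1 x0 x Ux0 Ux; exists c.
have /choice[p Hp] : forall x, exists v, U x ->
    exists N : nat, forall n, (N <= n)%N -> path_sum n (cc x) = v.
  move=> x; have [Ux|] := pselect (U x); last by exists 0.
  have [pc _ _] := Hcc x Ux.
  by have [N [v Hv]] := path_sum_stable pc; exists v => _; exists N.
exists p => z Uz.
have [r1 r10 ar] := delta_loc Uz.
have /nbhs_ballP[r2 /= r20 br2] := open_nbhs_nbhs (conj openU Uz).
exists (Num.min r1 r2); first by rewrite lt_min r10.
have sU : ball z (Num.min r1 r2) `<=` U.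
  by move=> a za; apply: br2; apply: le_ball za; rewrite ge_min lexx orbT.
split=> // a b za zb.
have {}ar : additive_on (ball z (Num.min r1 r2)).
  have s1 : ball z (Num.min r1 r2) `<=` ball z r1 by apply: le_ball; rewrite ge_min lexx.
  by move=> u v w zu zv zw; apply: ar; exact: s1.
have Ua := sU _ za; have Ub := sU _ zb.
have [pa a0 a1] := Hcc a Ua; have [pb b0 b1] := Hcc b Ub.
have [Na HNa] := Hp a Ua; have [Nb HNb] := Hp b Ub.
have seg := segment_ball za zb.
have [g lg Hg] := concat_paths pa pb (etrans a0 (esym b0)) a1 b1 (fun t t01 => sU _ (seg t t01)).
have [Ng HNg] := homotopic_path_sum0 (scU.2 g lg).
have [Nu HNu] := path_uniform pb.
(* Beyond four thresholds: those of the path sums to [a] and to [b], that of the loop, and the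
   fineness needed to reverse the steps towards [b]. *)
pose n := (maxn (maxn Na Nb) (maxn Ng Nu)).+1.
have [nNa nNb nNg nNu] : [/\ Na <= n, Nb <= n, Ng <= n & Nu <= n]%N.
  by split; rewrite ltnW// ltnS !leq_max leqnn ?orbT.
have n0 : (0 < n)%N by [].
have := HNg (3 * n)%N ltac:(by rewrite (leq_trans nNg)// leq_pmull).
pose F i := delta (g (i%:R / (3 * n)%:R)) (g (i.+1%:R / (3 * n)%:R)).
pose G k := \sum_(j < n) F (k * n + j)%N.
have G3 : \sum_(k < 3) G k = G 0%N + (G 1%N + G 2%N).
  by move: G => G; rewrite !big_ord_recl big_ord0 addr0.
rewrite /path_sum (sum_ord_mul F) [LHS]G3 /G.
have -> : \sum_(j < n) F (0 * n + j)%N = p a.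
  rewrite -(HNa n)//; apply: eq_bigr => j _; rewrite /F mul0n add0n.
  by have [-> _ _] := Hg n j n0 (ltnW (ltn_ord j)); have [-> _ _] := Hg n j.+1 n0 (ltn_ord j).
have -> : \sum_(j < n) F (1 * n + j)%N = delta a b.
  pose q (k : nat) := a + (k%:R / n%:R) *: (b - a).
  transitivity (\sum_(j < n) delta (q j) (q j.+1)).
    apply: eq_bigr => j _; rewrite /F mul1n -addnS.
    by have [_ -> _] := Hg n j n0 (ltnW (ltn_ord j)); have [_ -> _] := Hg n j.+1 n0 (ltn_ord j).
  rewrite (additive_on_chain (q := q) ar) => [|i i_n]; last exact/seg/div_itv01.
  by rewrite /q mul0r scale0r addr0 divff ?pnatr_eq0// scale1r addrC subrK.
have -> : \sum_(j < n) F (2 * n + j)%N = - p b.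
  rewrite -(HNb n)// /path_sum -sumrN (reindex_inj rev_ord_inj) /=.
  apply: eq_bigr => j _; rewrite /F mul2n -addnn -addnS.
  have jn := ltn_ord j.
  have [_ _ ->] := Hg n (n - j.+1)%N n0 (leq_subr _ _).
  have [_ _ ->] := Hg n (n - j.+1).+1 n0 ltac:(by rewrite subnSK// leq_subr).
  rewrite subnSK// !subKn// ?(ltnW jn)//.
  (* Antisymmetry of [delta] holds only inside one additive set, which the fineness provides for
     each single step. *)
  have [B aB HB] := HNu n 1%N j nNu jn (ltn0Sn 0).
  have := HB 0%N isT; have := HB 1%N isT; rewrite !muln1 addn0 addn1 => B1 B0.
  exact: (additive_on_sym aB).
by move=> H; lra.
Qed.

End Monodromy.

(** * Smooth functions and test functions *)

Section FlatExponential.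
Variable R : realType.
Implicit Types (P : {poly R}) (x : R).

Definition flat P (x : R) : R := if 0 < x then P.[x^-1] * expR (- x^-1) else 0.

(** From [(P(1/x) exp(-1/x))' = x^-2 (P - P')(1/x) exp(-1/x)]: the family [flat] is stable under
    differentiation. *)
Definition flat_deriv P : {poly R} := 'X^2 * (P - deriv P).

Lemma expRN_le_inv_exp n (u : R) : 0 <= u -> u ^+ n * expR (- u) <= n`!%:R.
Proof.
move=> u0; rewrite expRN ler_pdivrMr ?expR_gt0//.
case: n => [|n]; first by rewrite expr0 fact0 mul1r -expR0 ler_expR.
rewrite mulrC -ler_pdivrMr ?ltr0n ?fact_gt0//.
by apply: le_trans (expR_ge1Dxn n u0); rewrite lerDr.
Qed.

(** With [u = x^-1], the product [u^(i+2) exp(-u)] is at most [(i+2)!]. The order two makes the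
    derivative at the origin vanish. *)
Lemma flat_quadratic P : exists2 C, 0 <= C & forall x, `|flat P x| <= C * x ^+ 2.
Proof.
exists (\sum_(i < size P) `|P`_i| * (i + 2)`!%:R).
  by apply: sumr_ge0 => i _; rewrite mulr_ge0.
move=> x; rewrite /flat; case: ifPn => [x0|_]; last first.
  by rewrite normr0 mulr_ge0 ?sqr_ge0//; apply: sumr_ge0 => i _; rewrite mulr_ge0.
have xV0 : 0 < x^-1 by rewrite invr_gt0.
rewrite horner_coef mulr_suml mulr_suml.
apply: le_trans (ler_norm_sum _ _ _) _; apply: ler_sum => i _.
rewrite -ler_pdivrMr ?exprn_gt0//.
rewrite !normrM (ger0_norm (ltW (expR_gt0 _))) (ger0_norm (exprn_ge0 _ (ltW xV0))).
rewrite -exprVn -!mulrA ler_wpM2l// mulrC -mulrA -exprD mulrC addnC.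
by rewrite expRN_le_inv_exp// ltW.
Qed.

Lemma flat_le0 P x : x <= 0 -> flat P x = 0.
Proof. by move=> x0; rewrite /flat ltNge x0. Qed.

Lemma is_derive_flat P x : is_derive x 1 (flat P) (flat (flat_deriv P) x).
Proof.
have [x0|x0|->] := ltgtP x 0.
- rewrite [X in is_derive _ _ _ X](flat_le0 _ (ltW x0)).
  apply: (near_eq_is_derive _ (is_derive_cst (0 : R) x 1)).
  have : \forall y \near x, y < 0 by exact: lt_nbhsl.
  by apply: filterS => y y0; rewrite flat_le0// ltW.
- pose g (y : R) := P.[y^-1] * expR (- y^-1).
  apply: (@near_eq_is_derive _ _ _ g).
    have : \forall y \near x, 0 < y by exact: lt_nbhsr.
    by apply: filterS => y y0; rewrite /flat y0.
  have dV : is_derive x (1 : R) (fun y : R => y^-1) (- x ^- 2).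
    have := @is_deriveV R id x 1 1 ltac:(by rewrite gt_eqF) (is_derive_id _ _).
    by rewrite [- _ *: 1]mulr1.
  have dP := is_derive1_comp (is_derive_poly P x^-1) dV.
  have dE : is_derive x (1 : R) (fun y : R => expR (- y^-1)) (expR (- x^-1) * x ^- 2).
    have := @is_derive1_comp R expR (fun y : R => - y^-1) x _ _ (is_derive_expR (- x^-1)) (is_deriveN dV).
    by rewrite opprK.
  have := is_deriveM dP dE; congr (is_derive _ _ _ _).
  rewrite /flat x0 /flat_deriv !hornerE /= /GRing.scale /= exprVn; ring.
rewrite (flat_le0 _ (lexx 0)); have [C C0 HC] := flat_quadratic P.
(* Caratheodory's criterion with the quotient [flat P y / y]: its value at the origin is 0 because
   [0^-1 = 0], and it tends to 0 by the quadratic bound. *)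
apply/is_derive1_caratheodory; exists (fun y => flat P y / y); split.
- move=> z; rewrite (flat_le0 _ (lexx 0)) !subr0; have [->|z0] := eqVneq z 0.
    by rewrite mulr0 flat_le0.
  by rewrite divfK.
- suff : flat P y / y @[y --> (0 : R)] --> (0 : R).
    by rewrite -[X in _ --> X -> _](mulr0 (flat P 0)) -{3}(invr0 R).
  apply/cvgr0Pnorm_le => e e0.
  have : \forall y \near (0 : R), `|y| < e / (C + 1).
    apply: nbhs0_lt; rewrite divr_gt0// ltr_wpDl//.
  apply: filterS => y ye; have [->|y0] := eqVneq y 0.
    by rewrite invr0 mulr0 normr0 ltW.
  rewrite normrM normfV ler_pdivrMr ?normr_gt0//.
  apply: le_trans (HC y) _; rewrite -real_normK ?num_real// expr2 mulrA ler_wpM2r//.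
  move: ye; rewrite ltr_pdivlMr ?ltr_wpDl// => ye.
  by apply: le_trans (ltW ye); rewrite mulrC ler_wpM2l// lerDl.
- by rewrite invr0 mulr0.
Qed.

End FlatExponential.

Section SmoothClass.
Variable R : realType.

Lemma is_derive0P (f : field R) x y l :
  is_derive (x, y) (basis R 0) f l <-> is_derive x 1 (fun t => f (t, y)) l.
Proof.
split=> [] [d e]; split.
- exact/derivable0E.
- by rewrite -e -derive1E -partial0E.
- exact/derivable0E.
- by rewrite -e -derive1E -partial0E.
Qed.

Lemma is_derive1P (f : field R) x y l :
  is_derive (x, y) (basis R 1) f l <-> is_derive y 1 (fun t => f (x, t)) l.
Proof.
split=> [] [d e]; split.
- exact/derivable1E.
- by rewrite -e -derive1E -partial1E.
- exact/derivable1E.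
- by rewrite -e -derive1E -partial1E.
Qed.

Lemma ord2P (j : 'I_2) : j = 0 \/ j = 1.
Proof. by case: j; case=> [|[|//]] ?; [left|right]; exact: val_inj. Qed.

Lemma is_derive_basis_comp (h : R -> R) (f : field R) z (j : 'I_2) a b :
  is_derive (f z) 1 h a -> is_derive z (basis R j) f b ->
  is_derive z (basis R j) (fun w => h (f w)) (a * b).
Proof.
case: z => x y dh; have [->|->] := ord2P j.
  by move=> /is_derive0P df; apply/is_derive0P; exact: (is_derive1_comp dh df).
by move=> /is_derive1P df; apply/is_derive1P; exact: (is_derive1_comp dh df).
Qed.

(** A syntactic class containing the kernels and bumps used below. Smoothness and the symmetry of
    second derivatives follow by induction on its constructors. *)
Inductive smooth_class : field R -> Prop :=
| SmoothCst c : smooth_class (fun=> c)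
| SmoothFst : smooth_class fst
| SmoothSnd : smooth_class snd
| SmoothAdd f g : smooth_class f -> smooth_class g -> smooth_class (fun z => f z + g z)
| SmoothMul f g : smooth_class f -> smooth_class g -> smooth_class (fun z => f z * g z)
| SmoothFlat P f : smooth_class f -> smooth_class (fun z => flat P (f z)).

Lemma smooth_class_derive f (j : 'I_2) : smooth_class f ->
  exists2 f', smooth_class f' & forall z, is_derive z (basis R j) f (f' z).
Proof.
elim=> [c|||{}f g sf [f' sf' df] sg [g' sg' dg]|{}f g sf [f' sf' df] sg [g' sg' dg]|
  P {}f sf [f' sf' df]].
- exists (fun=> 0); first exact: SmoothCst.
  by move=> z; exact: is_derive_cst.
- exists (fun=> (j == 0)%:R); first exact: SmoothCst.
  move=> [x y]; have [->|->] := ord2P j; [apply/is_derive0P|apply/is_derive1P].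
  exact: (is_derive_cst x y 1).
- exists (fun=> (j == 1)%:R); first exact: SmoothCst.
  move=> [x y]; have [->|->] := ord2P j; [apply/is_derive0P|apply/is_derive1P].
  exact: (is_derive_cst y x 1).
- exists (fun z => f' z + g' z); first exact: SmoothAdd.
  by move=> z; exact: is_deriveD.
- exists (fun z => f z * g' z + g z * f' z).
    by apply: SmoothAdd; exact: SmoothMul.
  by move=> z; exact: is_deriveM.
- exists (fun z => flat (flat_deriv P) (f z) * f' z).
    by apply: SmoothMul => //; exact: SmoothFlat.
  by move=> z; apply: is_derive_basis_comp => //; exact: is_derive_flat.
Qed.

Lemma smooth_class_continuous f : smooth_class f -> continuous f.
Proof.
elim=> [c|||{}f g _ cf _ cg|{}f g _ cf _ cg|P {}f _ cf] z.
- exact: cvg_cst.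
- exact: cvg_fst.
- exact: cvg_snd.
- by apply: cvgD; [exact: cf|exact: cg].
- by apply: cvgM; [exact: cf|exact: cg].
- apply: (@continuous_comp _ _ _ f (flat P)); first exact: cf.
  apply/differentiable_continuous/derivable1_diffP.
  by have [] := is_derive_flat P (f z).
Qed.

Lemma smooth_class_partial f j : smooth_class f -> smooth_class (partial j f).
Proof.
move=> sf; have [f' sf' df] := smooth_class_derive j sf.
by rewrite (_ : partial j f = f') //; apply/funext => z; have [_ <-] := df z.
Qed.

Lemma smooth_class_smooth f : smooth_class f -> smooth f.
Proof.
move=> sf js g; have sg : smooth_class g.
  by rewrite /g; elim: js {g} => //= j js; exact: smooth_class_partial.
split; first exact: smooth_class_continuous.
by move=> j x; have [f' _ df] := smooth_class_derive j sg; have [] := df x.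
Qed.


Lemma smooth_class_partialE f j z : smooth_class f -> is_derive z (basis R j) f (partial j f z).
Proof. by move=> sf; have [f' _ df] := smooth_class_derive j sf; split; have [] := df z. Qed.

(** By induction on the class: the sum, product and chain rules expand both mixed derivatives into
    the same expression, up to the induction hypotheses. *)
Lemma partial_schwarz f : smooth_class f -> partial 0 (partial 1 f) = partial 1 (partial 0 f).
Proof.
move: f; have cst0 (c : R) j : partial j (fun=> c) = fun=> 0.
  by apply/funext => z; exact: derive_cst.
have add f g j : smooth_class f -> smooth_class g ->
    partial j (fun z => f z + g z) = fun z => partial j f z + partial j g z.
  move=> sf sg; apply/funext => z.
  by have [_ e] := is_deriveD (smooth_class_partialE j z sf) (smooth_class_partialE j z sg); exact: e.
have mul f g j : smooth_class f -> smooth_class g ->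
    partial j (fun z => f z * g z) = fun z => f z * partial j g z + g z * partial j f z.
  move=> sf sg; apply/funext => z.
  by have [_ e] := is_deriveM (smooth_class_partialE j z sf) (smooth_class_partialE j z sg); exact: e.
have fl P f j : smooth_class f ->
    partial j (fun z => flat P (f z)) = fun z => flat (flat_deriv P) (f z) * partial j f z.
  move=> sf; apply/funext => z.
  by have [_ e] := is_derive_basis_comp (is_derive_flat P (f z)) (smooth_class_partialE j z sf); exact: e.
have coord0 j : partial j (fst : field R) = fun=> (j == 0)%:R.
  apply/funext => -[x y]; have [->|->] := ord2P j.
    by rewrite partial0E derive1E; exact: derive_id.
  by rewrite partial1E derive1E; exact: (derive_cst x y 1).
have coord1 j : partial j (snd : field R) = fun=> (j == 1)%:R.
  apply/funext => -[x y]; have [->|->] := ord2P j.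
    by rewrite partial0E derive1E; exact: (derive_cst y x 1).
  by rewrite partial1E derive1E; exact: derive_id.
have sp h j : smooth_class h -> smooth_class (partial j h) by exact: smooth_class_partial.
have add2 f g i j : smooth_class f -> smooth_class g ->
    partial i (partial j (fun z => f z + g z)) =
    fun z => partial i (partial j f) z + partial i (partial j g) z.
  move=> sf sg; apply: (etrans (congr1 (partial i) (add f g j sf sg))).
  exact: add (sp _ j sf) (sp _ j sg).
have mul2 f g i j : smooth_class f -> smooth_class g ->
    partial i (partial j (fun z => f z * g z)) = fun z =>
    (f z * partial i (partial j g) z + partial j g z * partial i f z) +
    (g z * partial i (partial j f) z + partial j f z * partial i g z).
  move=> sf sg; apply: (etrans (congr1 (partial i) (mul f g j sf sg))).
  apply: (etrans (add _ _ i (SmoothMul sf (sp _ j sg)) (SmoothMul sg (sp _ j sf)))).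
  exact: (congr2 (fun a b => fun z => a z + b z) (mul _ _ i sf (sp _ j sg)) (mul _ _ i sg (sp _ j sf))).
have fl2 P f i j : smooth_class f -> partial i (partial j (fun z => flat P (f z))) = fun z =>
    flat (flat_deriv P) (f z) * partial i (partial j f) z +
    partial j f z * (flat (flat_deriv (flat_deriv P)) (f z) * partial i f z).
  move=> sf; apply: (etrans (congr1 (partial i) (fl P f j sf))).
  apply: (etrans (mul _ _ i (SmoothFlat (flat_deriv P) sf) (sp _ j sf))).
  exact: (congr1 (fun a => fun z => _ + _ * a z) (fl _ _ i sf)).
move=> f0; elim=> [c|||f g sf ef sg eg|f g sf ef sg eg|P f sf ef].
- by rewrite !cst0.
- by rewrite !coord0 !cst0.
- by rewrite !coord1 !cst0.
- apply: (etrans (add2 f g 0 1 sf sg)); apply: etrans (esym (add2 f g 1 0 sf sg)).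
  exact: (congr2 (fun a b => fun z => a z + b z) ef eg).
- apply: (etrans (mul2 f g 0 1 sf sg)); apply: etrans (esym (mul2 f g 1 0 sf sg)).
  have alg (u v a b p q r s : R) :
    (u * a + p * q) + (v * b + r * s) = (u * a + s * r) + (v * b + q * p) by ring.
  apply/funext => z; apply: (etrans (alg _ _ _ _ _ _ _ _)).
  exact: (congr2 (fun a b => (f z * a + partial 0 g z * partial 1 f z) +
    (g z * b + partial 0 f z * partial 1 g z)) (congr1 (@^~ z) eg) (congr1 (@^~ z) ef)).
- apply: (etrans (fl2 P f 0 1 sf)); apply: etrans (esym (fl2 P f 1 0 sf)).
  have alg (u a p v q : R) : u * a + p * (v * q) = u * a + q * (v * p) by ring.
  apply/funext => z; apply: (etrans (alg _ _ _ _ _)).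
  exact: (congr1 (fun a => flat (flat_deriv P) (f z) * a + partial 0 f z *
    (flat (flat_deriv (flat_deriv P)) (f z) * partial 1 f z)) (congr1 (@^~ z) ef)).
Qed.

Lemma smooth_partial (f : field R) j : smooth f -> smooth (partial j f).
Proof.
move=> sf js; have := sf (rcons js j).
by rewrite -cats1 foldr_cat.
Qed.

Lemma smooth_continuous (f : field R) : smooth f -> continuous f.
Proof. by move=> /(_ [::]) []. Qed.

Lemma smooth_is_derive (f : field R) j z : smooth f -> is_derive z (basis R j) f (partial j f z).
Proof. by move=> /(_ [::]) [_ df]; split. Qed.

Lemma partialD (f g : field R) j : smooth f -> smooth g ->
  partial j (f + g) = partial j f + partial j g.
Proof.
move=> sf sg; apply/funext => z.
by have [_ e] := is_deriveD (smooth_is_derive j z sf) (smooth_is_derive j z sg); exact: e.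
Qed.

Lemma partialZ (a : R) (f : field R) j : smooth f -> partial j (a *: f) = a *: partial j f.
Proof.
move=> sf; apply/funext => z.
by have [_ e] := is_deriveZ a (smooth_is_derive j z sf); exact: e.
Qed.

Lemma smoothD (f g : field R) : smooth f -> smooth g -> smooth (f + g).
Proof.
move=> sf sg js.
have : foldr (@partial R) (f + g) js = foldr (@partial R) f js + foldr (@partial R) g js /\
    (smooth (foldr (@partial R) f js) /\ smooth (foldr (@partial R) g js)).
  elim: js => [|j js [e [sf' sg']]]; first by split; [|split].
  rewrite [LHS]/=.
  rewrite e (partialD j sf' sg'); split; first by [].
  exact: (conj (smooth_partial j sf') (smooth_partial j sg')).
move=> [/= -> [sf' sg']]; split=> [z|j z].
  by apply: cvgD; exact: smooth_continuous.
by apply: derivableD; [case: (smooth_is_derive j z sf')|case: (smooth_is_derive j z sg')].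
Qed.

Lemma smoothZ (a : R) (f : field R) : smooth f -> smooth (a *: f).
Proof.
move=> sf js.
have : foldr (@partial R) (a *: f) js = a *: foldr (@partial R) f js /\ smooth (foldr (@partial R) f js).
  elim: js => [//|j js [e sf']] /=.
  by rewrite e (partialZ a j sf'); split; [|exact: (smooth_partial j sf')].
move=> [/= -> sf']; split=> [z|j z].
  by apply: cvgZl_tmp; exact: smooth_continuous.
by apply: derivableZ; case: (smooth_is_derive j z sf').
Qed.

Definition support (f : field R) : set (plane R) := closure [set x | f x != 0].

Lemma notin_support (f : field R) x : ~ support f x -> \forall y \near x, f y = 0.
Proof.
move=> nfx.
have : open_nbhs x (~` support f) by split=> //; apply: closed_openC; exact: closed_closure.
move=> /open_nbhs_nbhs; apply: filterS => y nfy.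
by apply/eqP/negPn/negP => fy; apply: nfy; exact: subset_closure.
Qed.

Lemma support_sub (f : field R) A : closed A -> [set x | f x != 0] `<=` A -> support f `<=` A.
Proof. by move=> cA /closureS; rewrite -((closure_id A).1 cA). Qed.

Lemma support_partial (f : field R) j : support (partial j f) `<=` support f.
Proof.
apply: support_sub; first exact: closed_closure.
move=> x /=; apply: contraPP => /notin_support fx0.
apply/negP; rewrite negbK /partial -(derive_cst (0 : R) x (basis R j)).
by apply/eqP; exact: near_eq_derive.
Qed.

Section TestFunctions.
Variable U : set (plane R).

Lemma test_functionI (f : field R) K : smooth f -> compact K -> K `<=` U ->
  [set x | f x != 0] `<=` K -> test_function U f.
Proof.
move=> sf cK KU fK.
have sK : support f `<=` K.
  by apply: support_sub => //; apply: compact_closed => //; exact: norm_hausdorff.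
split=> //; last exact: subset_trans KU.
by apply: subclosed_compact cK sK; exact: closed_closure.
Qed.

Lemma test_partial (f : field R) j : test_function U f -> test_function U (partial j f).
Proof.
move=> [sf cf fU]; apply: (test_functionI _ cf fU); first exact: smooth_partial.
by apply: subset_trans (@support_partial f j); exact: subset_closure.
Qed.

Lemma testD (f g : field R) : test_function U f -> test_function U g -> test_function U (f + g).
Proof.
move=> [sf cf fU] [sg cg gU].
apply: (test_functionI (smoothD sf sg) (compactU cf cg)).
  by move=> x [/fU|/gU].
move=> x /=; have [/eqP fx0|fx0 _] := boolP (f x == 0); last first.
  by left; exact: subset_closure.
have -> : (f + g) x = g x by rewrite -[LHS]/(f x + g x) fx0 add0r.
by move=> gx0; right; exact: subset_closure.
Qed.

Lemma testZ (a : R) (f : field R) : test_function U f -> test_function U (a *: f).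
Proof.
move=> [sf cf fU]; apply: (test_functionI (smoothZ a sf) cf fU).
move=> x /=; rewrite [(a *: f) x]/(a * f x) mulf_eq0 negb_or => /andP[_ fx0].
exact: subset_closure.
Qed.

Lemma test0 : test_function U 0.
Proof.
apply: (@test_functionI 0 set0) => [|||x /=].
- by apply: smooth_class_smooth; exact: (SmoothCst 0).
- exact: compact0.
- by [].
- by rewrite eqxx.
Qed.

Lemma test_supp (f : field R) x : test_function U f -> ~ U x -> f x = 0.
Proof.
move=> [_ _ fU] nUx; apply/eqP/negPn/negP => fx; apply: nUx; apply: fU.
exact: subset_closure.
Qed.

Lemma test_box (f : field R) : test_function U f ->
  exists2 M : R, 0 < M & forall z, ~ cbox M z -> f z = 0.
Proof.
move=> [_ cf _]; have [M M0 HM] := bounded_sub_cbox (compact_bounded cf).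
exists M => // z nMz; apply/eqP/negPn/negP => fz; apply/nMz/HM.
exact: subset_closure.
Qed.

Lemma continuous_compact_support_bounded (f : field R) (M : R) : continuous f ->
  (forall z, ~ cbox M z -> f z = 0) -> exists2 B : R, 0 < B & forall z, `|f z| <= B.
Proof.
move=> cf f0; have /compact_bounded [B [_ HB]] : compact (f @` cbox M).
  apply: continuous_compact; first exact: continuous_subspaceT.
  by apply: compact_setX; exact: segment_compact.
exists (`|B| + 1); first by rewrite ltr_wpDl.
move=> z; have [zM|/f0 ->] := pselect (cbox M z); last by rewrite normr0 addr_ge0.
by apply: (HB (`|B| + 1)); [rewrite (le_lt_trans (ler_norm _)) ?ltrDl|exists z].
Qed.

Lemma itg_continuous_compact_support (f : field R) (M : R) : continuous f ->
  (forall z, ~ cbox M z -> f z = 0) -> itg f.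
Proof.
move=> cf f0; have [B _ HB] := continuous_compact_support_bounded cf f0.
by apply: (itg_bounded_cbox _ HB f0); exact: continuous_measurable_plane.
Qed.

Lemma sqint_continuous_compact_support (f : field R) (M : R) : continuous f ->
  (forall z, ~ cbox M z -> f z = 0) -> sqint (leb2 R) f.
Proof.
move=> cf f0; split; first exact: continuous_measurable_plane.
have -> : (fun x => f x ^+ 2) = (fun x => f x * f x) by apply/funext => x; rewrite expr2.
apply: (@itg_continuous_compact_support _ M) => [z|z /f0 ->]; last by rewrite mulr0.
by apply: cvgM; exact: cf.
Qed.

Lemma test_sqint (f : field R) : test_function U f -> sqint (leb2 R) f.
Proof.
move=> tf; have [M _ HM] := test_box tf; apply: sqint_continuous_compact_support HM.
by apply: smooth_continuous; case: tf.
Qed.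

End TestFunctions.

Lemma test_mono (U V : set (plane R)) (f : field R) : U `<=` V ->
  test_function U f -> test_function V f.
Proof. by move=> UV [sf cf fU]; split=> //; exact: subset_trans UV. Qed.

End SmoothClass.

Section Lnorm2.
Context d (T : measurableType d) (R : realType).
Variable mu : {measure set T -> \bar R}.

Lemma Lnorm2_sqrt (f : T -> R) : sqint mu f ->
  ('N[mu]_2%:E[EFin \o f] = (Num.sqrt (ip mu f f))%:E)%E.
Proof.
move=> hf; rewrite unlock /Lnorm.
have -> : (\int[mu]_x `|(EFin \o f) x| `^ 2 = (ip mu f f)%:E)%E.
  rewrite /ip /Rintegral fineK; last by apply: integrable_fin_num => //; exact: sqintM.
  by apply: eq_integral => x _; rewrite [(EFin \o f) x]/= abse_EFin poweR_EFin powR_mulrn// real_normK ?num_real.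
by rewrite poweR_EFin powR12_sqrt// ip_ge0.
Qed.

Lemma Lfun2P (f : T -> R) : f \in Lfun mu 2%:E <-> sqint mu f.
Proof.
split=> [hf|hf].
  split; last exact: Lfun2_integrable_sqr.
  by move: hf => /[!inE] /andP[/[!inE]].
by rewrite inE; apply/andP; split; rewrite inE /=; [case: hf|
  rewrite /finite_norm Lnorm2_sqrt// ltry].
Qed.

End Lnorm2.

(** * Classical functions as elements of H^1 *)

Section SobolevC1.
Variable R : realType.
Notation mu := (leb2 R).
Implicit Types (f g : field R) (U : set (plane R)).

Lemma L2P U f : L2 U f <-> sqint mu (zero_ext U f).
Proof. exact: Lfun2P. Qed.

Lemma zero_extT f : zero_ext setT f = f.
Proof. by apply/funext => x; rewrite /zero_ext patchT ?inE. Qed.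

Lemma zero_ext_id U f : (forall x, ~ U x -> f x = 0) -> zero_ext U f = f.
Proof.
move=> f0; apply/funext => x; rewrite /zero_ext /patch; case: ifPn => //.
by rewrite notin_setE => /f0 ->.
Qed.

Lemma zero_ext_in U f x : U x -> zero_ext U f x = f x.
Proof. by move=> Ux; rewrite /zero_ext patchT ?inE. Qed.

Lemma zero_ext_out U f x : ~ U x -> zero_ext U f x = 0.
Proof. by move=> Ux; rewrite /zero_ext patchN// notin_setE. Qed.

Lemma L2norm_cvg0P U (f : nat -> field R) : (forall n, L2 U (f n)) ->
  L2norm U (f n) @[n --> \oo] --> 0%E <->
  ip mu (zero_ext U (f n)) (zero_ext U (f n)) @[n --> \oo] --> 0.
Proof.
move=> hf; rewrite /L2norm.
under eq_fun do rewrite (Lnorm2_sqrt ((L2P _ _).1 (hf _))).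
split=> H.
  have {H} : (Num.sqrt (ip mu (zero_ext U (f n)) (zero_ext U (f n)))) @[n --> \oo] --> 0.
    by move/fine_cvgP : H => [].
  move=> H; pose s n := Num.sqrt (ip mu (zero_ext U (f n)) (zero_ext U (f n))).
  have -> : (fun n => ip mu (zero_ext U (f n)) (zero_ext U (f n))) = (fun n => s n * s n).
    by apply/funext => n; rewrite /s -expr2 sqr_sqrtr// ip_ge0.
  by rewrite -(mulr0 (0 : R)); apply: cvgM.
apply: cvg_EFin; first exact: nearW.
have := cvg_comp _ _ H (@sqrt_continuous R 0).
by rewrite sqrtr0.
Qed.

Lemma Rintegral_zero_ext U f g : 
  \int[mu]_(x in U) (f x * g x) = \int[mu]_x (zero_ext U f x * g x).
Proof.
rewrite Rintegral_mkcond; apply: eq_Rintegral => x _.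
by rewrite /zero_ext /patch; case: ifP => // _; rewrite mul0r.
Qed.

Lemma distr_ofE U f psi : distr_of U f psi = ip mu (zero_ext U f) psi.
Proof. exact: Rintegral_zero_ext. Qed.

(** Nothing is known of [f] outside [U], but near such a point [psi] vanishes, its support being
    closed and contained in [U]. *)
Lemma continuous_mul_test U f psi : open U -> {in U, continuous f} -> test_function U psi ->
  continuous (fun z => f z * psi z).
Proof.
move=> oU cf tpsi z; have [Uz|nUz] := pselect (U z).
  apply: cvgM; first by apply: cf; exact/mem_set.
  by apply: smooth_continuous; case: tpsi.
have nz : ~ support psi z by case: tpsi => _ _ sU /sU.
rewrite /continuous_at (test_supp tpsi nUz) mulr0.
apply: cvg_near_cst.
by apply: filterS (notin_support nz) => y ->; rewrite mulr0.
Qed.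

(** The product [f * psi] is compactly supported on the plane, so its derivative integrates to
    zero. *)
Lemma integration_by_parts_test U f psi j : open U ->
  (forall z, U z -> derivable f z (basis R j)) -> {in U, continuous f} ->
  {in U, continuous (partial j f)} -> test_function U psi ->
  \int[mu]_(x in U) (f x * partial j psi x) = - \int[mu]_(x in U) (partial j f x * psi x).
Proof.
move=> oU df cf cdf tpsi.
have tdpsi := test_partial j tpsi.
have outU (h g : field R) : test_function U g ->
    \int[mu]_(x in U) (h x * g x) = \int[mu]_x (h x * g x).
  move=> tg; rewrite Rintegral_mkcond; apply: eq_Rintegral => x _.
  by rewrite /patch; case: ifPn => //; rewrite notin_setE => /(test_supp tg) ->; rewrite mulr0.
rewrite !outU//.
have [M M0 HM] := test_box tpsi; have [M' M'0 HM'] := test_box tdpsi.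
have c1 := continuous_mul_test oU cdf tpsi.
have c2 := continuous_mul_test oU cf tdpsi.
have i1 : itg (fun z => partial j f z * psi z).
  by apply: (itg_continuous_compact_support (M := M)) => // z /HM ->; rewrite mulr0.
have i2 : itg (fun z => f z * partial j psi z).
  by apply: (itg_continuous_compact_support (M := M')) => // z /HM' ->; rewrite mulr0.
have dg z : is_derive z (basis R j) (fun z => f z * psi z)
    (f z * partial j psi z + partial j f z * psi z).
  have [Uz|nUz] := pselect (U z).
    have [spsi _ _] := tpsi.
    have dfz : is_derive z (basis R j) f (partial j f z) by split=> //; exact: df.
    have := is_deriveM dfz (smooth_is_derive j z spsi).
    by rewrite [partial j f z * _]mulrC.
  have nz : ~ support psi z by case: tpsi => _ _ sU /sU.
  rewrite (test_supp tpsi nUz) (test_supp tdpsi nUz) !mulr0 addr0.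
  apply: (near_eq_is_derive _ (is_derive_cst (0 : R) z (basis R j))).
  by apply: filterS (notin_support nz) => y ->; rewrite mulr0.
have pg : partial j (fun z => f z * psi z) =
    (fun z => f z * partial j psi z + partial j f z * psi z).
  by apply/funext => z; have [_ e] := dg z; exact: e.
apply/eqP; rewrite -subr_eq0 opprK -RintegralD//; apply/eqP.
rewrite -[X in _ = X](@integral_partial_eq0 R j (fun z => f z * psi z) M) => [|z|||z].
- by rewrite pg.
- by have [] := dg z.
- by apply: continuous_mul_test oU cf tpsi.
- by rewrite pg => z; apply: cvgD; [exact: c2|exact: c1].
- by move=> /HM ->; rewrite mulr0.
Qed.

Lemma H1_C1 U f : open U -> (forall j z, U z -> derivable f z (basis R j)) ->
  {in U, continuous f} -> (forall j, {in U, continuous (partial j f)}) ->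
  L2 U f -> (forall j, L2 U (partial j f)) -> H1 U f (fun j => partial j f).
Proof.
move=> oU df cf cdf L2f L2df; split=> // j psi tpsi.
rewrite /dpartial /distr_of integration_by_parts_test ?opprK//.
by move=> z; exact: df.
Qed.

(** [V] is independent of [U]: test functions of the plane restrict to H^1(U), which is how the zero
    traction condition acts across the boundary. *)
Lemma test_H1 U V psi : open U -> test_function V psi ->
  H1 U psi (fun j => partial j psi).
Proof.
move=> oU tpsi; have [spsi _ _] := tpsi.
have L2t g : test_function V g -> L2 U g.
  move=> tg; apply/L2P; have [mg ig] := test_sqint tg.
  have mzg : measurable_fun setT (zero_ext U g : mplane R -> R).
    apply/(measurable_restrictT (g : mplane R -> R) (open_measurable_plane oU)).
    exact: measurable_funTS.
  split=> //; apply: (itg_le _ ig); first exact: measurable_funX.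
  move=> x; rewrite ger0_norm ?sqr_ge0// /zero_ext /patch; case: ifP => // _.
  by rewrite expr0n sqr_ge0.
apply: H1_C1 => //.
- by move=> j z _; have [] := smooth_is_derive j z spsi.
- by move=> z _; exact: smooth_continuous.
- by move=> j z _; apply: smooth_continuous; exact: smooth_partial.
- exact: L2t.
- by move=> j; apply/L2t/test_partial.
Qed.

End SobolevC1.

(** * Mollification and Weyl's lemma *)

Section ParametricIntegral.
Variable R : realType.
Notation mu := (leb2 R).
Variables (h : field R) (M : R).
Hypothesis ih : itg h.
Hypothesis h0 : forall w, ~ cbox M w -> h w = 0.

Lemma compact_cbox : compact (cbox M).
Proof. by apply: compact_setX; exact: segment_compact. Qed.

Lemma continuous_section (T : topologicalType) (k : T -> field R) :
  continuous (fun p : T * plane R => k p.1 p.2) -> forall t, continuous (k t).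
Proof.
move=> ck t w; apply: (@continuous_comp _ _ _ (fun w : plane R => (t, w)) (fun p : T * plane R => k p.1 p.2)).
  by apply: (@cvg_pair _ _ _ (nbhs w) (nbhs t) (nbhs w)); [exact: cvg_cst|exact: cvg_id].
exact: ck.
Qed.

Lemma itg_mul_continuous (k : field R) : continuous k -> itg (fun w => h w * k w).
Proof.
move=> ck; have /compact_bounded [B [_ HB]] : compact (k @` cbox M).
  by apply: continuous_compact compact_cbox; exact: continuous_subspaceT.
have mh : measurable_fun setT (h : mplane R -> R).
  by apply/measurable_EFinP; case/integrableP : ih.
apply: (itg_le _ (itgZ (`|B| + 1) (integrable_norm ih))) => [|w].
  by apply: measurable_funM => //; exact: continuous_measurable_plane.
rewrite /= normrM mulrC; have [wM|/h0 ->] := pselect (cbox M w); last by rewrite normr0 !mulr0.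
rewrite ler_wpM2r//; apply: (HB (`|B| + 1)); last by exists w.
by rewrite (le_lt_trans (ler_norm _)) ?ltrDl.
Qed.

(** For [s] near [t], [k s] and [k t] are uniformly close on the compact box outside which [h]
    vanishes. *)
Lemma continuous_parametric (T : topologicalType) (k : T -> field R) :
  continuous (fun p : T * plane R => k p.1 p.2) ->
  continuous (fun t => \int[mu]_w (h w * k t w)).
Proof.
move=> ck t; apply/cvgrPdist_le => e e0.
pose I := \int[mu]_w `|h w|.
have I0 : 0 <= I by exact: Rintegral_ge0.
have d0 : 0 < e / (I + 1) by rewrite divr_gt0// ltr_wpDl.
have : \forall s \near t, cbox M `<=` [set w | `|k t w - k s w| < e / (I + 1)].
  have /compact_near_coveringP cK := compact_cbox.
  apply: cK => w _.
  have := ck (t, w) => /cvgrPdist_lt/(_ (e / (I + 1) / 2)).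
  rewrite divr_gt0// => /(_ isT) [[A B] /= [At Bw] AB].
  have ckt : continuous (k t) by exact: continuous_section.
  have := ckt w => /cvgrPdist_lt/(_ (e / (I + 1) / 2)).
  rewrite divr_gt0// => /(_ isT) C.
  exists ([set w' | B w' /\ `|k t w - k t w'| < e / (I + 1) / 2], A) => /=.
    by split=> //; apply: filterI.
  move=> [w' s] /= [[Bw' h1] As]; have h2 := AB (s, w') (conj As Bw').
  rewrite /= in h2; rewrite (splitr (e / (I + 1))).
  rewrite -(subrK (k t w) (k t w')) -addrA; apply: (le_lt_trans (ler_normD _ _)).
  by rewrite ltrD// distrC.
apply: filterS => s Hs.
have ctk r : continuous (k r) by exact: continuous_section.
rewrite -RintegralB//; [|exact: itg_mul_continuous..].
apply: le_trans (le_normr_Rintegral _ _) _ => //.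
  by apply: itgB; exact: itg_mul_continuous.
apply: (@le_trans _ _ (\int[mu]_w (e / (I + 1) * `|h w|))).
  apply: le_Rintegral => //.
  - by apply: integrable_norm; apply: itgB; exact: itg_mul_continuous.
  - by apply: itgZ; exact: integrable_norm.
  move=> w _; rewrite -mulrBr normrM mulrC.
  have [wM|/h0 ->] := pselect (cbox M w); last by rewrite normr0 !mulr0.
  by rewrite ler_wpM2r//; apply/ltW/Hs.
rewrite RintegralZl//; last exact: integrable_norm.
rewrite -mulrA ler_piMr ?(ltW e0)// mulrC ler_pdivrMr ?ltr_wpDl// mul1r.
by rewrite lerDl.
Qed.

(** Differentiation under the integral: [k'] is bounded on a compact set, so the derivative is
    dominated by a constant times [|h|]. *)
Lemma is_derive_parametric (k k' : R -> field R) :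
  continuous (fun p : R * plane R => k p.1 p.2) ->
  continuous (fun p : R * plane R => k' p.1 p.2) ->
  (forall (s : R) w, is_derive s (1 : R) (k ^~ w) (k' s w)) ->
  forall s : R, is_derive s (1 : R) (fun s => \int[mu]_w (h w * k s w)) (\int[mu]_w (h w * k' s w)).
Proof.
move=> ck ck' dk s.
have dhk (t : R) w : is_derive t (1 : R) (fun t => h w * k t w) (h w * k' t w).
  by have := is_deriveZ (h w) (dk t w).
have ctk r : continuous (k r) by exact: continuous_section.
have ctk' r : continuous (k' r) by exact: continuous_section.
have /compact_bounded [B [_ HB]] : compact ((fun p : R * plane R => k' p.1 p.2) @` (`[s - 1, s + 1] `*` cbox M : set (R * plane R))).
  apply: continuous_compact; first exact: continuous_subspaceT.
  by apply: compact_setX; [exact: segment_compact|exact: compact_cbox].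
pose G w := (`|B| + 1) * `|h w|.
have Is : `]s - 1, s + 1[%classic s by rewrite /= in_itv /= ltrDl gtrBl ltr01.
have G0 w : 0 <= G w by rewrite mulr_ge0// addr_ge0.
have iG : itg G by apply: itgZ; exact: integrable_norm.
have Gub (t : R) w : `]s - 1, s + 1[%classic t -> setT w ->
    `|partial1of2 (fun t w => h w * k t w) t w| <= G w.
  rewrite /= in_itv /= => /andP[t1 t2] _; rewrite partial1of2E; have [_ ->] := dhk t w.
  rewrite normrM mulrC /G; have [wM|/h0 ->] := pselect (cbox M w); last by rewrite normr0 !mulr0.
  rewrite ler_wpM2r//; apply: (HB (`|B| + 1)); first by rewrite (le_lt_trans (ler_norm _)) ?ltrDl.
  by exists (t, w) => //; split=> //; rewrite /= in_itv /= !ltW.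
have ifk (t : R) : `]s - 1, s + 1[%classic t -> itg (fun w => h w * k t w).
  by move=> _; exact: itg_mul_continuous.
have dfk (t : R) w : `]s - 1, s + 1[%classic t -> setT w -> derivable (fun t => h w * k t w) t 1.
  by move=> _ _; have [] := dhk t w.
split.
  exact: (derivable_under_integral measurableT Is ifk dfk G0 iG Gub).
have := differentiation_under_integral measurableT Is ifk dfk G0 iG Gub.
rewrite derive1E => ->; apply: eq_Rintegral => w _.
by rewrite partial1of2E; have [_ ->] := dhk s w.
Qed.

End ParametricIntegral.

Section Kernel.
Variable R : realType.
Notation mu := (leb2 R).
Implicit Types (z w : plane R) (a b : R) (i j : 'I_2).

Definition crd i z : R := if i == 0 then z.1 else z.2.

Lemma smooth_crd i : smooth_class (crd i).
Proof. by have [->|->] := ord2P i; [exact: SmoothFst|exact: SmoothSnd]. Qed.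

Lemma is_derive_crd i j z : is_derive z (basis R j) (crd i) (i == j)%:R.
Proof.
case: z => x y.
have [->|->] := ord2P i; have [->|->] := ord2P j; rewrite /crd /=.
- by apply/is_derive0P; exact: is_derive_id.
- by apply/is_derive1P; exact: (is_derive_cst x y 1).
- by apply/is_derive0P; exact: (is_derive_cst y x 1).
- by apply/is_derive1P; exact: is_derive_id.
Qed.

Definition dist2 z w : R := (crd 0 z - crd 0 w) ^+ 2 + (crd 1 z - crd 1 w) ^+ 2.

Lemma dist2C z w : dist2 z w = dist2 w z.
Proof. by rewrite /dist2; congr (_ + _); rewrite -sqrrN opprB. Qed.

(** The parameter [a] is an inverse squared radius: [rad a z w] is positive inside the Euclidean
    disc of radius [a^(-1/2)] about [z]. *)
Definition rad a z w : R := 1 - a * dist2 z w.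

(** [flat 1] is [exp(-1/x)] on the positive half-line; [P1] and [P2] belong to its first and second
    derivatives. *)
Definition P1 : {poly R} := flat_deriv 1.
Definition P2 : {poly R} := flat_deriv P1.

Definition bump a z w : R := flat 1 (rad a z w).
(** The kernel uses the derivative of the profile of [bump], not the profile itself: its derivative
    in the scale is then a multiple of the Laplacian of [bump]. The factor [a] keeps its mass
    constant in dimension two. *)
Definition ker a z w : R := a * flat P1 (rad a z w).
Definition dker j a z w : R := - 2 * a ^+ 2 * (flat P2 (rad a z w) * (crd j z - crd j w)).
Definition lapbump a z w : R :=
  4 * a * (a * dist2 z w * flat P2 (rad a z w) - flat P1 (rad a z w)).

Lemma radC a z w : rad a z w = rad a w z. Proof. by rewrite /rad dist2C. Qed.
Lemma kerC a z w : ker a z w = ker a w z. Proof. by rewrite /ker radC. Qed.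

Lemma smooth_rad a z : smooth_class (rad a z).
Proof.
have -> : rad a z = (fun w => 1 + (- a) * ((crd 0 z + (-1) * crd 0 w) * (crd 0 z + (-1) * crd 0 w) +
    (crd 1 z + (-1) * crd 1 w) * (crd 1 z + (-1) * crd 1 w))).
  by apply/funext => w; rewrite /rad /dist2; ring.
apply: SmoothAdd; first exact: SmoothCst.
apply: SmoothMul; first exact: SmoothCst.
have H i : smooth_class (fun w => crd i z + (-1) * crd i w).
  apply: SmoothAdd; first exact: SmoothCst.
  by apply: SmoothMul; [exact: SmoothCst|exact: smooth_crd].
by apply: SmoothAdd; exact: SmoothMul.
Qed.

Lemma smooth_bump a z : smooth_class (bump a z).
Proof. exact/SmoothFlat/smooth_rad. Qed.

Lemma smooth_ker a z : smooth_class (ker a z).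
Proof. by apply: SmoothMul; [exact: SmoothCst|exact/SmoothFlat/smooth_rad]. Qed.

Lemma is_derive_subcrd i j z w :
  is_derive w (basis R j) (fun w => crd i z - crd i w) (- (i == j)%:R).
Proof.
have := is_deriveB (is_derive_cst (crd i z) w (basis R j)) (is_derive_crd i j w).
by rewrite sub0r.
Qed.

Lemma is_derive_rad a z w j :
  is_derive w (basis R j) (rad a z) (2 * a * (crd j z - crd j w)).
Proof.
have H i : is_derive w (basis R j) (fun w => (crd i z - crd i w) ^+ 2)
    ((i == j)%:R * (- 2 * (crd i z - crd i w))).
  have := is_deriveM (is_derive_subcrd i j z w) (is_derive_subcrd i j z w).
  rewrite (_ : _ * _ = (fun w => (crd i z - crd i w) ^+ 2)); last first.
    by apply/funext => v; rewrite expr2.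
  by move=> H; apply: (is_derive_eq H); rewrite /GRing.scale /=; ring.
have := is_deriveB (is_derive_cst (1 : R) w (basis R j)) (is_deriveZ a (is_deriveD (H 0) (H 1))).
move=> {}H; apply: (is_derive_eq H); rewrite /GRing.scale /=.
by have [->|->] := ord2P j; rewrite /=; ring.
Qed.

Lemma is_derive_flat_rad P a z w j :
  is_derive w (basis R j) (fun w => flat P (rad a z w))
    (flat (flat_deriv P) (rad a z w) * (2 * a * (crd j z - crd j w))).
Proof. by apply: is_derive_basis_comp; [exact: is_derive_flat|exact: is_derive_rad]. Qed.

Lemma partial_bump a z j :
  partial j (bump a z) = fun w => flat P1 (rad a z w) * (2 * a * (crd j z - crd j w)).
Proof. by apply/funext => w; have [_ e] := is_derive_flat_rad 1 a z w j; exact: e. Qed.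

Lemma partial_partial_bump a z i j w : partial i (partial j (bump a z)) w =
  4 * a ^+ 2 * flat P2 (rad a z w) * (crd i z - crd i w) * (crd j z - crd j w)
  - 2 * a * (i == j)%:R * flat P1 (rad a z w).
Proof.
rewrite partial_bump.
have := is_deriveM (is_derive_flat_rad P1 a z w i)
  (is_deriveZ (2 * a) (is_derive_subcrd j i z w)).
move=> [_ e]; rewrite -[LHS]/('D_(basis R i) _ w).
rewrite [LHS]e (eq_sym i).
transitivity (flat P1 (rad a z w) * (2 * a * - (j == i)%:R) + 2 * a * (crd j z - crd j w) *
  (flat P2 (rad a z w) * (2 * a * (crd i z - crd i w)))); [by []|ring].
Qed.

Lemma laplacian_bump a z w :
  partial 0 (partial 0 (bump a z)) w + partial 1 (partial 1 (bump a z)) w = lapbump a z w.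
Proof. rewrite !partial_partial_bump /lapbump !eqxx /=.
by rewrite {1}/dist2; ring. Qed.

Lemma partial_bump_sym a z :
  partial 0 (partial 1 (bump a z)) = partial 1 (partial 0 (bump a z)).
Proof.
apply/funext => w; rewrite !partial_partial_bump.
have [-> ->] : ((0 == 1 :> 'I_2) = false) * ((1 == 0 :> 'I_2) = false) by []. ring. Qed.

(** The kernel depends on [z - w] only, so its derivatives in [w] and in [z] are opposite. *)
Lemma partial_ker a z j w : partial j (ker a z) w = - dker j a z w.
Proof.
have [_ e] := is_deriveZ a (is_derive_flat_rad P1 a z w j).
rewrite -[LHS]/('D_(basis R j) _ w) [LHS]e /dker -/P2 /GRing.scale /=; ring.
Qed.

Lemma is_derive_ker_z j a z w : is_derive z (basis R j) (fun z => ker a z w) (dker j a z w).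
Proof.
have := is_deriveZ a (is_derive_flat_rad P1 a w z j).
rewrite (_ : a \*: _ = (fun z => ker a z w)); last first.
  by apply/funext => z'; rewrite kerC.
move=> H; apply: (is_derive_eq H); rewrite /dker -/P2 /GRing.scale /= (radC a w z); ring.
Qed.

Lemma is_derive_ker_a a z w : is_derive a (1 : R) (fun a => ker a z w)
  (flat P1 (rad a z w) - a * dist2 z w * flat P2 (rad a z w)).
Proof.
have dr : is_derive a (1 : R) (fun a => rad a z w) (- dist2 z w).
  have := is_deriveB (is_derive_cst (1 : R) a (1 : R)) (is_deriveZ (dist2 z w) (is_derive_id a (1 : R))).
  rewrite sub0r [_ *: 1]mulr1.
  rewrite (_ : cst 1 - _ = (fun a => rad a z w))//.
  by apply/funext => b; rewrite /rad mulrC.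
have dc := @is_derive1_comp R (flat P1) (fun a => rad a z w) a _ _ (is_derive_flat P1 (rad a z w)) dr.
have := is_deriveM (is_derive_id a (1 : R)) dc.
move=> H; apply: (is_derive_eq H); rewrite /GRing.scale /= -/P2; ring.
Qed.

Section JointContinuity.
Variables (T : topologicalType) (s : T -> R) (Z W : T -> plane R).
Hypotheses (cs : continuous s) (cZ : continuous Z) (cW : continuous W).

Lemma continuous_crd i : continuous (crd i).
Proof. exact: smooth_class_continuous (smooth_crd i). Qed.

Lemma continuous_subcrd i : continuous (fun t => crd i (Z t) - crd i (W t)).
Proof.
have H (V : T -> plane R) : continuous V -> continuous (fun t => crd i (V t)).
  by move=> cV t; apply: (@continuous_comp _ _ _ V (crd i)); [exact: cV|exact: continuous_crd].
by move=> t; apply: cvgB; exact: H.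
Qed.

Lemma continuous_dist2 : continuous (fun t => dist2 (Z t) (W t)).
Proof.
move=> t; rewrite /dist2; apply: cvgD.
  by rewrite expr2; under eq_fun do rewrite expr2; apply: cvgM; exact: continuous_subcrd.
by rewrite expr2; under eq_fun do rewrite expr2; apply: cvgM; exact: continuous_subcrd.
Qed.

Lemma continuous_flat P : continuous (@flat R P).
Proof.
move=> x; apply/differentiable_continuous/derivable1_diffP.
by have [] := is_derive_flat P x.
Qed.

Lemma continuous_flat_rad P : continuous (fun t => flat P (rad (s t) (Z t) (W t))).
Proof.
move=> t; apply: (@continuous_comp _ _ _ (fun t => rad (s t) (Z t) (W t)) (flat P)); last exact: continuous_flat.
rewrite /rad; apply: cvgB; first exact: cvg_cst.
by apply: cvgM; [exact: cs|exact: continuous_dist2].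
Qed.

Lemma continuous_ker : continuous (fun t => ker (s t) (Z t) (W t)).
Proof. by move=> t; apply: cvgM; [exact: cs|exact: continuous_flat_rad]. Qed.

Lemma continuous_dker j : continuous (fun t => dker j (s t) (Z t) (W t)).
Proof.
move=> t; apply: cvgM; last by apply: cvgM; [exact: continuous_flat_rad|exact: continuous_subcrd].
apply: cvgM; first exact: cvg_cst.
by rewrite expr2; under eq_fun do rewrite expr2; apply: cvgM; exact: cs.
Qed.

Lemma continuous_ker_a : continuous (fun t =>
  flat P1 (rad (s t) (Z t) (W t)) - s t * dist2 (Z t) (W t) * flat P2 (rad (s t) (Z t) (W t))).
Proof.
move=> t; apply: cvgB; first exact: continuous_flat_rad.
apply: cvgM; last exact: continuous_flat_rad.
by apply: cvgM; [exact: cs|exact: continuous_dist2].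
Qed.

End JointContinuity.

(** [ball] is a square of half-width [r]; the condition [r^-2 < a] puts the closed supporting disc
    inside it. *)
Lemma rad_gt0_ball a z w r : 0 < r -> r ^- 2 < a -> 0 <= rad a z w -> ball z r w.
Proof.
move=> r0 ra; rewrite /rad subr_ge0 => h.
have a0 : 0 < a by apply: lt_trans ra; rewrite invr_gt0 exprn_gt0.
have d2 : dist2 z w < r ^+ 2.
  by rewrite -(ltr_pM2l a0); apply: le_lt_trans h _; rewrite -ltr_pdivrMr ?exprn_gt0// mul1r.
have c i : `|crd i z - crd i w| < r.
  rewrite -ltr_sqr ?nnegrE ?(ltW r0)// real_normK ?num_real//; apply: le_lt_trans d2.
  by rewrite /dist2; have [->|->] := ord2P i; rewrite ?lerDl ?lerDr sqr_ge0.
by split; [exact: (c 0)|exact: (c 1)].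
Qed.

Lemma flat_rad_out P a z w r : 0 < r -> r ^- 2 < a -> ~ ball z r w -> flat P (rad a z w) = 0.
Proof.
move=> r0 ra nb; apply: flat_le0; rewrite leNgt; apply/negP => h; apply: nb.
by apply: rad_gt0_ball ra _ => //; exact: ltW.
Qed.

Lemma ball_sub_cbox z (r : R) : ball z r `<=` cbox (`|z.1| + `|z.2| + r).
Proof.
have H (x y s : R) : `|x - y| < r -> 0 <= s -> y \in `[- (`|x| + s + r), `|x| + s + r].
  move=> xy s0; rewrite in_itv /= -ler_norml.
  have : `|y| <= `|x| + `|x - y| by rewrite -{1}(subKr x y) ler_normB.
  by move=> ?; lra.
case: z => x y [x' y'] [/= hx hy]; split=> /=; first exact: H.
by rewrite (addrC `|x|); exact: H.
Qed.

Lemma test_smooth_rad U a z r (f : field R) : 0 < r -> r ^- 2 < a -> ball z r `<=` U ->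
  smooth_class f -> (forall w, rad a z w <= 0 -> f w = 0) -> test_function U f.
Proof.
move=> r0 ra bU sf f0.
apply: (@test_functionI _ _ _ [set w | 0 <= rad a z w]) => [|||w /=].
- exact: smooth_class_smooth.
- have HM := @ball_sub_cbox z r; set M := (X in cbox X) in HM.
  apply: (subclosed_compact _ (@compact_cbox R M)).
    apply: (@closed_comp _ _ (rad a z) [set x | 0 <= x]) => [w _|]; last exact: closed_ge.
    exact: smooth_class_continuous (smooth_rad a z) w.
  by move=> w /= hw; apply: HM; exact: rad_gt0_ball hw.
- by move=> w /= hw; apply: bU; exact: rad_gt0_ball hw.
- by apply: contraNle => h; apply/eqP/f0/ltW.
Qed.

End Kernel.

Section Mollification.
Variable R : realType.
Notation mu := (leb2 R).
Implicit Types (a b r M : R) (z w : plane R).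

Lemma derive0_itv_cst (F : R -> R) (u v : R) :
  (forall t : R, u < t < v -> is_derive t (1 : R) F 0) ->
  forall a b, u < a < v -> u < b < v -> F a = F b.
Proof.
move=> dF; suff H a b : u < a < v -> u < b < v -> a <= b -> F a = F b.
  by move=> a b ha hb; have [ab|/ltW ba] := leP a b; [exact: H|apply/esym/H].
move=> /andP[ua av] /andP[ub bv] ab.
have inab t : a <= t <= b -> u < t < v.
  by move=> /andP[at_ tb]; rewrite (lt_le_trans ua)// (le_lt_trans tb).
have d1 t : t \in `]a, b[ -> is_derive t (1 : R) F 0.
  by rewrite in_itv /= => /andP[at_ tb]; apply: dF; apply: inab; rewrite !ltW.
have c1 : {within `[a, b], continuous F}.
  apply: derivable_within_continuous => t; rewrite in_itv /= => h.
  by have [] := dF t (inab t h).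
have [t _] := MVT_segment ab d1 c1.
by rewrite mul0r => /eqP; rewrite subr_eq0 => /eqP.
Qed.

Definition moll (h : field R) (a : R) (z : plane R) : R := \int[mu]_w (h w * ker a z w).

Section Properties.
Variables (h : field R) (M : R).
Hypothesis ih : itg h.
Hypothesis h0 : forall w, ~ cbox M w -> h w = 0.

Lemma continuous_moll a : continuous (moll h a).
Proof.
apply: (@continuous_parametric _ _ M ih h0 _ (ker a)).
apply: (@continuous_ker _ _ (fun=> a)) => p; [exact: cvg_cst|exact: cvg_fst|exact: cvg_snd].
Qed.

Lemma continuous_moll_deriv j a : continuous (fun z => \int[mu]_w (h w * dker j a z w)).
Proof.
apply: (@continuous_parametric _ _ M ih h0 _ (dker j a)).
apply: (@continuous_dker _ _ (fun=> a)) => p; [exact: cvg_cst|exact: cvg_fst|exact: cvg_snd].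
Qed.

Lemma is_derive_moll j a z :
  is_derive z (basis R j) (moll h a) (\int[mu]_w (h w * dker j a z w)).
Proof.
case: z => x y; have [->|->] := ord2P j.
- apply/is_derive0P; apply: (@is_derive_parametric _ _ M ih h0 (fun t => ker a (t, y)) (fun t => dker 0 a (t, y))).
  + apply: (@continuous_ker _ _ (fun=> a) (fun p : R * plane R => (p.1, y))) => p.
    * exact: cvg_cst.
    * by apply: continuous_pairP; [exact: cvg_fst|exact: cvg_cst].
    * exact: cvg_snd.
  + apply: (@continuous_dker _ _ (fun=> a) (fun p : R * plane R => (p.1, y))) => p.
    * exact: cvg_cst.
    * by apply: continuous_pairP; [exact: cvg_fst|exact: cvg_cst].
    * exact: cvg_snd.
  + by move=> s w; exact: ((is_derive0P (fun z => ker a z w) s y _).1 (is_derive_ker_z 0 a (s, y) w)).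
- apply/is_derive1P; apply: (@is_derive_parametric _ _ M ih h0 (fun t => ker a (x, t)) (fun t => dker 1 a (x, t))).
  + apply: (@continuous_ker _ _ (fun=> a) (fun p : R * plane R => (x, p.1))) => p.
    * exact: cvg_cst.
    * by apply: continuous_pairP; [exact: cvg_cst|exact: cvg_fst].
    * exact: cvg_snd.
  + apply: (@continuous_dker _ _ (fun=> a) (fun p : R * plane R => (x, p.1))) => p.
    * exact: cvg_cst.
    * by apply: continuous_pairP; [exact: cvg_cst|exact: cvg_fst].
    * exact: cvg_snd.
  + by move=> s w; exact: ((is_derive1P (fun z => ker a z w) x s _).1 (is_derive_ker_z 1 a (x, s) w)).
Qed.

(* The derivative of the radial kernel in its scale [a] is [- (4 a)^-1] times a
   Laplacian, so the mollification of a harmonic function does not depend on [a]. *)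
Lemma moll_scale r a b z : 0 < r -> r ^- 2 < a -> r ^- 2 < b ->
  (forall c, r ^- 2 < c -> \int[mu]_w (h w * lapbump c z w) = 0) ->
  moll h a z = moll h b z.
Proof.
move=> r0 ra rb hlap.
apply: (@derive0_itv_cst (fun a => moll h a z) (r ^- 2) (Num.max a b + 1)); last 2 first.
- by rewrite ra /= ltr_pwDr// le_max lexx.
- by rewrite rb /= ltr_pwDr// le_max lexx orbT.
move=> c /andP[rc _].
have c0 : 0 < c by apply: lt_trans rc; rewrite invr_gt0 exprn_gt0.
have cf2 (T := (R * plane R)%type) : continuous (fun p : T => p.2) by move=> p; exact: cvg_snd.
have cf1 (T := (R * plane R)%type) : continuous (fun p : T => p.1) by move=> p; exact: cvg_fst.
have cfz (T := (R * plane R)%type) : continuous (fun p : T => z) by move=> p; exact: cvg_cst.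
have H := @is_derive_parametric _ _ M ih h0 (fun a => ker a z)
   (fun a w => flat (P1 R) (rad a z w) - a * dist2 z w * flat (P2 R) (rad a z w))
   (continuous_ker cf1 cfz cf2) (continuous_ker_a cf1 cfz cf2)
   (fun a w => is_derive_ker_a a z w) c.
apply: (is_derive_eq H).
have clap : continuous (lapbump c z).
  have cs : continuous (fun p : plane R => c) by move=> p; exact: cvg_cst.
  have cw : continuous (fun p : plane R => p) by move=> p; exact: cvg_id.
  have cz : continuous (fun p : plane R => z) by move=> p; exact: cvg_cst.
  have := continuous_ker_a cs cz cw => ck.
  rewrite (_ : lapbump c z = (fun w => (- 4 * c) * (flat (P1 R) (rad c z w) - c * dist2 z w * flat (P2 R) (rad c z w)))).
    by move=> w; apply: cvgM; [exact: cvg_cst|exact: ck].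
  by apply/funext => w; rewrite /lapbump; ring.
transitivity ((- (4 * c)^-1) * \int[mu]_w (h w * lapbump c z w)); last by rewrite hlap// mulr0.
rewrite -RintegralZl//; last by exact: (itg_mul_continuous ih h0).
by apply: eq_Rintegral => w _; rewrite /lapbump; field; rewrite gt_eqF.
Qed.

End Properties.

(** The kernel is not normalised: its mass is a positive constant without closed form here, divided
    out in the smooth representative. *)
Definition mass (a : R) (z : plane R) : R := \int[mu]_w ker a z w.

Lemma ker_box a z r M w : 0 < r -> r ^- 2 < a -> ball z r `<=` cbox M ->
  ~ cbox M w -> ker a z w = 0.
Proof.
move=> r0 ra bM nw; rewrite /ker (flat_rad_out _ r0 ra) ?mulr0//.
by move=> bw; apply: nw; exact: bM.
Qed.

Lemma continuous_kerz a z : continuous (ker a z).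
Proof. exact: smooth_class_continuous (smooth_ker a z). Qed.

Lemma itg_ker a z : 0 < a -> itg (ker a z).
Proof.
(* With this [r], [r^2 >= r > a^-1], so the support of the kernel fits in a ball of radius [r]. *)
move=> a0; pose r := 1 + a^-1; have r0 : 0 < r by rewrite addr_gt0// invr_gt0.
have ra : r ^- 2 < a.
  rewrite invf_plt ?posrE ?exprn_gt0//; apply: (@lt_le_trans _ _ r).
    by rewrite /r ltrDr.
  by rewrite expr2 ler_peMl ?(ltW r0)// /r lerDl invr_ge0 ltW.
apply: (itg_continuous_compact_support (M := `|z.1| + `|z.2| + r)).
  exact: continuous_kerz.
by move=> w; apply: (ker_box r0 ra); exact: ball_sub_cbox.
Qed.

(** A compactly supported stand-in for the constant 1: its mollification equals [mass] at centres
    far enough inside the box. *)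
Let one (M : R) : field R := \1_(cbox M).

Lemma itg_one M : itg (one M).
Proof.
apply: (@itg_bounded_cbox _ _ M 1).
- apply: (@measurable_indic _ (mplane R) R setT (cbox M)); exact: measurable_cbox.
- by move=> x; rewrite /one indicE; case: (_ \in _); rewrite ?normr1 ?normr0.
- by move=> x nx; rewrite /one indicE memNset.
Qed.

Lemma one0 M w : ~ cbox M w -> one M w = 0.
Proof. by move=> nx; rewrite /one indicE memNset. Qed.

Lemma mul_one M (f : field R) : (forall w, ~ cbox M w -> f w = 0) ->
  (fun w => one M w * f w) = f.
Proof.
move=> f0; apply/funext => w; rewrite /one indicE.
have [/mem_set ->|nw] := pselect (cbox M w); first by rewrite mul1r.
by rewrite f0// mulr0.
Qed.

(** The constant 1 is harmonic, so [moll_scale] applies: the Laplacian of a compactly supported bump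
    integrates to zero. *)
Lemma mass_scale a b z : 0 < a -> 0 < b -> mass a z = mass b z.
Proof.
move=> a0 b0; pose c := Num.min a b; have c0 : 0 < c by rewrite lt_min a0.
pose r := 1 + c^-1; have r0 : 0 < r by rewrite addr_gt0// invr_gt0.
have rc : r ^- 2 < c.
  rewrite invf_plt ?posrE ?exprn_gt0//; apply: (@lt_le_trans _ _ r).
    by rewrite /r ltrDr.
  by rewrite expr2 ler_peMl ?(ltW r0)// /r lerDl invr_ge0 ltW.
have [ra rb] : r ^- 2 < a /\ r ^- 2 < b by move: rc; rewrite lt_min => /andP[].
pose M := `|z.1| + `|z.2| + r; have bM : ball z r `<=` cbox M by exact: ball_sub_cbox.
have E d : r ^- 2 < d -> mass d z = moll (one M) d z.
  by move=> rd; rewrite /moll mul_one// => w; exact: ker_box bM.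
rewrite (E a ra) (E b rb); apply: (moll_scale (itg_one M) (@one0 M) r0) => // d rd.
have t : test_function setT (bump d z).
  apply: (@test_smooth_rad _ _ _ z r) => //; first exact: rd.
    exact: smooth_bump.
  by move=> w h; rewrite /bump flat_le0.
have lap0 w : ~ cbox M w -> lapbump d z w = 0.
  move=> nw; rewrite /lapbump !(flat_rad_out _ r0 rd) ?mulr0 ?subrr ?mulr0//;
  by move=> bw; apply: nw; exact: bM.
rewrite mul_one//.
have tj j := test_partial j (test_partial j t).
have I j : itg (partial j (partial j (bump d z))).
  have [B _ HB] := test_box (tj j).
  by apply: itg_continuous_compact_support HB; apply: smooth_continuous; case: (tj j).
have Z j : \int[mu]_w partial j (partial j (bump d z)) w = 0.
  have [B _ HB] := test_box (test_partial j t).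
  have [sp _ _] := test_partial j t.
  apply: (integral_partial_eq0 _ _ _ HB).
  - by move=> w; have [] := smooth_is_derive j w sp.
  - exact: smooth_continuous.
  - exact/smooth_continuous/smooth_partial.
rewrite -[RHS](addr0 0) -{1}(Z 0) -{1}(Z 1) -RintegralD//.
by apply: eq_Rintegral => w _; rewrite laplacian_bump.
Qed.

Lemma cboxS (M M' : R) : M <= M' -> cbox M `<=` cbox M'.
Proof.
move=> MM' [x y] [/= hx hy]; move: hx hy; rewrite !in_itv /= -!ler_norml => hx hy.
by split; rewrite /= in_itv /= -ler_norml (le_trans _ MM').
Qed.

Lemma integral_dker_cst j a z r M : 0 < r -> r ^- 2 < a -> ball z r `<=` cbox M ->
  \int[mu]_w (one M w * dker j a z w) = 0.
Proof.
move=> r0 ra bM.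
have E w : dker j a z w = - partial j (ker a z) w by rewrite partial_ker opprK.
rewrite (mul_one (f := dker j a z)) => [|w nw]; last first.
  rewrite /dker (flat_rad_out _ r0 ra) ?mul0r ?mulr0// => bw; apply: nw; exact: bM.
have sk := smooth_class_smooth (smooth_ker a z).
have k0 w : ~ cbox M w -> ker a z w = 0 by move=> nw; exact: (ker_box r0 ra bM nw).
have ck : continuous (partial j (ker a z)) by exact/smooth_continuous/smooth_partial.
have I0 : \int[mu]_w partial j (ker a z) w = 0.
  apply: (integral_partial_eq0 _ _ ck k0).
  - by move=> w; have [] := smooth_is_derive j w sk.
  - exact: smooth_continuous.
have ik : itg (partial j (ker a z)).
  apply: (itg_continuous_compact_support ck (M := M)) => w nw.
  by rewrite partial_ker /dker (flat_rad_out _ r0 ra) ?mul0r ?mulr0 ?oppr0// => bw; apply: nw; exact: bM.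
transitivity (\int[mu]_w (-1 * partial j (ker a z) w)).
  by apply: eq_Rintegral => w _; rewrite mulN1r; exact: E.
by rewrite RintegralZl// I0 mulr0.
Qed.

(** The centre moves first horizontally, then vertically; along both segments the derivative of the
    mollified constant vanishes. *)
Lemma mass_cst a b z z' : 0 < a -> 0 < b -> mass a z = mass b z'.
Proof.
move=> a0 b0; rewrite (mass_scale z a0 b0) {a a0}.
pose r := 1 + b^-1; have r0 : 0 < r by rewrite addr_gt0// invr_gt0.
have rb : r ^- 2 < b.
  rewrite invf_plt ?posrE ?exprn_gt0//; apply: (@lt_le_trans _ _ r).
    by rewrite /r ltrDr.
  by rewrite expr2 ler_peMl ?(ltW r0)// /r lerDl invr_ge0 ltW.
case: z z' => x y [x' y'].
(* [L] strictly bounds all coordinates; the box of size [M] contains the balls of radius [r] about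
   all centres on the way. *)
pose L := `|x| + `|x'| + `|y| + `|y'| + 1; pose M := L + L + r.
have big (t s : R) : `|t| <= L -> `|s| <= L -> ball (t, s) r `<=` cbox M.
  move=> tL sL; apply: subset_trans (@ball_sub_cbox R (t, s) r) _.
  by apply: cboxS; rewrite lerD2r lerD.
have E (t s : R) : `|t| <= L -> `|s| <= L -> mass b (t, s) = moll (one M) b (t, s).
  move=> tL sL; rewrite /moll mul_one// => w; exact: ker_box (big _ _ tL sL).
have nn := (normr_ge0 x, normr_ge0 x', normr_ge0 y, normr_ge0 y').
have [[[n1 n2] n3] n4] := nn.
have Lx : `|x| < L by rewrite /L; lra.
have Lx' : `|x'| < L by rewrite /L; lra.
have Ly : `|y| < L by rewrite /L; lra.
have Ly' : `|y'| < L by rewrite /L; lra.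
rewrite (E x y (ltW Lx) (ltW Ly)) (E x' y' (ltW Lx') (ltW Ly')).
transitivity (moll (one M) b (x', y)).
  apply: (@derive0_itv_cst (fun t => moll (one M) b (t, y)) (- L) L); rewrite -?ltr_norml//.
  move=> t; rewrite -ltr_norml => tL.
  have := (is_derive0P (moll (one M) b) t y _).1 (is_derive_moll (itg_one M) (@one0 M) 0 b (t, y)).
  by rewrite (integral_dker_cst 0 r0 rb (big _ _ (ltW tL) (ltW Ly))).
apply: (@derive0_itv_cst (fun t => moll (one M) b (x', t)) (- L) L); rewrite -?ltr_norml//.
move=> t; rewrite -ltr_norml => tL.
have := (is_derive1P (moll (one M) b) x' t _).1 (is_derive_moll (itg_one M) (@one0 M) 1 b (x', t)).
by rewrite (integral_dker_cst 1 r0 rb (big _ _ (ltW Lx') (ltW tL))).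
Qed.

Lemma flat_P1E (x : R) : flat (P1 R) x = if 0 < x then x ^- 2 * expR (- x^-1) else 0.
Proof.
rewrite /flat; case: ifP => // _; congr (_ * _).
by rewrite /P1 /flat_deriv -polyC1 derivC subr0 mulr1 hornerXn exprVn.
Qed.

Lemma ker_ge0 a z w : 0 <= a -> 0 <= ker a z w.
Proof.
move=> a0; rewrite /ker mulr_ge0// flat_P1E; case: ifP => // _.
by rewrite mulr_ge0 ?expR_ge0// invr_ge0 sqr_ge0.
Qed.

Lemma mass_gt0 a z : 0 < a -> 0 < mass a z.
Proof.
move=> a0; rewrite (mass_cst z (0, 0) a0 ltr01).
(* On the unit square about the origin [rad] lies between 1/2 and 1, so the kernel is at least
   [exp(-2)]. *)
apply: (@lt_le_trans _ _ (\int[mu]_w (expR (- 2) * one 2^-1 w))); last first.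
  apply: le_Rintegral => //.
  - exact/itgZ/itg_one.
  - exact: itg_ker.
  move=> w _; have [wb|nw] := pselect (cbox 2^-1 w); last by rewrite one0// mulr0 ker_ge0.
  rewrite /one indicE mem_set// mulr1 /ker mul1r flat_P1E.
  have [w1 w2] : w.1 ^+ 2 <= 4^-1 /\ w.2 ^+ 2 <= 4^-1.
    have -> : 4^-1 = (2^-1) ^+ 2 :> R by field.
    case: wb => /=; rewrite !in_itv /= -!ler_norml => h1 h2.
    by rewrite -(real_normK (num_real w.1)) -(real_normK (num_real w.2)) !lerXn2r ?nnegrE.
  have [r1 r2] : 2^-1 <= rad 1 (0, 0) w /\ rad 1 (0, 0) w <= 1.
    rewrite /rad /dist2 /crd /= !sub0r !sqrrN mul1r.
    by have := sqr_ge0 w.1; have := sqr_ge0 w.2; split; lra.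
  have r0 : 0 < rad 1 (0, 0) w by lra.
  rewrite r0 -[leLHS]mul1r ler_pM//.
    by rewrite invf_ge1 ?exprn_gt0// exprn_ile1// ltW.
  by rewrite ler_expR lerN2 invf_ple ?posrE.
rewrite RintegralZl//; last exact: itg_one.
apply: mulr_gt0; first exact: expR_gt0.
have mE : leb2 R (cbox 2^-1) = 1%:E.
  have -> : leb2 R (cbox 2^-1) = (lebesgue_measure `[(- 2^-1)%R, 2^-1%R] *
      lebesgue_measure `[(- 2^-1)%R, 2^-1%R])%E.
    by rewrite /leb2 /cbox -product_measure1E.
  rewrite lebesgue_measure_itv /= lte_fin gtrN ?invr_gt0// -EFinD -EFinM.
  have -> : 2^-1 - - 2^-1 = 1 :> R by lra.
  by rewrite mulr1.
have := integral_indic mu measurableT (@measurable_cbox R 2^-1).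
rewrite setIT => e; have e1 : \int[mu]_x one 2^-1 x = 1.
  by rewrite /Rintegral -[RHS]/(fine 1%:E) -mE; congr fine; exact: e.
by apply: (lt_le_trans ltr01); rewrite -[leLHS]e1.
Qed.

(** The kernel is itself an admissible test function, and its derivatives in [z] and [w] are
    opposite: the mollified field is curl free at [z] in the classical sense. *)
Lemma moll_curl (N0 N1 : field R) (U : set (plane R)) (M : R) a z r :
  itg N0 -> itg N1 -> (forall w, ~ cbox M w -> N0 w = 0) -> (forall w, ~ cbox M w -> N1 w = 0) ->
  (forall psi, test_function U psi ->
    \int[mu]_w (N0 w * partial 1 psi w) = \int[mu]_w (N1 w * partial 0 psi w)) ->
  0 < r -> r ^- 2 < a -> ball z r `<=` U ->
  \int[mu]_w (N1 w * dker 0 a z w) = \int[mu]_w (N0 w * dker 1 a z w).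
Proof.
move=> i0 i1 h0 h1 curl r0 ra bU.
have t : test_function U (ker a z).
  apply: (test_smooth_rad r0 ra bU (smooth_ker a z)) => w hw.
  by rewrite /ker flat_le0 ?mulr0.
have ck j : continuous (partial j (ker a z)).
  by apply/smooth_continuous/smooth_partial; case: t.
have E (N : field R) j : itg (fun w => N w * partial j (ker a z) w) ->
    \int[mu]_w (N w * dker j a z w) = - 1 * \int[mu]_w (N w * partial j (ker a z) w).
  move=> iN; rewrite -(RintegralZl _ measurableT iN); apply: eq_Rintegral => w _.
  by rewrite partial_ker mulrN mulN1r opprK.
rewrite (E N1 0 (itg_mul_continuous i1 h1 (ck 0))) (E N0 1 (itg_mul_continuous i0 h0 (ck 1))).
exact: (congr1 (fun x => -1 * x) (esym (curl _ t))).
Qed.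

(** Curl and divergence together make each component weakly harmonic: for [N0] the curl identity is
    tested with [partial 1] of a bump and the divergence identity with [partial 0] of it, and
    conversely for [N1]. The divergence identity is assumed only on [smooth_class], where mixed
    derivatives commute. *)
Lemma weyl (N0 N1 : field R) (U : set (plane R)) (M : R) a b z r :
  itg N0 -> itg N1 -> (forall w, ~ cbox M w -> N0 w = 0) -> (forall w, ~ cbox M w -> N1 w = 0) ->
  (forall psi, test_function U psi ->
    \int[mu]_w (N0 w * partial 1 psi w) = \int[mu]_w (N1 w * partial 0 psi w)) ->
  (forall psi, smooth_class psi -> test_function U psi ->
    \int[mu]_w (N0 w * partial 0 psi w) + \int[mu]_w (N1 w * partial 1 psi w) = 0) ->
  0 < r -> r ^- 2 < a -> r ^- 2 < b -> ball z r `<=` U ->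
  moll N0 a z = moll N0 b z /\ moll N1 a z = moll N1 b z.
Proof.
move=> i0 i1 h0 h1 curl div r0 ra rb bU.
have t c : r ^- 2 < c -> test_function U (bump c z).
  move=> rc; apply: (test_smooth_rad r0 rc bU (smooth_bump c z)) => w hw.
  by rewrite /bump flat_le0.
have ct c i j : r ^- 2 < c -> continuous (partial i (partial j (bump c z))).
  move=> rc; have tc := test_partial i (test_partial j (t c rc)).
  by apply: smooth_continuous; case: tc.
split.
- apply: (moll_scale i0 h0 r0) => // c rc.
  under eq_Rintegral do rewrite -laplacian_bump mulrDr.
  rewrite (RintegralD measurableT (itg_mul_continuous i0 h0 (ct _ 0 0 rc))
    (itg_mul_continuous i0 h0 (ct _ 1 1 rc))).
  exact: (etrans (congr1 (fun x => _ + x) (etrans (curl _ (test_partial 1 (t c rc)))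
    (congr1 (fun F : field R => \int[mu]_w (N1 w * F w)) (partial_bump_sym c z))))
    (div _ (smooth_class_partial 0 (smooth_bump c z)) (test_partial 0 (t c rc)))).
- apply: (moll_scale i1 h1 r0) => // c rc.
  under eq_Rintegral do rewrite -laplacian_bump mulrDr.
  rewrite (RintegralD measurableT (itg_mul_continuous i1 h1 (ct _ 0 0 rc))
    (itg_mul_continuous i1 h1 (ct _ 1 1 rc))).
  exact: (etrans (congr1 (fun x => x + _) (etrans (esym (curl _ (test_partial 0 (t c rc))))
    (congr1 (fun F : field R => \int[mu]_w (N0 w * F w)) (esym (partial_bump_sym c z)))))
    (div _ (smooth_class_partial 1 (smooth_bump c z)) (test_partial 1 (t c rc)))).
Qed.

End Mollification.

(** * Fubini's theorem and limits of mollifications *)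

Section FubiniPlane.
Variable R : realType.

Lemma sigma_finite_leb2 : sigma_finite setT (leb2 R).
Proof.
exists (fun n => cbox n%:R).
  apply/seteqP; split=> // -[x y] _.
  exists (Num.truncn (Num.max `|x| `|y|)).+1 => //.
  have := truncnS_gt (Num.max `|x| `|y|); rewrite gt_max => /andP[? ?].
  by split; rewrite /= in_itv /= -ler_norml ltW.
by move=> n; split; [exact: measurable_cbox|exact: leb2_cbox].
Qed.

(** [leb2] repackaged with its sigma-finiteness, as Fubini's theorem asks for. *)
Definition leb2sf : {sigma_finite_measure set (mplane R) -> \bar R} :=
  HB.pack_for {sigma_finite_measure set (mplane R) -> \bar R} (Measure.sort (leb2 R)) (Measure_isSigmaFinite.Build _ _ _ (leb2 R) sigma_finite_leb2).
Lemma Fubini_leb2 (f : mplane R * mplane R -> R) (g h : mplane R -> R) :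
  measurable_fun setT f -> itg g -> itg h -> (forall z w, `|f (z, w)| <= `|g z| * `|h w|) ->
  \int[leb2 R]_z \int[leb2 R]_w f (z, w) = \int[leb2 R]_w \int[leb2 R]_z f (z, w).
Proof.
move=> mf ig ih fgh.
have iF : ((leb2sf \x leb2sf)%E).-integrable setT (EFin \o f).
  have mEf : measurable_fun setT (EFin \o f) by exact/measurable_EFinP.
  apply/(integrable12ltyP leb2sf leb2sf mEf).
  have ih' := integrable_norm ih; have ig' := integrable_norm ig.
  apply: (@le_lt_trans _ _ (\int[leb2 R]_z ((`|g z|)%:E * \int[leb2 R]_w (`|h w|)%:E))%E).
    apply: ge0_le_integral => //.
    - by move=> z _; exact: integral_ge0.
    - apply: (@measurable_fun_fubini_tonelli_F _ _ _ _ _ leb2sf (fun p => `|(f p)%:E|%E)) => //.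
      exact: measurableT_comp.
    - apply: emeasurable_funM; last exact: measurable_cst.
      by case/integrableP : ig'.
    move=> z _; rewrite -integralZl//.
    apply: ge0_le_integral.
    - exact: measurableT.
    - by move=> w _; exact: abse_ge0.
    - by apply: measurableT_comp => //; apply/measurable_EFinP; exact: measurableT_comp.
    - by apply: emeasurable_funM; [exact: measurable_cst|case/integrableP : ih'].
    - by move=> w _; rewrite -EFinM lee_fin.
  have [c cE] : exists c, (\int[leb2 R]_w (`|h w|)%:E = c%:E)%E.
    by exists (fine (\int[leb2 R]_w (`|h w|)%:E)%E); rewrite fineK//; exact: integrable_fin_num.
  rewrite cE; under eq_integral do rewrite muleC.
  rewrite integralZl// -[X in (_ * X)%E]fineK; last exact: integrable_fin_num.
  by rewrite -EFinM ltry.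
have FF := Fubini iF.
have i1 z : itg (fun w => f (z, w)).
  apply: (itg_le _ (itgZ `|g z| (integrable_norm ih))) => [|w]; last exact: fgh.
  exact: measurableT_comp.
have i2 w : itg (fun z => f (z, w)).
  apply: (itg_le _ (itgZ `|h w| (integrable_norm ig))) => [|z].
    exact: measurableT_comp.
  by rewrite mulrC; exact: fgh.
have E1 : \int[leb2 R]_z \int[leb2 R]_w f (z, w) = fine (\int[leb2sf]_z \int[leb2sf]_w (f (z, w))%:E)%E.
  rewrite /Rintegral; congr fine; apply: eq_integral => z _.
  by rewrite fineK//; exact: (integrable_fin_num measurableT (i1 z)).
rewrite E1 [X in fine X]FF /Rintegral; congr fine; apply: eq_integral => w _.
by rewrite fineK//; exact: (integrable_fin_num measurableT (i2 w)).
Qed.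

Lemma measurable_crd2 (i : 'I_2) (p : mplane R * mplane R -> mplane R) :
  measurable_fun setT p -> measurable_fun setT (fun z => crd i (p z)).
Proof.
by move=> mp; have [->|->] := ord2P i; rewrite /crd /=;
  apply: (measurableT_comp _ mp); [exact: measurable_fst|exact: measurable_snd].
Qed.

Lemma measurable_ker2 (a : R) :
  measurable_fun setT (fun p : mplane R * mplane R => ker a p.1 p.2).
Proof.
have md i : measurable_fun setT (fun p : mplane R * mplane R => crd i p.1 - crd i p.2).
  by apply: measurable_funB; apply: measurable_crd2; [exact: measurable_fst|exact: measurable_snd].
apply: measurable_funM => //; apply: (@measurableT_comp _ _ _ _ _ _ (@flat R (P1 R))).
  apply: continuous_measurable_fun => x; exact: continuous_flat.
rewrite /rad /dist2; apply: measurable_funB => //; apply: measurable_funM => //.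
by apply: measurable_funD; apply: measurable_funX.
Qed.

Lemma ker_bounded (a : R) : 0 < a -> exists2 C, 0 <= C & forall z w : plane R, `|ker a z w| <= C.
Proof.
move=> a0; have [C C0 HC] := flat_quadratic (P1 R).
exists (a * C); first by rewrite mulr_ge0// ltW.
move=> z w; rewrite /ker normrM (gtr0_norm a0) ler_wpM2l ?(ltW a0)//.
have [r0|r0] := leP (rad a z w) 0; first by rewrite flat_le0// normr0.
apply: le_trans (HC _) _; rewrite ler_piMr// expr_le1 ?(ltW r0)//.
by rewrite /rad lerBlDr lerDl mulr_ge0 ?(ltW a0)// addr_ge0// sqr_ge0.
Qed.

(** Fubini, with the symmetry of the kernel in its two points. *)
Lemma moll_adjoint (psi N : field R) (a : R) : 0 < a -> itg psi -> itg N ->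
  \int[leb2 R]_w (psi w * moll N a w) = \int[leb2 R]_v (N v * moll psi a v).
Proof.
move=> a0 ipsi iN; have [C C0 HC] := ker_bounded a0.
have mpsi : measurable_fun setT (psi : mplane R -> R).
  by apply/measurable_EFinP; case/integrableP : ipsi.
have mN : measurable_fun setT (N : mplane R -> R).
  by apply/measurable_EFinP; case/integrableP : iN.
have iK (f : field R) z : itg f -> itg (fun w => f w * ker a z w).
  move=> if_; apply: (itg_le _ (itgZ C (integrable_norm if_))) => [|w].
    apply: measurable_funM; first by apply/measurable_EFinP; case/integrableP : if_.
    apply: continuous_measurable_plane => x; exact: continuous_kerz.
  by rewrite normrM mulrC ler_wpM2r.
pose f (p : mplane R * mplane R) := psi p.1 * (N p.2 * ker a p.1 p.2).
transitivity (\int[leb2 R]_w \int[leb2 R]_v f (w, v)).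
  by apply: eq_Rintegral => w _; exact: (esym (RintegralZl (psi w) measurableT (iK N w iN))).
transitivity (\int[leb2 R]_v \int[leb2 R]_w f (w, v)); last first.
  apply: eq_Rintegral => v _; apply: etrans (RintegralZl (N v) measurableT (iK psi v ipsi)).
  by apply: eq_Rintegral => w _; rewrite /f kerC mulrCA.
apply: (@Fubini_leb2 f (fun w => psi w) (fun v => C * N v)).
- apply: measurable_funM; first exact: (measurableT_comp mpsi measurable_fst).
  apply: measurable_funM; first exact: (measurableT_comp mN measurable_snd).
  exact: measurable_ker2.
- exact: ipsi.
- exact: itgZ.
- move=> w v; rewrite /f [X in `|X|]/= 2!normrM (normrM C) (ger0_norm C0).
  apply: ler_wpM2l; first exact: normr_ge0.
  rewrite mulrC; apply: ler_wpM2r; [exact: normr_ge0|exact: HC].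
Qed.

(** As soon as [d^-2 < n + 1] the kernel is supported where [psi] is within [e / m] of [psi v]. *)
Lemma moll_cvg (psi : field R) (L : R) v : continuous psi -> (forall w, ~ cbox L w -> psi w = 0) ->
  moll psi n.+1%:R v @[n --> \oo] --> mass 1 0 * psi v.
Proof.
move=> cpsi psi0; apply/cvgrPdist_le => e e0.
pose m : R := mass 1 0; have m0 : 0 < m by exact: mass_gt0.
have ipsi : itg psi by exact: itg_continuous_compact_support psi0.
have := cpsi v => /cvgrPdist_le/(_ (e / m)); rewrite divr_gt0// => /(_ isT).
move=> /nbhs_ballP[d /= d0 Hd].
exists (Num.truncn (d ^- 2)) => // n /= dn.
have nd : d ^- 2 < n.+1%:R :> R by rewrite (lt_le_trans (truncnS_gt _))// ler_nat ltnS.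
have ik : itg (ker n.+1%:R v) by exact: itg_ker.
have ipk : itg (fun w => psi w * ker n.+1%:R v w).
  by apply: (itg_mul_continuous ipsi psi0); exact: continuous_kerz.
rewrite -/m /m (mass_cst 0 v ltr01 (ltr0Sn R n)) /mass mulrC -RintegralZl// /moll.
rewrite -RintegralB//; last exact: itgZ.
apply: (@le_trans _ _ (\int[leb2 R]_w (e / m * ker n.+1%:R v w))).
  apply: le_trans (le_normr_Rintegral _ _) _ => //; first exact: (itgB (itgZ _ ik)).
  apply: le_Rintegral => //.
  - exact: (integrable_norm (itgB (itgZ _ ik) ipk)).
  - exact: itgZ.
  move=> w _; rewrite -mulrBl normrM (ger0_norm (ker_ge0 _ _ _))//.
  have [bw|nb] := pselect (ball v d w); last first.
    by rewrite /ker (flat_rad_out _ d0 nd nb) !mulr0.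
  by rewrite ler_wpM2r ?ker_ge0//; exact: Hd.
rewrite RintegralZl// -/(mass _ _) (mass_cst v 0 (ltr0Sn R n) ltr01) -/m.
by rewrite divfK// gt_eqF.
Qed.

(** Dominated convergence: the mollifications of [psi] are uniformly bounded by [B * m]. *)
Lemma moll_weak_limit (psi N : field R) (L : R) : continuous psi ->
  (forall w, ~ cbox L w -> psi w = 0) -> itg N ->
  \int[leb2 R]_v (N v * moll psi n.+1%:R v) @[n --> \oo] -->
  \int[leb2 R]_v (N v * (mass 1 0 * psi v)).
Proof.
move=> cpsi psi0 iN; pose m : R := mass 1 0.
have ipsi : itg psi by exact: itg_continuous_compact_support psi0.
have [B B0 HB] := continuous_compact_support_bounded cpsi psi0.
have mN : measurable_fun setT (N : mplane R -> R).
  by apply/measurable_EFinP; case/integrableP : iN.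
have cm n : continuous (moll psi n.+1%:R) by exact: (continuous_moll ipsi psi0).
have bm n v : `|moll psi n.+1%:R v| <= B * m.
  have ik : itg (ker n.+1%:R v) by exact: itg_ker.
  have ipk : itg (fun w => psi w * ker n.+1%:R v w).
    by apply: (itg_mul_continuous ipsi psi0); exact: continuous_kerz.
  apply: le_trans (le_normr_Rintegral _ _) _ => //.
  rewrite /m -(mass_cst v 0 (ltr0Sn R n) ltr01) /mass -RintegralZl//.
  apply: le_Rintegral => //; [exact: integrable_norm|exact: itgZ|].
  by move=> w _; rewrite normrM (ger0_norm (ker_ge0 _ _ _))// ler_wpM2r ?ker_ge0.
have [] := @dominated_convergence _ (mplane R) R (leb2 R) setT measurableT
  (fun n v => (N v * moll psi n.+1%:R v)%:E) (fun v => (N v * (m * psi v))%:E)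
  (fun v => (B * m * `|N v|)%:E).
- move=> n; apply/measurable_EFinP; apply: measurable_funM => //.
  exact: continuous_measurable_plane.
- apply/measurable_EFinP; apply: measurable_funM => //; apply: measurable_funM => //.
  exact: continuous_measurable_plane.
- apply: aeW => v _; apply: cvg_EFin; first exact: nearW.
  by apply: (@cvgM _ _ _ _ (fun=> N v) (fun n => moll psi n.+1%:R v)); [exact: cvg_cst|exact: (moll_cvg (L := L))].
- exact/itgZ/integrable_norm.
- by apply: aeW => v n _; rewrite lee_fin normrM mulrC ler_wpM2r.
move=> il _ H.
have {}H : (\int[leb2 R]_v (N v * moll psi n.+1%:R v)%:E)%E @[n --> \oo] -->
    (\int[leb2 R]_v (N v * (m * psi v)))%:E.
  by rewrite /Rintegral fineK; [exact: H|exact: integrable_fin_num].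
by have /fine_cvgP [_] := H.
Qed.

End FubiniPlane.

(** * The fundamental lemma of the calculus of variations *)

Section FundamentalLemma.
Variable R : realType.
Notation mu := (leb2 R).

(** Quadrants form a pi-system generating the product sigma-algebra, and their indicators are limits
    of products of continuous functions of one variable. *)
Definition quadrant (a b : R) : set (plane R) := [set w | a < w.1 /\ b < w.2].

Lemma open_quadrant a b : open (quadrant a b).
Proof.
have -> : quadrant a b = (fst @^-1` `]a, +oo[) `&` (snd @^-1` `]b, +oo[).
  by apply/seteqP; split=> w; rewrite /quadrant /= !in_itv /= !andbT.
apply: openI.
  by apply: open_comp => [w _|]; [exact: cvg_fst|exact: interval_open].
by apply: open_comp => [w _|]; [exact: cvg_snd|exact: interval_open].
Qed.

Definition quadrants : set (set (mplane R)) :=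
  [set E | exists a b, E = quadrant a b].

Lemma quadrants_setI : setI_closed quadrants.
Proof.
move=> _ _ [a [b ->]] [a' [b' ->]]; exists (Num.max a a'), (Num.max b b').
apply/seteqP; split=> w; rewrite /quadrant /= !gt_max.
  by move=> [[-> ->] [-> ->]].
by move=> [/andP[-> ->] /andP[-> ->]].
Qed.

Lemma quadrant_halfplane0 a : <<s quadrants >> [set w : mplane R | a < w.1].
Proof.
have -> : [set w : mplane R | a < w.1] = \bigcup_n quadrant a (- n%:R).
  apply/seteqP; split=> [w /= aw|w [n _ []]//].
  exists (Num.truncn (- w.2)).+1 => //; split=> //.
  by rewrite ltrNl; exact: truncnS_gt.
have sa : sigma_algebra setT <<s quadrants >> by exact: smallest_sigma_algebra.
by case: sa => _ _ H; apply: H => n; apply: sub_gen_smallest; exists a, (- n%:R).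
Qed.

Lemma quadrant_halfplane1 b : <<s quadrants >> [set w : mplane R | b < w.2].
Proof.
have -> : [set w : mplane R | b < w.2] = \bigcup_n quadrant (- n%:R) b.
  apply/seteqP; split=> [w /= bw|w [n _ []]//].
  exists (Num.truncn (- w.1)).+1 => //; split=> //.
  by rewrite ltrNl; exact: truncnS_gt.
have sa : sigma_algebra setT <<s quadrants >> by exact: smallest_sigma_algebra.
by case: sa => _ _ H; apply: H => n; apply: sub_gen_smallest; exists (- n%:R), b.
Qed.

Let qplane := g_sigma_algebraType quadrants.

Lemma measurable_quadrants (E : set (mplane R)) : measurable E -> <<s quadrants >> E.
Proof.
have m0 : measurable_fun setT (fst : qplane -> measurableTypeR R).
  apply: (measurability _ (RGenOInfty.measurableE R)) => _ [_ [a ->] <-].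
  rewrite setTI (_ : _ @^-1` _ = [set w : mplane R | a < w.1]); last first.
    by apply/seteqP; split=> w /=; rewrite in_itv /= andbT.
  exact: quadrant_halfplane0.
have m1 : measurable_fun setT (snd : qplane -> measurableTypeR R).
  apply: (measurability _ (RGenOInfty.measurableE R)) => _ [_ [a ->] <-].
  rewrite setTI (_ : _ @^-1` _ = [set w : mplane R | a < w.2]); last first.
    by apply/seteqP; split=> w /=; rewrite in_itv /= andbT.
  exact: quadrant_halfplane1.
rewrite measurable_prod_measurableType; apply: smallest_sub.
  exact: smallest_sigma_algebra.
move=> _ [A mA [B mB <-]].
have : (measurable : set (set qplane)) ((setT `&` fst @^-1` A) `&` (setT `&` snd @^-1` B)).
  by apply: measurableI; [exact: m0|exact: m1].
by rewrite !setTI.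
Qed.

Section Vanishing.
Variable D : field R.
Hypothesis iD : itg D.

Let I (E : set (plane R)) : R := \int[mu]_w (D w * \1_E w).

Lemma itg_mul_indic (E : set (mplane R)) : measurable E -> itg (fun w => D w * \1_E w).
Proof.
move=> mE; apply: (itg_le _ (integrable_norm iD)) => [|w].
  apply: measurable_funM; first by apply/measurable_EFinP; case/integrableP : iD.
  exact: measurable_indic.
by rewrite /= normrM indicE; case: (_ \in _); rewrite /= ?normr1 ?mulr1 ?normr0 ?mulr0 ?lexx.
Qed.

Lemma bounded_cvg_integral (psi : nat -> field R) (E : set (mplane R)) : measurable E ->
  (forall n, measurable_fun setT (psi n : mplane R -> R)) ->
  (forall n w, `|psi n w| <= 1) -> (forall w, D w != 0 -> psi n w @[n --> \oo] --> (\1_E w : R)) ->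
  (forall n, \int[mu]_w (D w * psi n w) = 0) -> I E = 0.
Proof.
move=> mE mpsi bpsi cpsi psi0.
have mD : measurable_fun setT (D : mplane R -> R).
  by apply/measurable_EFinP; case/integrableP : iD.
have [] := @dominated_convergence _ (mplane R) R mu setT measurableT
  (fun n w => (D w * psi n w)%:E) (fun w => (D w * \1_E w)%:E) (fun w => `|D w|%:E).
- by move=> n; apply/measurable_EFinP; exact: measurable_funM.
- by apply/measurable_EFinP; apply: measurable_funM => //; exact: measurable_indic.
- apply: aeW => w _; apply: cvg_EFin; first exact: nearW.
  have [D0|D0] := eqVneq (D w) 0.
    by rewrite D0 mul0r; apply: cvg_near_cst; apply: nearW => n /=; rewrite mul0r.
  by apply: (@cvgM _ _ _ _ (fun=> D w) (fun n => psi n w)); [exact: cvg_cst|exact: cpsi].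
- exact: integrable_norm.
- by apply: aeW => w n _; rewrite lee_fin normrM ler_piMr.
move=> il _ H.
have E0 n : (\int[mu]_w (D w * psi n w)%:E)%E = 0%E.
  have iDp : itg (fun w => D w * psi n w).
    apply: (itg_le _ (integrable_norm iD)) => [|w]; first exact: measurable_funM.
    by rewrite normrM ler_piMr.
  rewrite -[LHS]fineK; last exact: (integrable_fin_num measurableT iDp).
  by congr EFin; exact: psi0.
have {}H : (\int[mu]_w (D w * \1_E w)%:E)%E = 0%E.
  apply/esym; apply: (cvg_unique (@ereal_hausdorff R) _ H).
  by apply: cvg_near_cst; apply: nearW.
by rewrite /I /Rintegral H.
Qed.

Hypothesis IQ : forall a b, I (quadrant a b) = 0.
Variable L : R.
Hypothesis D0 : forall w, ~ cbox L w -> D w = 0.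

(** Dynkin's lemma: the sets on which [D] integrates to zero form a lambda-system containing the
    quadrants. *)
Lemma integral_indic_eq0 (E : set (mplane R)) : measurable E -> I E = 0.
Proof.
have mq a b : measurable (quadrant a b : set (mplane R)).
  by apply: open_measurable_plane; exact: open_quadrant.
suff : <<s quadrants >> `<=` [set E : set (mplane R) | measurable E /\ I E = 0].
  by move=> H mE; have [] := H _ (measurable_quadrants mE).
apply: lambda_system_subset => //; first exact: quadrants_setI.
split=> //.
(* A quadrant with its corner below the box that carries [D] does the work of the whole plane. *)
- split=> //; rewrite -(IQ (- `|L| - 1) (- `|L| - 1)).
  apply: eq_Rintegral => w _; have [[hx hy]|/D0 ->] := pselect (cbox L w); last by rewrite !mul0r.
  rewrite !indicE !mem_set//; split; move: hx hy; rewrite /= !in_itv /= => /andP[h1 _] /andP[h2 _];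
    have := ler_norm L; lra.
- move=> A B BA [mA IA] [mB IB]; split; first exact: measurableD.
  have -> : I (A `\` B) = I A - I B.
    rewrite /I -RintegralB//; [|exact: itg_mul_indic..].
    apply: eq_Rintegral => w _; rewrite -mulrBr; congr (_ * _); rewrite !indicE in_setD.
    have [/[dup] wB /BA wA|wB] := pselect (B w).
      by rewrite (mem_set wB) (mem_set wA) /= subrr.
    by rewrite (memNset wB) /= andbT subr0.
  by rewrite IA IB subrr.
- move=> F ndF HF; have mF n : measurable (F n : set (mplane R)) by case: (HF n).
  have mU : measurable (\bigcup_n F n : set (mplane R)) by exact: bigcupT_measurable.
  split=> //; apply: (@bounded_cvg_integral (fun n => \1_(F n))) => //.
  + by move=> n w; rewrite indicE; case: (_ \in _); rewrite ?normr1 ?normr0.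
  + move=> w _; apply: cvg_near_cst.
    have [[N _ FN]|nU] := pselect ((\bigcup_n F n) w).
      have wU : (\bigcup_n F n) w by exists N.
      exists N => // n /= Nn; have /subsetPset/(_ w FN) Fn := ndF N n Nn.
      by rewrite !indicE (mem_set wU) (mem_set Fn).
    apply: nearW => n; rewrite !indicE !memNset// => Fn; apply: nU; by exists n.
  + by move=> n; case: (HF n).
- by move=> {}E [a [b ->]].
Qed.

Lemma ae_eq0_of_quadrants : {ae mu, forall w, D w = 0}.
Proof.
have := @integral_ae_eq _ (mplane R) R mu setT measurableT (cst 0%E) (EFin \o D) iD (measurable_cst _).
have H (E : set (mplane R)) : E `<=` setT -> measurable E ->
    (\int[mu]_(x in E) (EFin \o D) x = \int[mu]_(x in E) cst 0 x)%E.
  move=> _ mE; rewrite integral0 integral_mkcond.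
  have -> : (EFin \o D) \_ E = EFin \o (fun w => D w * \1_E w).
    apply/funext => w; rewrite /patch /= indicE; case: (_ \in _); by rewrite ?mulr1 ?mulr0.
  rewrite -[LHS]fineK; last exact: (integrable_fin_num measurableT (itg_mul_indic mE)).
  by congr EFin; exact: integral_indic_eq0.
move=> /(_ H); apply: filterS => w /(_ Logic.I) /= []; exact.
Qed.

End Vanishing.

Definition clip (t : R) : R := Num.max 0 (Num.min 1 t).

Lemma continuous_clip01 : continuous clip.
Proof.
move=> t; apply: (@continuous_max R R (fun=> 0) (fun t => Num.min 1 t)); first exact: cvg_cst.
by apply: (@continuous_min R R (fun=> 1) id); [exact: cvg_cst|exact: cvg_id].
Qed.

Lemma clip_bound t : 0 <= clip t <= 1.
Proof. by rewrite /clip le_max lexx /= ge_max ler01 ge_min lexx. Qed.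

Lemma clip_le0 t : t <= 0 -> clip t = 0.
Proof. by move=> t0; rewrite /clip max_l// ge_min t0 orbT. Qed.

Lemma clip_ge1 t : 1 <= t -> clip t = 1.
Proof. by move=> t1; rewrite /clip min_l// max_r. Qed.

Lemma clip_cvg t : clip (n%:R * t) @[n --> \oo] --> (((0 < t)%R)%:R : R).
Proof.
apply: cvg_near_cst; have [t0|t0] := ltP 0 t; last first.
  by apply: nearW => n; rewrite clip_le0// mulr_ge0_le0.
exists (Num.truncn t^-1).+1 => // n /= tn; rewrite clip_ge1//.
by rewrite -ler_pdivrMr// mul1r (le_trans (ltW (truncnS_gt _)))// ler_nat.
Qed.

Lemma ae_eq0_of_continuous (D : field R) (z : plane R) (r : R) : itg D ->
  (forall w, ~ ball z r w -> D w = 0) ->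
  (forall psi : field R, continuous psi -> (forall w, ~ ball z r w -> psi w = 0) ->
     \int[mu]_w (D w * psi w) = 0) ->
  {ae mu, forall w, D w = 0}.
Proof.
move=> iD D0 H.
apply: (@ae_eq0_of_quadrants D iD _ (`|z.1| + `|z.2| + r)) => [a b|w nw]; last first.
  by apply: D0 => bw; apply: nw; exact: ball_sub_cbox.
(* Continuous approximations of the indicator of the quadrant; the first factor makes them vanish
   outside the ball, where [D] is zero. *)
pose psi (n : nat) (w : plane R) := clip (n%:R * (r - `|z - w|)) *
  (clip (n%:R * (w.1 - a)) * clip (n%:R * (w.2 - b))).
have cc (f : field R) : continuous f -> continuous (fun w => clip (f w)).
  by move=> cf w; apply: (@continuous_comp _ _ _ f clip); [exact: cf|exact: continuous_clip01].
have cpsi n : continuous (psi n).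
  move=> w; apply: cvgM; last apply: cvgM.
  - apply: cc => {}w; apply: cvgM; first exact: cvg_cst.
    apply: cvgB; first exact: cvg_cst.
    by apply: cvg_norm; apply: cvgB; [exact: cvg_cst|exact: cvg_id].
  - apply: (cc (fun w => n%:R * (w.1 - a))) => {}w; apply: cvgM; first exact: cvg_cst.
    by apply: cvgB; [exact: cvg_fst|exact: cvg_cst].
  - apply: (cc (fun w => n%:R * (w.2 - b))) => {}w; apply: cvgM; first exact: cvg_cst.
    by apply: cvgB; [exact: cvg_snd|exact: cvg_cst].
have ballE w : ball z r w = (`|z - w| < r) :> Prop.
  by rewrite -ball_normE.
apply: (@bounded_cvg_integral D iD psi).
- by apply: open_measurable_plane; exact: open_quadrant.
- by move=> n; exact: continuous_measurable_plane.
- move=> n w; rewrite /psi.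
  have /andP[p0 p1] := clip_bound (n%:R * (r - `|z - w|)).
  have /andP[q0 q1] := clip_bound (n%:R * (w.1 - a)).
  have /andP[s0 s1] := clip_bound (n%:R * (w.2 - b)).
  by rewrite ger0_norm ?mulr_ge0// mulr_ile1 ?mulr_ge0// mulr_ile1.
- move=> w Dw; have bw : ball z r w.
    by apply: contrapT => /D0 /eqP; rewrite (negbTE Dw).
  have -> : \1_(quadrant a b) w = ((0 < r - `|z - w|)%R)%:R * (((0 < w.1 - a)%R)%:R * ((0 < w.2 - b)%R)%:R) :> R.
    have bw' : `|z - w| < r by rewrite -ballE.
    rewrite !subr_gt0 bw' mul1r -natrM mulnb indicE; congr (nat_of_bool _)%:R.
    apply/idP/idP => [/set_mem[-> ->]//|/andP[h1 h2]]; exact/mem_set.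
  by apply: cvgM; [exact: clip_cvg|apply: cvgM; exact: clip_cvg].
- move=> n; apply: H => // w; rewrite ballE => /negP; rewrite -leNgt => rw.
  by rewrite /psi clip_le0 ?mul0r// mulr_ge0_le0// subr_le0.
Qed.

End FundamentalLemma.

(** * Closed fields on simply connected domains *)

Section Poincare.
Variable R : realType.
Notation mu1 := (@lebesgue_measure R).

Lemma itg1_continuous (f : R -> R) (a b : R) : continuous f -> mu1.-integrable `[a, b] (EFin \o f).
Proof.
move=> cf; apply: continuous_compact_integrable; first exact: segment_compact.
exact: continuous_subspaceT.
Qed.

Lemma is_derive_primitive (f : R -> R) (a x : R) : continuous f -> a < x ->
  is_derive x (1 : R) (fun x => \int[mu1]_(t in `[a, x]) f t) (f x).
Proof.
move=> cf ax.
have [d e] := @continuous_FTC1_closed R f a x (x + 1) ltac:(by rewrite ltrDl)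
  (itg1_continuous _ _ cf) ax (cf x).
by split; [exact: d|apply: etrans e; rewrite derive1E].
Qed.

Lemma Rintegral_derive (F f : R -> R) (a b : R) : a < b -> continuous f ->
  (forall x, is_derive x (1 : R) F (f x)) ->
  \int[mu1]_(t in `[a, b]) f t = F b - F a.
Proof.
move=> ab cf dF.
have cF : continuous F.
  by move=> x; apply/differentiable_continuous/derivable1_diffP; have [] := dF x.
have dFab : derivable_oo_LRcontinuous F a b.
  split=> [x _||]; first by have [] := dF x.
  + exact/cvg_at_right_filter/cF.
  + exact/cvg_at_left_filter/cF.
rewrite /Rintegral (continuous_FTC2 ab (continuous_subspaceT cf) dFab) => [|x _].
  by rewrite -EFinB.
by rewrite derive1E; have [] := dF x.
Qed.

Lemma is_derive_integral_param (f g : field R) (a b x : R) : continuous f -> continuous g ->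
  (forall z, is_derive z (basis R 0) f (g z)) ->
  is_derive x (1 : R) (fun x => \int[mu1]_(t in `[a, b]) f (x, t))
    (\int[mu1]_(t in `[a, b]) g (x, t)).
Proof.
move=> cf cg df.
have /compact_bounded [B [_ HB]] : compact (g @` (`[x - 1, x + 1] `*` `[a, b])).
  apply: continuous_compact; first exact: continuous_subspaceT.
  by apply: compact_setX; exact: segment_compact.
have cs (h : field R) (y : R) : continuous h -> continuous (fun t => h (y, t)).
  by move=> ch t; apply: continuous_slice1; exact: ch.
have dfx y t : is_derive y (1 : R) (fun y => f (y, t)) (g (y, t)).
  exact/is_derive0P.
have Ix : `]x - 1, x + 1[%classic x by rewrite /= in_itv /= ltrDl gtrBl ltr01.
have iC : mu1.-integrable `[a, b] (EFin \o (fun _ : R => `|B| + 1)).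
  by apply: itg1_continuous => y; exact: cvg_cst.
have C0 (y : R) : 0 <= `|B| + 1 by rewrite addr_ge0.
have if_ (y : R) : `]x - 1, x + 1[%classic y -> mu1.-integrable `[a, b] (EFin \o (fun t => f (y, t))).
  by move=> _; apply: itg1_continuous; exact: cs.
have df_ (y t : R) : `]x - 1, x + 1[%classic y -> `[a, b]%classic t -> derivable (fun y => f (y, t)) y 1.
  by move=> _ _; have [] := dfx y t.
have ub (y t : R) : `]x - 1, x + 1[%classic y -> `[a, b]%classic t ->
    `|partial1of2 (fun y t => f (y, t)) y t| <= `|B| + 1.
  rewrite /= !in_itv /= => /andP[y1 y2] tab; rewrite partial1of2E; have [_ ->] := dfx y t.
  apply: (HB (`|B| + 1)); first by rewrite (le_lt_trans (ler_norm _)) ?ltrDl.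
  by exists (y, t) => //; split; rewrite /= in_itv //= !ltW.
have mab : measurable (`[a, b]%classic : set (measurableTypeR R)) by exact: measurable_itv.
split.
  exact: (derivable_under_integral mab Ix if_ df_ C0 iC ub).
have := differentiation_under_integral mab Ix if_ df_ C0 iC ub.
rewrite derive1E => ->; apply: eq_Rintegral => t _.
by rewrite partial1of2E; have [_ ->] := dfx x t.
Qed.

Definition has_grad (p : field R) (F : 'I_2 -> field R) (z : plane R) : Prop :=
  forall j, is_derive z (basis R j) p (F j z).

(** Integration along a horizontal and then a vertical segment from the lower left corner of the
    square [ball z r]. That corner is on the boundary, hence the curl condition on a larger ball. *)
Lemma poincare_ball (F : 'I_2 -> field R) (g g' : field R) z (r r' : R) : r < r' ->
  (forall j, continuous (F j)) ->
  continuous g -> continuous g' ->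
  (forall w, is_derive w (basis R 0) (F 1) (g w)) ->
  (forall w, is_derive w (basis R 1) (F 0) (g' w)) ->
  (forall w, ball z r' w -> g w = g' w) ->
  exists p : field R, forall w, ball z r w -> has_grad p F w.
Proof.
move=> rr' cF cg cg' dg dg' gg'; case: z gg' => zx zy gg'.
pose x0 := zx - r; pose y0 := zy - r.
have sl0 (h : field R) y : continuous h -> continuous (fun t => h (t, y)).
  by move=> ch t; apply: continuous_slice0; exact: ch.
have sl1 (h : field R) x : continuous h -> continuous (fun t => h (x, t)).
  by move=> ch t; apply: continuous_slice1; exact: ch.
exists (fun w => \int[mu1]_(t in `[x0, w.1]) F 0 (t, y0) + \int[mu1]_(t in `[y0, w.2]) F 1 (w.1, t)).
move=> [x y] [/= bx by_] j.
have xx0 : x0 < x by move: bx; rewrite /ball /= ltr_norml /x0 => /andP[? ?]; lra.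
have yy0 : y0 < y by move: by_; rewrite /ball /= ltr_norml /y0 => /andP[? ?]; lra.
have [->|->] := ord2P j.
  apply/is_derive0P => /=.
  have d1 := is_derive_primitive (sl0 _ y0 (cF 0)) xx0.
  have d2 := is_derive_integral_param y0 y x (cF 1) cg dg.
  apply: (is_derive_eq (is_deriveD d1 d2)).
  have -> : \int[mu1]_(t in `[y0, y]) g (x, t) = \int[mu1]_(t in `[y0, y]) g' (x, t).
    apply: eq_Rintegral => t /set_mem /=; rewrite in_itv /= => /andP[t1 t2]; apply: gg'.
    move: bx by_; rewrite /ball /= !ltr_norml => /andP[? ?] /andP[? ?].
    by split; rewrite /ball /= ltr_norml; apply/andP; rewrite /y0 in t1; split; lra.
  rewrite (Rintegral_derive yy0 (sl1 _ x cg') (fun t => (is_derive1P (F 0) x t _).1 (dg' (x, t)))).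
  by rewrite addrC subrK.
apply/is_derive1P => /=.
have d2 := is_derive_primitive (sl1 _ x (cF 1)) yy0.
apply: (is_derive_eq (is_deriveD (is_derive_cst _ y (1 : R)) d2)).
by rewrite add0r.
Qed.


Lemma ball_corner (z a b : plane R) r : ball z r a -> ball z r b -> ball z r (b.1, a.2).
Proof. by case: z a b => [z1 z2] [a1 a2] [b1 b2] [/= h1 h2] [/= h3 h4]; split. Qed.

Lemma ball_itv (z1 z2 x y r : R) : ball ((z1, z2) : plane R) r (x, y) <->
  (z1 - r < x < z1 + r) /\ (z2 - r < y < z2 + r).
Proof.
split=> [[/=]|[]].
  by rewrite /ball /= !ltr_norml => /andP[? ?] /andP[? ?]; split; apply/andP; split; lra.
move=> /andP[? ?] /andP[? ?]; split; rewrite /ball /= ltr_norml; apply/andP; split; lra.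
Qed.

(** The two squares meet in a rectangle, in which [a] and [b] are joined by a horizontal and a
    vertical segment through the corner [(b.1, a.2)]. *)
Lemma primitive_unique (p q : field R) (F : 'I_2 -> field R) z z' r r' a b :
  (forall w, ball z r w -> has_grad p F w) -> (forall w, ball z' r' w -> has_grad q F w) ->
  ball z r a -> ball z' r' a -> ball z r b -> ball z' r' b ->
  p b - p a = q b - q a.
Proof.
move=> hp hq za za' zb zb'.
have zc := ball_corner za zb; have zc' := ball_corner za' zb'.
pose D w := p w - q w.
have dD w j : ball z r w -> ball z' r' w -> is_derive w (basis R j) D 0.
  by move=> h h'; apply: (is_derive_eq (is_deriveB (hp w h j) (hq w h' j))); rewrite subrr.
suff : D a = D b by rewrite /D; lra.
case: z z' a b {hp hq} za za' zb zb' zc zc' dD => [z1 z2] [z1' z2'] [a1 a2] [b1 b2].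
rewrite /= !ball_itv => -[A1 A2] [A1' A2'] [B1 B2] [B1' B2'] _ _ dD.
move: A1 A2 A1' A2' B1 B2 B1' B2' => /andP[? ?] /andP[? ?] /andP[? ?] /andP[? ?]
  /andP[? ?] /andP[? ?] /andP[? ?] /andP[? ?].
transitivity (D (b1, a2)).
  apply: (@derive0_itv_cst R (fun t => D (t, a2)) (Num.max (z1 - r) (z1' - r')) (Num.min (z1 + r) (z1' + r'))).
  - move=> t; rewrite gt_max lt_min => /andP[/andP[? ?] /andP[? ?]].
    by apply/is_derive0P; apply: dD; apply/ball_itv; split; apply/andP.
  - by rewrite gt_max lt_min; apply/andP; split; apply/andP.
  - by rewrite gt_max lt_min; apply/andP; split; apply/andP.
apply: (@derive0_itv_cst R (fun t => D (b1, t)) (Num.max (z2 - r) (z2' - r')) (Num.min (z2 + r) (z2' + r'))).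
- move=> t; rewrite gt_max lt_min => /andP[/andP[? ?] /andP[? ?]].
  by apply/is_derive1P; apply: dD; apply/ball_itv; split; apply/andP.
- by rewrite gt_max lt_min; apply/andP; split; apply/andP.
- by rewrite gt_max lt_min; apply/andP; split; apply/andP.
Qed.

(** [has_grad] asserts partial derivatives only. Their continuity at [z] bounds them nearby, and the
    mean value theorem along axis-parallel segments gives a Lipschitz estimate at [z]. *)
Lemma has_grad_continuous (p : field R) (F : 'I_2 -> field R) z r : 0 < r ->
  (forall w, ball z r w -> has_grad p F w) ->
  (forall j, {for z, continuous (F j)}) -> {for z, continuous p}.
Proof.
move=> r0 hp cF.
have [s [C [s0 C0 sr HC]]] : exists s C : R, [/\ 0 < s, 0 < C, s <= r &
    forall w j, ball z s w -> `|F j w| <= C].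
  have H j : \forall w \near z, `|F j w| <= `|F j z| + 1.
    have := cF j => /cvgrPdist_le/(_ 1 ltr01); apply: filterS => w h.
    have := ler_normB (F j z) (F j z - F j w); rewrite subKr => h2.
    by apply: le_trans h2 _; rewrite lerD2l.
  have /nbhs_ballP[s1 /= s10 H1] := H 0; have /nbhs_ballP[s2 /= s20 H2] := H 1.
  exists (Num.min r (Num.min s1 s2)), (`|F 0 z| + `|F 1 z| + 1); split.
  - by rewrite !lt_min r0 s10.
  - by rewrite ltr_wpDl// addr_ge0.
  - by rewrite ge_min lexx.
  - move=> w j bw; have [->|->] := ord2P j.
      have : `|F 0 w| <= `|F 0 z| + 1.
        by apply: H1; apply: le_ball bw; rewrite !ge_min lexx /= orbT.
      by have := normr_ge0 (F 1 z); lra.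
    have : `|F 1 w| <= `|F 1 z| + 1.
      by apply: H2; apply: le_ball bw; rewrite !ge_min lexx /= !orbT.
    by have := normr_ge0 (F 0 z); lra.
have mvt (h h' : R -> R) (u v : R) :
    (forall t, Num.min u v <= t <= Num.max u v -> is_derive t (1 : R) h (h' t)) ->
    (forall t, Num.min u v <= t <= Num.max u v -> `|h' t| <= C) ->
    `|h v - h u| <= C * `|v - u|.
  wlog uv : u v / u <= v.
    move=> W; have /orP[uv|vu] := le_total u v; first exact: W.
    by move=> d1 d2; rewrite distrC (distrC v); apply: W; rewrite // minC maxC.
  rewrite (min_l uv) (max_r uv) => d1 d2.
  have dd t : t \in `]u, v[ -> is_derive t (1 : R) h (h' t).
    by rewrite in_itv /= => /andP[? ?]; apply: d1; rewrite !ltW.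
  have cc : {within `[u, v], continuous h}.
    apply: derivable_within_continuous => t; rewrite in_itv /= => h0.
    by have [] := d1 t h0.
  have [t tuv ->] := MVT_segment uv dd cc.
  by rewrite normrM ler_wpM2r//; apply: d2; move: tuv; rewrite in_itv.
have lip w : ball z s w -> `|p w - p z| <= C * `|w.1 - z.1| + C * `|w.2 - z.2|.
  move=> bw; rewrite -(subrK (p (w.1, z.2)) (p w)) -addrA addrC.
  apply: le_trans (ler_normD _ _) _.
  have bz : ball z s z by exact: ballxx.
  case: z w {cF} hp HC bz bw => [z1 z2] [w1 w2] hp HC /ball_itv[/andP[? ?] /andP[? ?]]
    /ball_itv[/andP[? ?] /andP[? ?]] /=.
  have in0 t : Num.min z1 w1 <= t <= Num.max z1 w1 -> ball ((z1, z2) : plane R) s (t, z2).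
    rewrite ge_min le_max => /andP[/orP[]? /orP[]?]; apply/ball_itv; split; apply/andP; split; lra.
  have in1 t : Num.min z2 w2 <= t <= Num.max z2 w2 -> ball ((z1, z2) : plane R) s (w1, t).
    rewrite ge_min le_max => /andP[/orP[]? /orP[]?]; apply/ball_itv; split; apply/andP; split; lra.
  apply: lerD.
    apply: (mvt (fun t => p (t, z2)) (fun t => F 0 (t, z2))) => t /in0 h; last exact: HC.
    by apply/is_derive0P; apply: (hp _ _ 0); apply: le_ball h.
  apply: (mvt (fun t => p (w1, t)) (fun t => F 1 (w1, t))) => t /in1 h; last exact: HC.
  by apply/is_derive1P; apply: (hp _ _ 1); apply: le_ball h.
apply/cvgrPdist_le => e e0.
have d0 : 0 < Num.min s (e / (2 * C)) by rewrite lt_min s0 divr_gt0// mulr_gt0.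
have nb : \forall w \near z, ball z (Num.min s (e / (2 * C))) w by exact: nbhsx_ballx.
apply: filterS nb => w bw.
have bs : ball z s w by apply: le_ball bw; rewrite ge_min lexx.
rewrite distrC; apply: le_trans (lip w bs) _.
have [h1 h2] : `|w.1 - z.1| <= e / (2 * C) /\ `|w.2 - z.2| <= e / (2 * C).
  have : ball z (e / (2 * C)) w by apply: le_ball bw; rewrite ge_min lexx orbT.
  by case=> h1 h2; rewrite !(distrC w.1) !(distrC w.2); split; apply: ltW.
rewrite -mulrDr -ler_pdivlMl// mulrC; apply: le_trans (lerD h1 h2) _.
by rewrite le_eqVlt; apply/orP; left; apply/eqP; field; rewrite gt_eqF.
Qed.

Variable U : set (plane R).
Hypotheses (oU : open U) (scU : simply_connected U).

(* Local primitives differ by constants, so their increments form an additive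
   cocycle, to which the monodromy argument applies. *)
Lemma global_primitive (F : 'I_2 -> field R) :
  (forall z, U z -> exists2 r : R, 0 < r & exists p, forall w, ball z r w -> has_grad p F w) ->
  exists p : field R, forall z, U z -> has_grad p F z.
Proof.
move=> loc.
pose prim a b v := exists z r p, [/\ forall w, ball z r w -> has_grad p F w,
  ball z r a, ball z r b & v = p b - p a].
(* The value is well defined by [primitive_unique]; 0 is the default for points with no common
   ball. *)
pose delta a b : R := xget 0 [set v | prim a b v].
have deltaE z r p a b : (forall w, ball z r w -> has_grad p F w) -> ball z r a -> ball z r b ->
    delta a b = p b - p a.
  move=> hp za zb; rewrite /delta; case: xgetP => [v _ [z' [r' [q [hq za' zb' ->]]]]|/(_ (p b - p a))].
    exact: (primitive_unique hq hp).
  by case; exists z, r, p.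
have [P HP] : exists P : field R, forall z, U z -> exists2 r : R, 0 < r & ball z r `<=` U /\
    forall a b, ball z r a -> ball z r b -> P b - P a = delta a b.
  apply: global_potential => // z Uz; have [r r0 [p hp]] := loc z Uz.
  exists r => // a b c za zb zc; rewrite !(deltaE z r p)//; ring.
exists P => z Uz j; have [r r0 [_ HPz]] := HP z Uz; have [r' r0' [p hp]] := loc z Uz.
have zz : ball z r z by exact: ballxx.
have zz' : ball z r' z by exact: ballxx.
have := hp z zz' j => dp.
have dpc : is_derive z (basis R j) (fun w => p w + (P z - p z)) (F j z).
  have := is_deriveD dp (is_derive_cst (P z - p z) z (basis R j)).
  by rewrite addr0.
apply: near_eq_is_derive dpc.
have : \forall w \near z, ball z (Num.min r r') w.
  by apply: nbhsx_ballx; rewrite lt_min r0.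
apply: filterS => w bw.
have bwr : ball z r w by apply: le_ball bw; rewrite ge_min lexx.
have bwr' : ball z r' w by apply: le_ball bw; rewrite ge_min lexx orbT.
have := HPz _ _ zz bwr; rewrite (deltaE z r' p)//; lra.
Qed.

End Poincare.

Lemma ae_imply d (T : measurableType d) (R : realType) (mu : {measure set T -> \bar R})
  (P Q : T -> Prop) : (forall x, P x -> Q x) ->
  {ae mu, forall x, P x} -> {ae mu, forall x, Q x}.
Proof. by move=> PQ; apply: filterS. Qed.

(** * Smooth representatives of weakly curl free and divergence free fields *)

Section Representative.
Variable R : realType.
Notation mu := (leb2 R).

Lemma ball_ball (z w : plane R) (r s : R) : ball z r w -> ball w s `<=` ball z (r + s).
Proof. by move=> zw v wv; exact: ball_triangle zw wv. Qed.

(** A rational radius below [r / 5] leaves room both for moving the centre by it and for quadrupling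
    it. *)
Lemma rational_ball (z : plane R) (r : R) : 0 < r ->
  exists q : rat * rat * rat, let c := (ratr q.1.1, ratr q.1.2) : plane R in
    [/\ 0 < (ratr q.2 : R), ball c (ratr q.2) z & ball c (4 * ratr q.2) `<=` ball z r].
Proof.
move=> r0; have [s] := @rat_in_itvoo R 0 (r / 5) ltac:(by rewrite divr_gt0).
rewrite in_itv /= => /andP[s0 sr].
have H (a : R) : exists q : rat, `|ratr q - a| < ratr s.
  have [q] := @rat_in_itvoo R (a - ratr s) (a + ratr s) ltac:(by rewrite ltrD2l gtrN).
  by rewrite in_itv /= -ltr_distl => ?; exists q.
have [qx hx] := H z.1; have [qy hy] := H z.2.
have cz : ball ((ratr qx, ratr qy) : plane R) (ratr s) z by split.
exists (qx, qy, s); split=> //= w cw.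
apply: (@le_ball _ _ z (ratr s + 4 * ratr s)); first by lra.
by apply: ball_triangle cw; exact: ball_sym.
Qed.

(** Rational balls reduce the exceptional set to a countable union of null sets. The factor 4 leaves
    room for mollification with radius [r] about points at distance up to [3 * r]. *)
Lemma ae_of_rational_balls (U : set (plane R)) (P : plane R -> Prop) : open U ->
  (forall z r, 0 < r -> ball z (4 * r) `<=` U -> {ae mu, forall w, ball z r w -> P w}) ->
  {ae mu, forall w, U w -> P w}.
Proof.
move=> oU H.
pose Q (q : rat * rat * rat) w := let c := (ratr q.1.1, ratr q.1.2) : plane R in
  0 < (ratr q.2 : R) -> ball c (4 * ratr q.2) `<=` U -> ball c (ratr q.2) w -> P w.
have HQ : {ae mu, forall w, forall n, oapp (fun q => Q q w) True (unpickle n)}.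
  apply/ae_foralln => n; case: (unpickle n) => [q|] /=; last exact: aeW.
  rewrite /Q; have [q0|] := boolP (0 < (ratr q.2 : R)); last by move=> h; apply: aeW.
  have [qU|] := pselect (ball ((ratr q.1.1, ratr q.1.2) : plane R) (4 * ratr q.2) `<=` U).
    by move: (H _ _ q0 qU); apply: ae_imply => w h _ _; exact: h.
  by move=> h; apply: aeW.
move: HQ; apply: ae_imply => w Hw Uw.
have /nbhs_ballP[r /= r0 rU] := open_nbhs_nbhs (conj oU Uw).
have [q [q0 qw qr]] := rational_ball w r0.
have := Hw (pickle q); rewrite pickleK /= /Q; apply=> //.
exact: subset_trans rU.
Qed.

Section SmoothRepresentative.
Variables (U : set (plane R)) (M : R) (N : 'I_2 -> field R).
Hypotheses (oU : open U) (UM : U `<=` cbox M).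
Hypothesis iN : forall j, itg (N j).
Hypothesis N0 : forall j w, ~ U w -> N j w = 0.
Hypothesis curl : forall psi, test_function U psi ->
  \int[mu]_w (N 0 w * partial 1 psi w) = \int[mu]_w (N 1 w * partial 0 psi w).
Hypothesis div : forall psi, smooth_class psi -> test_function U psi ->
  \int[mu]_w (N 0 w * partial 0 psi w) + \int[mu]_w (N 1 w * partial 1 psi w) = 0.

Let m : R := mass 1 0.
Let m0 : 0 < m. Proof. exact: mass_gt0. Qed.

Let NM j w : ~ cbox M w -> N j w = 0.
Proof. by move=> nw; apply: N0 => Uw; apply: nw; exact: UM. Qed.

Lemma moll_stable j a b z r : 0 < r -> r ^- 2 < a -> r ^- 2 < b -> ball z r `<=` U ->
  moll (N j) a z = moll (N j) b z.
Proof.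
move=> r0 ra rb bU.
have [e0 e1] := weyl (iN 0) (iN 1) (@NM 0) (@NM 1) curl div r0 ra rb bU.
by have [->|->] := ord2P j.
Qed.

(** Mollification at any admissible scale gives the same value, so the scale may depend on the
    point; locally it is traded for a fixed one, at which the mollified field is differentiable and
    curl free. *)
Lemma smooth_representative : exists F : 'I_2 -> field R,
  [/\ forall j, {in U, continuous (F j)},
      forall z, U z -> exists2 r : R, 0 < r & exists p, forall w, ball z r w -> has_grad p F w &
      forall j, {ae mu, forall w, U w -> N j w = F j w}].
Proof.
have /choice[s Hs] : forall z, exists s : R, U z -> 0 < s /\ ball z s `<=` U.
  move=> z; have [Uz|] := pselect (U z); last by exists 0.
  by have /nbhs_ballP[s /= s0 sU] := open_nbhs_nbhs (conj oU Uz); exists s.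
pose A z := (s z) ^- 2 + 1.
pose F j z := m^-1 * moll (N j) (A z) z.
pose Fa a j z := m^-1 * moll (N j) a z.
have FE z r a j w : 0 < r -> r ^- 2 < a -> ball z (4 * r) `<=` U -> ball z (3 * r) w -> F j w = Fa a j w.
  move=> r0 ra zU zw; rewrite /F /Fa; congr (_ * _).
  have wU : ball w r `<=` U.
    by apply: subset_trans zU; have := ball_ball zw (s := r); rewrite (_ : 3 * r + r = 4 * r)//; ring.
  have Uw : U w by apply: wU; exact: ballxx.
  have [sw swU] := Hs w Uw.
  (* The two scales are admissible for different radii; both are compared with their maximum. *)
  pose b := Num.max a (A w).
  have rb : r ^- 2 < b by rewrite lt_max ra.
  have sA : (s w) ^- 2 < A w by rewrite ltrDl.
  have sb : (s w) ^- 2 < b by rewrite lt_max sA orbT.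
  rewrite (moll_stable j sw sA sb swU); exact: (moll_stable j r0 rb ra wU).
have cFa a j : continuous (Fa a j).
  move=> w; apply: cvgM; first exact: cvg_cst.
  exact: (continuous_moll (iN j) (@NM j)).
have dFa a i j z : is_derive z (basis R i) (Fa a j) (m^-1 * \int[mu]_w (N j w * dker i a z w)).
  exact: (is_deriveZ m^-1 (is_derive_moll (iN j) (@NM j) i a z)).
have cdFa a i j : continuous (fun z => m^-1 * \int[mu]_w (N j w * dker i a z w)).
  move=> w; apply: cvgM; first exact: cvg_cst.
  exact: (continuous_moll_deriv (iN j) (@NM j)).
have bU4 z : U z -> exists2 r : R, 0 < r & ball z (4 * r) `<=` U.
  move=> Uz; have /nbhs_ballP[r /= r0 rU] := open_nbhs_nbhs (conj oU Uz).
  by exists (r / 4); [rewrite divr_gt0|rewrite mulrC divfK].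
exists F; split.
- move=> j z /set_mem Uz; have [r r0 zU] := bU4 z Uz.
  pose a := r ^- 2 + 1; have ra : r ^- 2 < a by rewrite ltrDl.
  have zz : ball z (3 * r) z by apply: ballxx; rewrite mulr_gt0.
  rewrite /continuous_at (FE z r a j z r0 ra zU zz).
  apply: cvg_trans (cFa a j z); apply: near_eq_cvg.
  have : \forall w \near z, ball z (3 * r) w by apply: nbhsx_ballx; rewrite mulr_gt0.
  by apply: filterS => w zw; rewrite (FE z r a j w r0 ra zU zw).
- move=> z Uz; have [r r0 zU] := bU4 z Uz.
  pose a := r ^- 2 + 1; have ra : r ^- 2 < a by rewrite ltrDl.
  exists (2 * r); first by rewrite mulr_gt0.
  have r23 : 2 * r < 3 * r by rewrite ltr_pM2r// ltr_nat.
  have curlE w : ball z (3 * r) w ->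
      m^-1 * \int[mu]_v (N 1 v * dker 0 a w v) = m^-1 * \int[mu]_v (N 0 v * dker 1 a w v).
    move=> zw; congr (_ * _).
    apply: (moll_curl (iN 0) (iN 1) (@NM 0) (@NM 1) curl r0 ra).
    by apply: subset_trans zU; have := ball_ball zw (s := r); rewrite (_ : 3 * r + r = 4 * r)//; ring.
  have [p hp] := poincare_ball r23 (cFa a) (cdFa a 0 1) (cdFa a 1 0) (dFa a 0 1) (dFa a 1 0) curlE.
  exists p => w zw j; rewrite (FE z r a j w r0 ra zU); first exact: hp.
  by apply: le_ball zw; exact: ltW.
- move=> j; apply: ae_of_rational_balls => // z r r0 zU.
  pose a := r ^- 2 + 1; have ra : r ^- 2 < a by rewrite ltrDl.
  have a0 : 0 < a by rewrite ltr_wpDl// invr_ge0 sqr_ge0.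
  have r3 : r <= 3 * r by rewrite ler_peMl ?(ltW r0)// ler1n.
  pose B : set (plane R) := ball z r.
  have mB : measurable (B : set (mplane R)) by apply: open_measurable_plane; exact: ball_open.
  pose L := `|z.1| + `|z.2| + r.
  have BL : B `<=` cbox L by exact: ball_sub_cbox.
  have cmoll : continuous (moll (N j) a) by exact: (continuous_moll (iN j) (@NM j)).
  have mN : measurable_fun setT (N j : mplane R -> R).
    by apply/measurable_EFinP; case/integrableP : (iN j).
  have i1 : itg (fun w => N j w * \1_B w) by exact: itg_mul_indic.
  have [C HC] : exists C : R, forall w, cbox L w -> `|moll (N j) a w| <= C.
    have /compact_bounded [C [_ HC]] : compact (moll (N j) a @` cbox L).
      by apply: continuous_compact; [exact: continuous_subspaceT|exact: compact_cbox].
    exists (`|C| + 1) => w Lw; apply: (HC (`|C| + 1)); last by exists w.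
    by rewrite (le_lt_trans (ler_norm _)) ?ltrDl.
  have i2 : itg (fun w => moll (N j) a w * \1_B w).
    apply: (@itg_bounded_cbox _ _ L `|C|).
    - apply: measurable_funM; first exact: continuous_measurable_plane.
      exact: measurable_indic.
    - move=> w; rewrite normrM indicE; have [wB|wB] := pselect (B w).
        rewrite mem_set// normr1 mulr1; apply: le_trans (ler_norm C).
        by apply: HC; exact: BL.
      by rewrite memNset// normr0 mulr0.
    - by move=> w nw; rewrite indicE memNset ?mulr0// => /BL.
  (* The difference of [m N] and its mollification, cut to the ball; it is shown to annihilate every
     continuous function vanishing outside the ball. *)
  pose D w := m * (N j w * \1_B w) - moll (N j) a w * \1_B w.
  have iD : itg D by apply: itgB => //; exact: itgZ.
  suff : {ae mu, forall w, D w = 0}.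
    apply: ae_imply => w Dw zw; rewrite (FE z r a j w r0 ra zU); last exact: (le_ball r3).
    move: Dw; rewrite /D indicE mem_set// !mulr1 /Fa => /eqP; rewrite subr_eq0 => /eqP <-.
    by rewrite mulKf// gt_eqF.
  apply: (ae_eq0_of_continuous iD (z := z) (r := r)) => [w nw|psi cpsi psi0].
    by rewrite /D indicE memNset// !mulr0 subrr.
  have psiL w : ~ cbox L w -> psi w = 0 by move=> nw; apply: psi0 => /BL.
  have ipsi : itg psi by exact: itg_continuous_compact_support psiL.
  have ind w : \1_B w * psi w = psi w.
    rewrite indicE; have [wB|wB] := pselect (B w); first by rewrite mem_set// mul1r.
    by rewrite psi0// mulr0.
  have i3 : itg (fun w => N j w * psi w) by exact: (itg_mul_continuous (iN j) (@NM j)).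
  have i4 : itg (fun w => psi w * moll (N j) a w).
    by apply: (itg_mul_continuous ipsi psiL).
  have -> : \int[mu]_w (D w * psi w) =
      \int[mu]_w (m * (N j w * psi w)) - \int[mu]_w (psi w * moll (N j) a w).
    rewrite -RintegralB//; last exact: itgZ.
    by apply: eq_Rintegral => w _; rewrite /D mulrBl -!mulrA ind [psi w * _]mulrC.
  apply/eqP; rewrite subr_eq0; apply/eqP.
  have lim := moll_weak_limit cpsi psiL (iN j).
  (* For large [n] the adjoint moves the mollification to [N], where the scale [n.+1] may be
     replaced by [a]: the sequence with limit [m] times the integral of [N psi] is eventually
     constant. *)
  have eqm n : (Num.truncn a <= n)%N ->
      \int[mu]_v (N j v * moll psi n.+1%:R v) = \int[mu]_w (psi w * moll (N j) a w).
    move=> an; apply: (etrans (esym (moll_adjoint (ltr0Sn R n) ipsi (iN j)))).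
    apply: eq_Rintegral => w _.
    have [wB|wB] := pselect (B w); last by rewrite psi0// !mul0r.
    congr (_ * _); apply: (moll_stable j r0) => //.
      by rewrite (lt_trans ra)// (lt_le_trans (truncnS_gt _))// ler_nat ltnS.
    apply: subset_trans zU; have := ball_ball wB (s := r).
    by move=> /subset_trans; apply; apply: le_ball; lra.
  have -> : \int[mu]_w (m * (N j w * psi w)) = \int[mu]_v (N j v * (mass 1 0 * psi v)).
    by apply: eq_Rintegral => v _; rewrite mulrCA.
  apply: (cvg_unique (@Rhausdorff R) lim); apply: cvg_near_cst.
  by exists (Num.truncn a).
Qed.

End SmoothRepresentative.

End Representative.

Section AlmostEverywhere.
Context d (T : measurableType d) (R : realType).
Variable mu : {measure set T -> \bar R}.

Lemma sqint_ae (f g : T -> R) : sqint mu f -> measurable_fun setT g ->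
  {ae mu, forall x, f x = g x} -> sqint mu g.
Proof.
move=> [mf if_] mg fg; split=> //; apply/integrableP; split.
  by apply/measurable_EFinP; exact: measurable_funX.
case/integrableP : if_ => mf2; apply: le_lt_trans; rewrite le_eqVlt; apply/orP; left; apply/eqP.
apply: ge0_ae_eq_integral => //.
- by apply: measurableT_comp => //; apply/measurable_EFinP; exact: measurable_funX.
- exact: measurableT_comp.
- by apply: ae_imply fg => x /= -> _.
Qed.

Lemma ip_ae (f g h : T -> R) : measurable_fun setT f -> measurable_fun setT g ->
  measurable_fun setT h -> {ae mu, forall x, f x = g x} -> ip mu h f = ip mu h g.
Proof.
move=> mf mg mh fg; rewrite /ip /Rintegral; congr fine.
apply: ae_eq_integral => //.
- by apply/measurable_EFinP; exact: measurable_funM.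
- by apply/measurable_EFinP; exact: measurable_funM.
- by apply: ae_imply fg => x /= -> _.
Qed.

End AlmostEverywhere.

(** * Stream functions *)

Section GradientOrthogonality.
Variable R : realType.
Notation mu := (leb2 R).

Lemma sqint_itg (f : field R) (M : R) : sqint mu f -> (forall w, ~ cbox M w -> f w = 0) -> itg f.
Proof.
move=> hf f0; have h1 : sqint mu (\1_(cbox M) : field R).
  split; first by apply: measurable_indic; exact: measurable_cbox.
  apply: (@itg_bounded_cbox _ _ M 1).
  - by apply: measurable_funX; apply: measurable_indic; exact: measurable_cbox.
  - by move=> x; rewrite indicE; case: (_ \in _); rewrite ?expr1n ?expr0n /= ?normr1 ?normr0.
  - by move=> x nx; rewrite indicE memNset// expr0n.
have := sqintM hf h1; congr (_.-integrable _ (EFin \o _)).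
apply/funext => w; rewrite indicE; have [wM|wM] := pselect (cbox M w).
  by rewrite mem_set// mulr1.
by rewrite f0// mul0r.
Qed.

Lemma measurable_zero_ext (U : set (plane R)) (f : field R) : open U -> {in U, continuous f} ->
  measurable_fun setT (zero_ext U f : mplane R -> R).
Proof.
move=> oU cf.
apply/(measurable_restrictT (f : mplane R -> R) (open_measurable_plane oU)).
exact: open_continuous_measurable_plane.
Qed.

Variables (U : set (plane R)) (M : R) (G : 'I_2 -> field R).
Hypotheses (oU : open U) (UM : U `<=` cbox M) (scU : simply_connected U).
Hypothesis sG : forall j, sqint mu (G j).
Hypothesis G0 : forall j w, ~ U w -> G j w = 0.
Hypothesis HG : forall phi dphi, H1 U phi dphi ->
  \int[mu]_(w in U) (G 0 w * dphi 0 w) + \int[mu]_(w in U) (G 1 w * dphi 1 w) = 0.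

Lemma RintegralG j (f : field R) :
  \int[mu]_(w in U) (G j w * f w) = ip mu (G j) (zero_ext U f).
Proof.
rewrite Rintegral_mkcond; apply: eq_Rintegral => w _; rewrite /patch /zero_ext /patch.
by case: ifP => // _; rewrite mulr0.
Qed.

(* [P] need not be square integrable, so [G] is tested against the bounded functions
   [k * sin (P / k)], whose gradients tend to [F]. *)
Lemma orthogonal_gradient (P : field R) (F : 'I_2 -> field R) :
  (forall z, U z -> has_grad P F z) -> (forall j, {in U, continuous (F j)}) ->
  (forall j, sqint mu (zero_ext U (F j))) ->
  ip mu (G 0) (zero_ext U (F 0)) + ip mu (G 1) (zero_ext U (F 1)) = 0.
Proof.
move=> hP cF sF.
have cP : {in U, continuous P}.
  move=> z /set_mem Uz; have /nbhs_ballP[r /= r0 rU] := open_nbhs_nbhs (conj oU Uz).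
  by apply: (has_grad_continuous r0) => [w /rU|j]; [exact: hP|apply: cF; exact/mem_set].
pose k n : R := n.+1%:R; have k0 n : 0 < k n by rewrite /k.
(* Bounded by [k n], hence square integrable on the bounded set [U], with a gradient dominated by
   [F] since the cosine is at most 1. *)
pose phi n z := k n * sin (P z / k n).
pose df n j z := cos (P z / k n) * F j z.
have cPk n : {in U, continuous (fun z => P z / k n)}.
  by move=> z Uz; apply: cvgM; [exact: cP|exact: cvg_cst].
have dphi n j z : U z -> is_derive z (basis R j) (phi n) (df n j z).
  move=> Uz; have dP := hP z Uz j.
  have dPk : is_derive z (basis R j) (fun z => P z / k n) (F j z / k n).
    have := is_deriveM dP (is_derive_cst (k n)^-1 z (basis R j)).
    by rewrite scaler0 add0r [_^-1 *: _]mulrC.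
  have ds := is_derive_basis_comp (is_derive_sin (P z / k n)) dPk.
  apply: (is_derive_eq (is_deriveZ (k n) ds)); rewrite /df [_ *: _]mulrCA; congr (_ * _).
  by rewrite mulrC divfK// gt_eqF.
have pphi n j z : U z -> partial j (phi n) z = df n j z.
  by move=> Uz; have [_ e] := dphi n j z Uz; exact: e.
have cphi n : {in U, continuous (phi n)}.
  move=> z Uz; apply: cvgM; first exact: cvg_cst.
  apply: (@continuous_comp _ _ _ (fun z => P z / k n) sin); first exact: cPk.
  exact: continuous_sin.
have cdf n j : {in U, continuous (df n j)}.
  move=> z Uz; apply: cvgM; last exact: cF.
  apply: (@continuous_comp _ _ _ (fun z => P z / k n) cos); first exact: cPk.
  exact: continuous_cos.
have cpphi n j : {in U, continuous (partial j (phi n))}.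
  move=> z Uz; rewrite /continuous_at (pphi n j z (set_mem Uz)).
  apply: cvg_trans (cdf n j z Uz); apply: near_eq_cvg.
  apply: filterS (open_nbhs_nbhs (conj oU (set_mem Uz))) => w Uw.
  by rewrite pphi.
have zpphi n j : zero_ext U (partial j (phi n)) = zero_ext U (df n j).
  apply/funext => z; have [Uz|Uz] := pselect (U z); last by rewrite !zero_ext_out.
  by rewrite !zero_ext_in// pphi.
have mdf n j : measurable_fun setT (zero_ext U (df n j) : mplane R -> R).
  exact: measurable_zero_ext.
have dfF n j z : `|zero_ext U (df n j) z| <= `|zero_ext U (F j) z|.
  have [Uz|Uz] := pselect (U z); last by rewrite !zero_ext_out.
  by rewrite !zero_ext_in// /df normrM ler_piMl// ler_norml cos_geN1 cos_le1.
have sdf n j : sqint mu (zero_ext U (df n j)).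
  split=> //; apply: (itg_le _ (sF j).2); first exact: measurable_funX.
  move=> z; rewrite normrX -(real_normK (num_real (zero_ext U (F j) z))).
  by rewrite lerXn2r ?nnegrE.
have H n : H1 U (phi n) (fun j => partial j (phi n)).
  apply: H1_C1 => // [j z Uz||j].
  - by have [] := dphi n j z Uz.
  - apply/L2P; split; first exact: measurable_zero_ext.
    apply: (@itg_bounded_cbox _ _ M (k n ^+ 2)).
    + by apply: measurable_funX; exact: measurable_zero_ext.
    + move=> z; rewrite normrX lerXn2r ?nnegrE ?(ltW (k0 n))//.
      have [Uz|Uz] := pselect (U z); last by rewrite zero_ext_out// normr0 ltW.
      rewrite zero_ext_in// /phi normrM gtr0_norm// ler_piMr ?(ltW (k0 n))//.
      by rewrite ler_norml sin_geN1 sin_le1.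
    + by move=> z nz; rewrite zero_ext_out ?expr0n// => /UM.
  - by apply/L2P; rewrite zpphi.
have E n : ip mu (G 0) (zero_ext U (df n 0)) + ip mu (G 1) (zero_ext U (df n 1)) = 0.
  by have := HG (H n); rewrite !RintegralG !zpphi.
have lim j : ip mu (G j) (zero_ext U (df n j)) @[n --> \oo] --> ip mu (G j) (zero_ext U (F j)).
  have mG : measurable_fun setT (G j : mplane R -> R) by case: (sG j).
  have mF : measurable_fun setT (zero_ext U (F j) : mplane R -> R) by case: (sF j).
  have [] := @dominated_convergence _ (mplane R) R mu setT measurableT
    (fun n v => (G j v * zero_ext U (df n j) v)%:E) (fun v => (G j v * zero_ext U (F j) v)%:E)
    (fun v => `|G j v * zero_ext U (F j) v|%:E).
  - by move=> n; apply/measurable_EFinP; exact: measurable_funM.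
  - by apply/measurable_EFinP; exact: measurable_funM.
  - apply: aeW => z _; apply: cvg_EFin; first exact: nearW.
    apply: (@cvgM _ _ _ _ (fun=> G j z) (fun n => zero_ext U (df n j) z)); first exact: cvg_cst.
    have [Uz|Uz] := pselect (U z); last first.
      rewrite zero_ext_out//; apply: cvg_near_cst; apply: nearW => n; exact: zero_ext_out.
    rewrite zero_ext_in// -[F j z]mul1r -cos0.
    under eq_fun do rewrite zero_ext_in//.
    apply: (@cvgM _ _ _ _ (fun n => cos (P z / k n)) (fun=> F j z)); last exact: cvg_cst.
    have Pk0 : P z / k n @[n --> \oo] --> (0 : R).
      rewrite -(mulr0 (P z)); apply: (@cvgM _ _ _ _ (fun=> P z) (fun n => (k n)^-1)).
        exact: cvg_cst.
      exact: cvg_harmonic.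
    exact: (cvg_comp _ _ Pk0 (@continuous_cos R 0)).
  - exact: (integrable_norm (sqintM (sG j) (sF j))).
  - by apply: aeW => z n _; rewrite lee_fin !normrM ler_wpM2l.
  move=> il _ H'.
  have {}H' : (\int[mu]_v (G j v * zero_ext U (df n j) v)%:E)%E @[n --> \oo] -->
      (\int[mu]_v (G j v * zero_ext U (F j) v))%:E.
    by rewrite /Rintegral fineK; [exact: H'|exact: integrable_fin_num].
  by have /fine_cvgP [_] := H'.
pose S n := ip mu (G 0) (zero_ext U (df n 0)) + ip mu (G 1) (zero_ext U (df n 1)).
have L : S n @[n --> \oo] -->
    (ip mu (G 0) (zero_ext U (F 0)) + ip mu (G 1) (zero_ext U (F 1))).
  by apply: cvgD; exact: lim.
have L0 : S n @[n --> \oo] --> (0 : R) by apply: cvg_near_cst; apply: nearW => n; exact: E.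
exact: (cvg_unique (@Rhausdorff R) L L0).
Qed.

End GradientOrthogonality.

Section StreamFunction.
Variable R : realType.
Notation mu := (leb2 R).
Notation nq f := (ip mu f f).

Lemma ip_partial_swap (V : set (plane R)) (f psi : field R) j : smooth f -> test_function V psi ->
  ip mu f (partial j psi) = - ip mu (partial j f) psi.
Proof.
move=> sf tpsi.
have tT : test_function setT psi by apply: test_mono tpsi.
have := @integration_by_parts_test R setT f psi j openT.
rewrite /ip => -> // z _; first by have [] := smooth_is_derive j z sf.
  exact: smooth_continuous.
exact/smooth_continuous/smooth_partial.
Qed.

(** Integration by parts against the first coordinate [x] turns the integral of [psi^2] into -2
    times that of [x psi (partial 0 psi)]. On the support [|x| <= M], and Cauchy-Schwarz yields the
    constant [(2 M)^2]. *)
Lemma poincare_inequality (U : set (plane R)) (M : R) (psi : field R) : 0 < M ->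
  U `<=` cbox M -> test_function U psi ->
  nq psi <= 4 * M ^+ 2 * nq (partial 0 psi).
Proof.
move=> M0 UM tpsi; have [spsi _ _] := tpsi.
have sp := test_sqint tpsi; have sdp := test_sqint (test_partial 0 tpsi).
have tT : test_function setT psi by apply: test_mono tpsi.
pose f : field R := fun z => z.1 * psi z.
have df z : is_derive z (basis R 0) f (z.1 * partial 0 psi z + psi z).
  have d1 : is_derive z (basis R 0) (fst : field R) 1.
    by have := is_derive_crd 0 0 z; rewrite eqxx.
  have := is_deriveM d1 (smooth_is_derive 0 z spsi).
  by rewrite [psi z *: 1]mulr1.
have pf : partial 0 f = fun z => z.1 * partial 0 psi z + psi z.
  by apply/funext => z; have [_ e] := df z; exact: e.
have cpsi := smooth_continuous spsi; have cdpsi := smooth_continuous (smooth_partial 0 spsi).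
have cf : continuous f by move=> z; apply: cvgM; [exact: cvg_fst|exact: cpsi].
have f0 z : ~ cbox M z -> f z = 0.
  by move=> nz; rewrite /f (test_supp tpsi) ?mulr0// => /UM.
have psi0 z : ~ cbox M z -> psi z = 0 by move=> nz; apply: (test_supp tpsi) => /UM.
have sf : sqint mu f by exact: sqint_continuous_compact_support f0.
have derf z : derivable f z (basis R 0) by have [] := df z.
have ibp := @integration_by_parts_test R setT f psi 0 openT
  (fun z _ => derf z) (fun z _ => cf z).
have cpf : {in setT, continuous (partial 0 f)}.
  move=> z _; rewrite pf; apply: cvgD; last exact: cpsi.
  by apply: cvgM; [exact: cvg_fst|exact: cdpsi].
have {}ibp := ibp cpf tT.
have E : nq psi = - 2 * ip mu f (partial 0 psi).
  have : ip mu f (partial 0 psi) = - (ip mu f (partial 0 psi) + nq psi).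
    rewrite {1}/ip ibp pf; congr (- _).
    rewrite /ip -RintegralD//; [|exact: sqintM..].
    by apply: eq_Rintegral => z _; rewrite /f; ring.
  by move=> h; lra.
have ff : nq f <= M ^+ 2 * nq psi.
  rewrite /ip -RintegralZl//; last exact: sqintM.
  apply: le_Rintegral => //; [exact: sqintM|by apply: itgZ; exact: sqintM|].
  move=> z _; have [zM|/psi0 pz] := pselect (cbox M z); last by rewrite /f pz !mulr0.
  have -> : f z * f z = z.1 ^+ 2 * (psi z * psi z) by rewrite /f; ring.
  rewrite ler_wpM2r -?expr2 ?sqr_ge0// -(real_normK (num_real z.1)) lerXn2r ?nnegrE ?(ltW M0)//.
  by case: zM; rewrite /= in_itv /= -ler_norml.
have CS := CauchySchwarz sf sdp.
have p0 := ip_ge0 mu psi; have d0 := ip_ge0 mu (partial 0 psi).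
have [->|pn] := eqVneq (nq psi) 0; first by rewrite mulr_ge0// mulr_ge0// sqr_ge0.
have pp : 0 < nq psi by rewrite lt_neqAle eq_sym pn.
rewrite -(ler_pM2l pp).
have -> : nq psi * nq psi = 4 * ip mu f (partial 0 psi) ^+ 2 by rewrite {1 2}E; ring.
have : ip mu f (partial 0 psi) ^+ 2 <= M ^+ 2 * nq psi * nq (partial 0 psi).
  by apply: le_trans CS _; rewrite ler_wpM2r.
by move=> h; lra.
Qed.

(** The law is put in midpoint form because the midpoint of two competitors is again a
    competitor. *)
Lemma parallelogram (f g : field R) : sqint mu f -> sqint mu g ->
  nq (fun x => f x - g x) = 2 * nq f + 2 * nq g - 4 * nq (fun x => 2^-1 * (f x + g x)).
Proof.
move=> hf hg; have hs := sqintD hf hg.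
have hd := sqintB hf hg.
have e1 : nq (fun x => f x + g x) = nq f + 2 * ip mu f g + nq g.
  by rewrite (ipDl hf hg hs) (ipDr hf hg hf) (ipDr hf hg hg) (ipC mu g f); ring.
have e2 : nq (fun x => f x - g x) = nq f - 2 * ip mu f g + nq g.
  by rewrite (ipBl hf hg hd) (ipBr hf hg hf) (ipBr hf hg hg) (ipC mu g f); ring.
rewrite e2 (ipZl 2^-1 hs (sqintZ _ hs)) (ipZr 2^-1 hs hs) e1.
by field.
Qed.

Lemma sqint_zero_ext (A : set (plane R)) (f : field R) : measurable (A : set (mplane R)) ->
  sqint mu f -> sqint mu (zero_ext A f).
Proof.
move=> mA [mf if_]; split.
  apply/(measurable_restrictT (f : mplane R -> R) mA).
  exact: measurable_funTS.
apply: (itg_le _ if_) => [|x].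
  apply: measurable_funX.
  apply/(measurable_restrictT (f : mplane R -> R) mA).
  exact: measurable_funTS.
rewrite ger0_norm ?sqr_ge0// /zero_ext /patch; case: ifP => // _.
by rewrite expr0n sqr_ge0.
Qed.

Variables (U : set (plane R)) (M : R) (G : 'I_2 -> field R).
Hypotheses (oU : open U) (M0 : 0 < M) (UM : U `<=` cbox M) (scU : simply_connected U).
Hypothesis sG : forall j, sqint mu (G j).
Hypothesis G0 : forall j w, ~ U w -> G j w = 0.
Hypothesis HG : forall phi dphi, H1 U phi dphi ->
  \int[mu]_(w in U) (G 0 w * dphi 0 w) + \int[mu]_(w in U) (G 1 w * dphi 1 w) = 0.

(** The H^1 condition on [U] applied to restrictions of test functions. With [V] the plane, it makes
    [G], extended by zero, divergence free across the boundary of [U]. *)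
Lemma orthogonal_test (V : set (plane R)) (f : field R) : test_function V f ->
  ip mu (G 0) (partial 0 f) + ip mu (G 1) (partial 1 f) = 0.
Proof.
move=> tf; have h := HG (test_H1 oU tf).
have z j : \int[mu]_(w in U) (G j w * partial j f w) = ip mu (G j) (partial j f).
  by apply: etrans (Rintegral_zero_ext U _ _) _; rewrite (zero_ext_id (@G0 j)).
exact: etrans (esym (congr2 +%R (z 0) (z 1))) h.
Qed.

(** Cutting [g] to [U] only removes contributions from where [f] vanishes. *)
Lemma nq_zero_ext (f g : field R) : sqint mu f -> sqint mu g -> (forall w, ~ U w -> f w = 0) ->
  nq (fun x => f x - zero_ext U g x) <= nq (fun x => f x - g x).
Proof.
move=> hf hg f0; have hz := sqint_zero_ext (open_measurable_plane oU) hg.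
have h1 := sqintB hf hz; have h2 := sqintB hf hg.
apply: le_Rintegral => //; [exact: sqintM|exact: sqintM|] => w _.
have [Uw|Uw] := pselect (U w); first by rewrite zero_ext_in.
by rewrite zero_ext_out// f0// subrr mul0r -expr2 sqr_ge0.
Qed.

Lemma test_cauchy_limit (psi : nat -> field R) : (forall n, sqint mu (psi n)) ->
  (forall n w, ~ U w -> psi n w = 0) ->
  (forall e, 0 < e -> exists N, forall m n, (N <= m)%N -> (N <= n)%N ->
     nq (fun x => psi m x - psi n x) < e) ->
  exists2 g, sqint mu g /\ (forall w, ~ U w -> g w = 0) &
    nq (fun x => psi n x - g x) @[n --> \oo] --> 0.
Proof.
move=> hp p0 hc; have [g hg cg] := sqint_complete hp hc.
exists (zero_ext U g); first by split; [exact: sqint_zero_ext (open_measurable_plane oU) _|exact: zero_ext_out].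
apply/cvgr0Pnorm_le => e e0; have /cvgr0Pnorm_le/(_ e e0) := cg.
apply: filterS => n; rewrite !ger0_norm ?ip_ge0//; apply: le_trans.
exact: nq_zero_ext (p0 n).
Qed.

(** The squared distance from [G] to the rotated gradient of [psi]; the signs are those of a stream
    function [u] with [partial 1 u = G 0] and [partial 0 u = - G 1]. *)
Let J (psi : field R) := nq (fun x => G 0 x - partial 1 psi x) + nq (fun x => G 1 x + partial 0 psi x).

Lemma minimizing_sequence : exists psi : nat -> field R, exists2 c : R,
  (forall f, test_function U f -> c <= J f) &
  forall n, test_function U (psi n) /\ J (psi n) < c + n.+1%:R^-1.
Proof.
pose S := [set x | exists2 f, test_function U f & x = J f].
have S0 : S (J 0) by exists 0 => //; exact: test0.
have lbS : lbound S 0.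
  by move=> _ [f _ ->]; rewrite addr_ge0// ip_ge0.
have hS : has_inf S by split; [exists (J 0)|exists 0].
have /choice[psi Hpsi] : forall n : nat, exists f, test_function U f /\ J f < inf S + n.+1%:R^-1.
  move=> n; have n0 : 0 < n.+1%:R^-1 :> R by rewrite invr_gt0.
  have [_ [f tf ->] h] := inf_adherent n0 hS.
  by exists f.
exists psi, (inf S) => // f tf; apply: ge_inf; first by exists 0.
by exists f.
Qed.

Lemma partial_comb (f g : field R) (a b : R) j x : smooth f -> smooth g ->
  partial j (a *: f + b *: g) x = a * partial j f x + b * partial j g x.
Proof.
move=> sf sg; have e := partialD j (smoothZ a sf) (smoothZ b sg).
by rewrite e (partialZ a j sf) (partialZ b j sg).
Qed.

(** The core of the projection theorem: the midpoint of [f] and [g] has [J] at least [c], so the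
    parallelogram law bounds the distance of the two gradients by their excess over [c]. Minimising
    sequences thus have Cauchy gradients. *)
Lemma J_parallelogram (f g : field R) (c : R) : (forall f, test_function U f -> c <= J f) ->
  test_function U f -> test_function U g ->
  nq (fun x => partial 0 f x - partial 0 g x) + nq (fun x => partial 1 f x - partial 1 g x) <=
  2 * (J f - c) + 2 * (J g - c).
Proof.
have alg (a0 a1 b0 b1 h0 h1 : R) : c <= h1 + h0 ->
    (2 * a0 + 2 * b0 - 4 * h0) + (2 * a1 + 2 * b1 - 4 * h1) <=
    2 * (a1 + a0 - c) + 2 * (b1 + b0 - c) by move=> hh; lra.
move=> hc tf tg; have [sf _ _] := tf; have [sg _ _] := tg.
pose h := 2^-1 *: f + 2^-1 *: g.
have th : test_function U h by apply: testD; exact: testZ.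
have s j (k : field R) : test_function U k -> sqint mu (partial j k).
  by move=> tk; exact: (test_sqint (test_partial j tk)).
have e1 := parallelogram (sqintB (sG 0) (s 1 f tf)) (sqintB (sG 0) (s 1 g tg)).
have e2 := parallelogram (sqintD (sG 1) (s 0 f tf)) (sqintD (sG 1) (s 0 g tg)).
have Jh : J h = nq (fun x => 2^-1 * ((G 0 x - partial 1 f x) + (G 0 x - partial 1 g x))) +
    nq (fun x => 2^-1 * ((G 1 x + partial 0 f x) + (G 1 x + partial 0 g x))).
  have a1 (a p q : R) : a - (2^-1 * p + 2^-1 * q) = 2^-1 * ((a - p) + (a - q)) by field.
  have a2 (a p q : R) : a + (2^-1 * p + 2^-1 * q) = 2^-1 * ((a + p) + (a + q)) by field.
  rewrite /J; apply: congr2; apply: eq_Rintegral => x _.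
    by rewrite (partial_comb 2^-1 2^-1 1 x sf sg) a1.
  by rewrite (partial_comb 2^-1 2^-1 0 x sf sg) a2.
have d1 : nq (fun x => partial 1 f x - partial 1 g x) =
    nq (fun x => (G 0 x - partial 1 f x) - (G 0 x - partial 1 g x)).
  have a1 (a p q : R) : p - q = - ((a - p) - (a - q)) by ring.
  apply: eq_Rintegral => x _; rewrite (a1 (G 0 x) (partial 1 f x) (partial 1 g x)) mulrNN.
  by [].
have d2 : nq (fun x => partial 0 f x - partial 0 g x) =
    nq (fun x => (G 1 x + partial 0 f x) - (G 1 x + partial 0 g x)).
  have a1 (a p q : R) : p - q = (a + p) - (a + q) by ring.
  by apply: eq_Rintegral => x _; rewrite (a1 (G 1 x) (partial 0 f x) (partial 0 g x)).
have := hc h th; rewrite Jh => hch.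
rewrite (congr2 +%R (etrans d2 e2) (etrans d1 e1)).
exact: alg hch.
Qed.

Lemma cauchy_of_harmonic (a : nat -> nat -> R) (K : R) : 0 < K ->
  (forall m n, a m n <= K * (m.+1%:R^-1 + n.+1%:R^-1)) ->
  forall e, 0 < e -> exists N : nat, forall m n, (N <= m)%N -> (N <= n)%N -> a m n < e.
Proof.
move=> K0 ha e e0; exists (Num.truncn (2 * K / e)).+1 => m n Nm Nn.
have H k : ((Num.truncn (2 * K / e)).+1 <= k)%N -> k.+1%:R^-1 < e / (2 * K) :> R.
  move=> Nk; rewrite -[ltRHS]invrK ltf_pV2 ?posrE ?invr_gt0 ?divr_gt0 ?mulr_gt0//.
  by rewrite invf_div (lt_le_trans (truncnS_gt _))// ler_nat leqW.
apply: le_lt_trans (ha m n) _; rewrite mulrC -ltr_pdivlMr//.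
apply: lt_le_trans (ltrD (H m Nm) (H n Nn)) _.
by rewrite le_eqVlt; apply/orP; left; apply/eqP; field; rewrite gt_eqF.
Qed.

Lemma quadratic_ge0_eq0 (K Q : R) : 0 <= Q -> (forall t, 0 <= 0 - 2 * t * K + t ^+ 2 * Q) -> K = 0.
Proof.
move=> Q0 H; have P0 : 0 < Q + 1 by rewrite ltr_wpDl.
(* The minimising [t] would be [K / Q]; the shift by 1 covers [Q = 0] and still gives a negative
   value unless [K = 0]. *)
have := H (K / (Q + 1)).
have -> : 0 - 2 * (K / (Q + 1)) * K + (K / (Q + 1)) ^+ 2 * Q = - (K ^+ 2 * ((Q + 2) / (Q + 1) ^+ 2)).
  by field; rewrite gt_eqF.
rewrite oppr_ge0 pmulr_lle0; last by rewrite divr_gt0 ?exprn_gt0// ltr_wpDl.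
by move=> h; apply/eqP; rewrite -sqrf_eq0 eq_le h sqr_ge0.
Qed.

Lemma lim_eq (a b : nat -> R) (A B : R) : (forall n, a n = b n) ->
  a n @[n --> \oo] --> A -> b n @[n --> \oo] --> B -> A = B.
Proof. by move=> /funext-> ha; apply: cvg_unique. Qed.

(** A field of norm zero need not vanish pointwise; by Cauchy-Schwarz it is orthogonal to everything
    and does not affect norms. *)
Lemma nq_addl_null (a : nat -> field R) (N : field R) : (forall n, sqint mu (a n)) -> sqint mu N ->
  nq N = 0 -> nq (a n) @[n --> \oo] --> 0 ->
  forall t, nq (fun x => a n x - t * N x) @[n --> \oo] --> 0.
Proof.
move=> sa sN N0 ha t.
have e n : nq (fun x => a n x - t * N x) = nq (a n).
  have aN : ip mu (a n) N = 0.
    apply/eqP; rewrite -sqrf_eq0 eq_le sqr_ge0 andbT.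
    by apply: le_trans (CauchySchwarz (sa n) sN) _; rewrite N0 mulr0.
  by rewrite (ip_subZ t (sa n) sN) aN N0 !mulr0 subr0 addr0.
by under eq_fun do rewrite e.
Qed.

Lemma stream_function : exists u : field R, exists psi : nat -> field R,
  [/\ sqint mu u /\ (forall w, ~ U w -> u w = 0), forall n, test_function U (psi n),
      nq (fun x => psi n x - u x) @[n --> \oo] --> 0,
      nq (fun x => partial 0 (psi n) x + G 1 x) @[n --> \oo] --> 0 &
      nq (fun x => partial 1 (psi n) x - G 0 x) @[n --> \oo] --> 0].
Proof.
have alg1 (c d a b x y : R) : d <= 2 * (a - c) + 2 * (b - c) -> a < c + x -> b < c + y ->
  d <= 2 * (x + y) by lra.
have alg2 (h x : R) : h <= 2 * x -> 4 * M ^+ 2 * h <= 8 * M ^+ 2 * x.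
  by move=> /(ler_wpM2l (mulr_ge0 (ler0n R 4) (sqr_ge0 M))); lra.
have alg3 (c a x k q : R) : c <= a - k + q -> a < c + x -> 0 <= x - k + q by lra.
have alg4 (a b t k k' q q' : R) : a - 2 * t * k + t ^+ 2 * q +
    (b - 2 * (- t) * k' + (- t) ^+ 2 * q') = (a + b) - 2 * t * (k - k') + t ^+ 2 * (q' + q).
  by ring.
have alg5 (a b k : R) : a - k + (b + k) = a + b by ring.
have [psi [c hc /all_and2[tpsi Jpsi]]] := minimizing_sequence.
have s j n : sqint mu (partial j (psi n)) by exact: (test_sqint (test_partial j (tpsi n))).
have z0 j n w : ~ U w -> partial j (psi n) w = 0.
  exact: (test_supp (test_partial j (tpsi n))).
have dpar m n : nq (fun x => partial 0 (psi m) x - partial 0 (psi n) x) +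
    nq (fun x => partial 1 (psi m) x - partial 1 (psi n) x) <= 2 * (m.+1%:R^-1 + n.+1%:R^-1).
  exact: alg1 (J_parallelogram hc (tpsi m) (tpsi n)) (Jpsi m) (Jpsi n).
have cauchy j : forall e, 0 < e -> exists N : nat, forall m n, (N <= m)%N -> (N <= n)%N ->
    nq (fun x => partial j (psi m) x - partial j (psi n) x) < e.
  apply: (@cauchy_of_harmonic _ 2) => // m n; apply: le_trans (dpar m n).
  have [->|->] := ord2P j.
    exact: ler_wpDr (ip_ge0 _ _) (lexx _).
  exact: ler_wpDl (ip_ge0 _ _) (lexx _).
have [W0 [sW0 W00] cW0] := test_cauchy_limit (s 0) (z0 0) (cauchy 0).
have [W1 [sW1 W10] cW1] := test_cauchy_limit (s 1) (z0 1) (cauchy 1).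
have [u [su u0] cu] : exists2 u, sqint mu u /\ (forall w, ~ U w -> u w = 0) &
    nq (fun x => psi n x - u x) @[n --> \oo] --> 0.
  apply: test_cauchy_limit => [n|n w|]; [exact: (test_sqint (tpsi n))|exact: (test_supp (tpsi n))|].
  apply: (@cauchy_of_harmonic _ (8 * M ^+ 2)); first by rewrite mulr_gt0// exprn_gt0.
  move=> m n; have [sm _ _] := tpsi m; have [sn _ _] := tpsi n.
  have tmn : test_function U (1 *: psi m + (-1) *: psi n) by apply: testD; exact: testZ.
  have := poincare_inequality M0 UM tmn.
  have -> : nq (1 *: psi m + (-1) *: psi n) = nq (fun x => psi m x - psi n x).
    apply: eq_Rintegral => x _.
    by rewrite -[(_ + _) x]/(1 * psi m x + (-1) * psi n x) mul1r mulN1r.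
  have -> : nq (partial 0 (1 *: psi m + (-1) *: psi n)) =
      nq (fun x => partial 0 (psi m) x - partial 0 (psi n) x).
    by apply: eq_Rintegral => x _; rewrite !partial_comb// mul1r mulN1r.
  move=> /le_trans; apply.
  have h : nq (fun x => partial 0 (psi m) x - partial 0 (psi n) x) <= 2 * (m.+1%:R^-1 + n.+1%:R^-1).
    by apply: le_trans (dpar m n); exact: ler_wpDr (ip_ge0 _ _) (lexx _).
  exact: alg2 h.
(* The residual of the infimum: [G] minus the limit [(W1, - W0)] of the rotated gradients. *)
pose N (j : 'I_2) : field R := if j == 0 then (fun x => G 0 x - W1 x) else (fun x => G 1 x + W0 x).
have sN j : sqint mu (N j).
  by have [->|->] := ord2P j; rewrite /N /=; [exact: sqintB|exact: sqintD].
have N0 j w : ~ U w -> N j w = 0.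
  by move=> nw; have [->|->] := ord2P j; rewrite /N /= G0// ?W00// ?W10// ?subrr ?addr0.
have iN j : itg (N j).
  by apply: (sqint_itg (M := M)) => // w nw; apply: N0 => /UM.
have lim0 (f : field R) : sqint mu f -> ip mu (partial 0 (psi n)) f @[n --> \oo] --> ip mu W0 f.
  by move=> sf; exact: (ip_cvg (s 0) sW0 sf cW0).
have lim1 (f : field R) : sqint mu f -> ip mu (partial 1 (psi n)) f @[n --> \oo] --> ip mu W1 f.
  by move=> sf; exact: (ip_cvg (s 1) sW1 sf cW1).
(* The Euler-Lagrange equation of the minimisation. Each [psi n] is minimal up to [1 / (n + 1)], an
   error that disappears in the limit [K] of the first variations [k n]. *)
have curl f : test_function U f ->
    \int[mu]_w (N 0 w * partial 1 f w) = \int[mu]_w (N 1 w * partial 0 f w).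
  move=> tf; have [sf _ _] := tf.
  have s0 := test_sqint (test_partial 0 tf).
  have s1 := test_sqint (test_partial 1 tf).
  pose Q := nq (partial 0 f) + nq (partial 1 f).
  have Q0 : 0 <= Q by rewrite addr_ge0 ?ip_ge0.
  pose k n := ip mu (fun x => G 0 x - partial 1 (psi n) x) (partial 1 f) -
    ip mu (fun x => G 1 x + partial 0 (psi n) x) (partial 0 f).
  pose K := ip mu (N 0) (partial 1 f) - ip mu (N 1) (partial 0 f).
  have limk : k n @[n --> \oo] --> K.
    rewrite /k /K /N /= (ipBl (sG 0) sW1 s1) (ipDl (sG 1) sW0 s0).
    under eq_fun do rewrite (ipBl (sG 0) (s 1 _) s1) (ipDl (sG 1) (s 0 _) s0).
    apply: cvgB; first by apply: cvgB; [exact: cvg_cst|exact: lim1].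
    by apply: cvgD; [exact: cvg_cst|exact: lim0].
  have ge0 t n : 0 <= n.+1%:R^-1 - 2 * t * k n + t ^+ 2 * Q.
    have tt : test_function U (1 *: psi n + t *: f).
      exact: testD (testZ 1 (tpsi n)) (testZ t tf).
    have := hc _ tt; have [sp _ _] := tpsi n.
    have -> : J (1 *: psi n + t *: f) = J (psi n) - 2 * t * k n + t ^+ 2 * Q.
      have e1 := ip_subZ t (sqintB (sG 0) (s 1 n)) s1.
      have e2 := ip_subZ (- t) (sqintD (sG 1) (s 0 n)) s0.
      have -> : J (1 *: psi n + t *: f) =
        nq (fun x => (G 0 x - partial 1 (psi n) x) - t * partial 1 f x) +
        nq (fun x => (G 1 x + partial 0 (psi n) x) - (- t) * partial 0 f x).
        have a1 (a p q : R) : a - (1 * p + t * q) = a - p - t * q by ring.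
        have a2 (a p q : R) : a + (1 * p + t * q) = a + p - - t * q by ring.
        rewrite /J; apply: congr2; apply: eq_Rintegral => x _.
          by rewrite (partial_comb 1 t 1 x sp sf) a1.
        by rewrite (partial_comb 1 t 0 x sp sf) a2.
      exact: etrans (congr2 +%R e1 e2) (alg4 _ _ _ _ _ _ _).
    by move=> h; exact: alg3 h (Jpsi n).
  have geK t : 0 <= 0 - 2 * t * K + t ^+ 2 * Q.
    have L : (n.+1%:R^-1 - 2 * t * k n + t ^+ 2 * Q) @[n --> \oo] --> 0 - 2 * t * K + t ^+ 2 * Q.
      apply: cvgD; last exact: cvg_cst.
      apply: cvgB; first exact: cvg_harmonic.
      by apply: cvgM; [exact: cvg_cst|exact: limk].
    by apply: (cvgr_to_ge L); apply: nearW => n; exact: ge0.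
  have K0 : K = 0 := quadratic_ge0_eq0 Q0 geK.
  by move/eqP: K0; rewrite subr_eq0 => /eqP.
(* A limit of gradients is weakly curl free, so the rotated limit is weakly divergence free;
   [smooth_class] lets the mixed derivatives of the test function commute. *)
have swap f : smooth_class f -> test_function U f ->
    ip mu W1 (partial 0 f) = ip mu W0 (partial 1 f).
  move=> scf tf; have [sf _ _] := tf.
  have s0 := test_sqint (test_partial 0 tf).
  have s1 := test_sqint (test_partial 1 tf).
  apply: lim_eq (lim1 _ s0) (lim0 _ s1) => n.
  apply: etrans (ipC mu _ _) _; apply: etrans (ip_partial_swap 1 (smooth_partial 0 sf) (tpsi n)) _.
  apply: etrans (esym (ipC mu _ _)); apply: etrans (esym (ip_partial_swap 0 (smooth_partial 1 sf) (tpsi n))).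
  by rewrite (partial_schwarz scf).
have div f : smooth_class f -> test_function U f ->
    \int[mu]_w (N 0 w * partial 0 f w) + \int[mu]_w (N 1 w * partial 1 f w) = 0.
  move=> scf tf.
  have s0 := test_sqint (test_partial 0 tf).
  have s1 := test_sqint (test_partial 1 tf).
  have h := orthogonal_test tf.
  have e0 : ip mu (N 0) (partial 0 f) = ip mu (G 0) (partial 0 f) - ip mu W1 (partial 0 f).
    exact: (ipBl (sG 0) sW1 s0).
  have e1 : ip mu (N 1) (partial 1 f) = ip mu (G 1) (partial 1 f) + ip mu W0 (partial 1 f).
    exact: (ipDl (sG 1) sW0 s1).
  apply: etrans (congr2 +%R e0 e1) _.
  by rewrite (swap f scf tf) alg5.
have [F [cF locF aeF]] := smooth_representative oU UM iN N0 curl div.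
have [P HP] := global_primitive oU scU locF.
have NF j : {ae mu, forall w, N j w = zero_ext U (F j) w}.
  apply: ae_imply (aeF j) => w h; have [Uw|Uw] := pselect (U w).
    by rewrite zero_ext_in// h.
  by rewrite zero_ext_out// N0.
have mF j := measurable_zero_ext oU (cF j).
have sF j : sqint mu (zero_ext U (F j)) by exact: sqint_ae (sN j) (mF j) (NF j).
(* [N] agrees almost everywhere in [U] with the gradient of [P], hence is orthogonal to [G]. *)
have GF := orthogonal_gradient oU UM sG HG HP cF sF.
have eGN j : ip mu (G j) (zero_ext U (F j)) = ip mu (N j) (G j).
  rewrite (ipC mu (N j)); apply/esym; apply: ip_ae (NF j) => //; [exact: (sN j).1|exact: (sG j).1].
have {}GF : ip mu (N 0) (G 0) + ip mu (N 1) (G 1) = 0.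
  exact: etrans (esym (congr2 +%R (eGN 0) (eGN 1))) GF.
(* The curl identity, tested with [psi n], passes to the limit: [N] is orthogonal to the limit of
   the rotated gradients. *)
have WN : ip mu W1 (N 0) = ip mu W0 (N 1).
  apply: lim_eq (lim1 _ (sN 0)) (lim0 _ (sN 1)) => n.
  exact: etrans (ipC mu _ _) (etrans (curl _ (tpsi n)) (ipC mu _ _)).
have NN : nq (N 0) + nq (N 1) = 0.
  have e0 : nq (N 0) = ip mu (N 0) (G 0) - ip mu (N 0) W1 by exact: (ipBr (sG 0) sW1 (sN 0)).
  have e1 : nq (N 1) = ip mu (N 1) (G 1) + ip mu (N 1) W0 by exact: (ipDr (sG 1) sW0 (sN 1)).
  apply: etrans (congr2 +%R e0 e1) _.
  rewrite (etrans (ipC mu (N 0) W1) (etrans WN (ipC mu W0 (N 1)))).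
  by rewrite alg5.
have nN j : nq (N j) = 0.
  move/eqP: NN; rewrite paddr_eq0 ?ip_ge0// => /andP[/eqP n0 /eqP n1].
  by have [->|->] := ord2P j.
exists u, psi; split=> //.
(* Replacing [W0] by [- G 1] changes the field by the null function [N 1] only. *)
- have := nq_addl_null (fun n => sqintB (s 0 n) sW0) (sN 1) (nN 1) cW0 (-1).
  have -> // : (fun n => nq (fun x => partial 0 (psi n) x - W0 x - (-1) * N 1 x)) =
    (fun n => nq (fun x => partial 0 (psi n) x + G 1 x)).
  apply/funext => n; apply: eq_Rintegral => x _.
  have a1 (p q r : R) : p - q - (-1) * (r + q) = p + r by ring.
  by rewrite (a1 _ _ (G 1 x)).
- have := nq_addl_null (fun n => sqintB (s 1 n) sW1) (sN 0) (nN 0) cW1 1.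
  have -> // : (fun n => nq (fun x => partial 1 (psi n) x - W1 x - 1 * N 0 x)) =
    (fun n => nq (fun x => partial 1 (psi n) x - G 0 x)).
  apply/funext => n; apply: eq_Rintegral => x _.
  have a1 (p q r : R) : p - q - 1 * (r - q) = p - r by ring.
  by rewrite (a1 _ _ (G 0 x)).
Qed.


End StreamFunction.

(** * Plane elasticity *)

Section Hooke.
Variable R : realType.

Lemma sum_ord2 (V : nmodType) (F : 'I_2 -> V) : \sum_(k < 2) F k = F 0 + F 1.
Proof. by rewrite big_ord_recl big_ord1; congr (_ + F _); apply: val_inj. Qed.

(** With [K = E / (1 + nu)] and [l] this ratio, Hooke's law reads
    [sigma = K (l (tr eps) I + eps)]. *)
Definition lame (pc : plane_case) (nu : R) : R :=
  if pc is PlaneStrain then nu / (1 - 2 * nu) else nu / (1 - nu).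

Lemma contract_stiffness (X : Type) pc (E nu : R) (T : 'I_2 -> 'I_2 -> X -> R) i j x :
  contract (stiffness pc E nu) T i j x = E / (1 + nu) *
    (lame pc nu * (i == j)%:R * (T 0 0 x + T 1 1 x) + 2^-1 * (T i j x + T j i x)).
Proof.
have -> : contract (stiffness pc E nu) T i j x =
    stiffness pc E nu i j 0 0 * T 0 0 x + stiffness pc E nu i j 0 1 * T 0 1 x +
    (stiffness pc E nu i j 1 0 * T 1 0 x + stiffness pc E nu i j 1 1 * T 1 1 x).
  by rewrite /contract !sum_ord2.
rewrite /stiffness -/(lame pc nu).
move: (lame pc nu) (E / (1 + nu)) => l K.
by have [->|->] := ord2P i; have [->|->] := ord2P j; rewrite /=; ring.
Qed.

Lemma DivE (T : 'I_2 -> 'I_2 -> distr R) i psi :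
  Div T i psi = - (T i 0 (partial 0 psi) + T i 1 (partial 1 psi)).
Proof. by rewrite /Div sum_ord2 opprD. Qed.

(** The normal coefficient is [E / (1 + nu)] times [nu / (1 - nu) + 1], that is [E / (1 - nu^2)];
    the shear coefficient [E / (1 + nu)] is [1 - nu] times that. *)
Lemma plane_stress_source (E nu : R) (D : 'I_2 -> 'I_2 -> distr R) psi :
  1 + nu != 0 -> 1 - nu != 0 -> D 1 0 = D 0 1 ->
  (- Div (contract (stiffness PlaneStress E nu) D) 0) psi =
    (- (E / (1 - nu ^+ 2)) *: (dpartial 0 (D 0 0) + nu *: dpartial 0 (D 1 1)
       + (1 - nu) *: dpartial 1 (D 0 1))) psi /\
  (- Div (contract (stiffness PlaneStress E nu) D) 1) psi =
    (- (E / (1 - nu ^+ 2)) *: (nu *: dpartial 1 (D 0 0) + dpartial 1 (D 1 1)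
       + (1 - nu) *: dpartial 0 (D 0 1))) psi.
Proof.
move=> p0 m0 sD.
have n0 : 1 - nu ^+ 2 != 0 by rewrite -[X in X - _](expr1n _ 2) subr_sqr mulf_neq0// addrC.
have e i : (- Div (contract (stiffness PlaneStress E nu) D) i) psi =
  contract (stiffness PlaneStress E nu) D i 0 (partial 0 psi) +
  contract (stiffness PlaneStress E nu) D i 1 (partial 1 psi).
  by rewrite -[LHS]/(- Div _ i psi) DivE opprK.
rewrite !e !contract_stiffness sD /= /lame.
split.
  rewrite -[RHS]/(- (E / (1 - nu ^+ 2)) * (- D 0 0 (partial 0 psi) + nu * - D 1 1 (partial 0 psi)
     + (1 - nu) * - D 0 1 (partial 1 psi))).
  move: (partial 0 psi) (partial 1 psi) => d0 d1.
  by field; rewrite p0 m0 n0.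
rewrite -[RHS]/(- (E / (1 - nu ^+ 2)) * (nu * - D 0 0 (partial 1 psi) - D 1 1 (partial 1 psi)
   + (1 - nu) * - D 0 1 (partial 0 psi))).
move: (partial 0 psi) (partial 1 psi) => d0 d1.
by field; rewrite p0 m0 n0.
Qed.

End Hooke.

(** * Weak derivatives of strong limits *)

Section StrongLimits.
Variable R : realType.
Notation mu := (leb2 R).
Notation nq f := (ip mu f f).

Lemma nq_cvgD (a b : nat -> field R) (A B : field R) :
  (forall n, sqint mu (a n)) -> (forall n, sqint mu (b n)) -> sqint mu A -> sqint mu B ->
  nq (fun x => a n x - A x) @[n --> \oo] --> 0 ->
  nq (fun x => b n x - B x) @[n --> \oo] --> 0 ->
  nq (fun x => 2^-1 * (a n x + b n x) - 2^-1 * (A x + B x)) @[n --> \oo] --> 0.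
Proof.
move=> sa sb sA sB ca cb.
have alg (p q r s : R) : s = 2 * p + 2 * q - 4 * r -> 0 <= s -> r <= 2^-1 * p + 2^-1 * q by lra.
have c : 2^-1 * nq (fun x => a n x - A x) + 2^-1 * nq (fun x => b n x - B x) @[n --> \oo] --> 0.
  rewrite -[0](addr0 (0 : R)) -{1}(mulr0 (2^-1 : R)) -[X in _ + X](mulr0 (2^-1 : R)).
  by apply: cvgD; apply: cvgM => //; exact: cvg_cst.
apply: (squeeze_cvgr _ (cvg_cst 0) c); apply: nearW => n; apply/andP; split; first exact: ip_ge0.
have e := parallelogram (sqintB (sa n) sA) (sqintB (sb n) sB).
apply: le_trans (alg _ _ _ _ e (ip_ge0 _ _)).
rewrite le_eqVlt; apply/orP; left; apply/eqP; apply: eq_Rintegral => x _.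
have r (p q s t : R) : 2^-1 * (p + q) - 2^-1 * (s + t) = 2^-1 * (p - s + (q - t)) by ring.
by rewrite r.
Qed.

Lemma nq_cvgZ (a : nat -> field R) (A : field R) (k : R) :
  (forall n, sqint mu (a n)) -> sqint mu A ->
  nq (fun x => a n x - A x) @[n --> \oo] --> 0 ->
  nq (fun x => k * a n x - k * A x) @[n --> \oo] --> 0.
Proof.
move=> sa sA ca.
have e n : nq (fun x => k * a n x - k * A x) = k ^+ 2 * nq (fun x => a n x - A x).
  have s := sqintB (sa n) sA.
  have -> : nq (fun x => k * a n x - k * A x) = nq (fun x => k * (a n x - A x)).
    by apply: eq_Rintegral => x _; rewrite (mulrBr k (a n x) (A x)).
  rewrite (ipZl k s (sqintZ k s)) (ipZr k s s); exact: mulrA.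
under eq_fun do rewrite e.
by rewrite -[0](mulr0 (k ^+ 2)); apply: cvgM => //; exact: cvg_cst.
Qed.

(** Integration by parts for [f n] passes to the limit. [V] is independent of [U]: with [V] the
    plane, [u] has weak gradient [du] without a jump across the boundary of [U]. *)
Lemma weak_gradient_limit (U : set (plane R)) (f : nat -> field R) (u du : field R) j :
  (forall n, test_function U (f n)) -> sqint mu u -> sqint mu du ->
  nq (fun x => f n x - u x) @[n --> \oo] --> 0 ->
  nq (fun x => partial j (f n) x - du x) @[n --> \oo] --> 0 ->
  forall V psi, test_function V psi -> ip mu u (partial j psi) = - ip mu du psi.
Proof.
move=> tf su sdu cu cdu V psi tpsi; have [spsi _ _] := tpsi.
have sp := test_sqint tpsi; have sdp := test_sqint (test_partial j tpsi).
have s n := test_sqint (tf n); have ds n := test_sqint (test_partial j (tf n)).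
apply: lim_eq (ip_cvg s su sdp cu) (cvgN (ip_cvg ds sdu sp cdu)) => n.
by have [sf _ _] := tf n; exact: ip_partial_swap sf tpsi.
Qed.

Lemma sqint_L2 (U : set (plane R)) (f : field R) : sqint mu f -> (forall w, ~ U w -> f w = 0) ->
  L2 U f.
Proof. by move=> sf f0; apply/L2P; rewrite zero_ext_id. Qed.

Lemma distr_of_zero_off (U : set (plane R)) (f : field R) psi : (forall w, ~ U w -> f w = 0) ->
  distr_of U f psi = ip mu f psi.
Proof. by move=> f0; rewrite distr_ofE zero_ext_id. Qed.

Lemma distr_of_test (U : set (plane R)) (f psi : field R) : test_function U psi ->
  distr_of U f psi = ip mu f psi.
Proof.
move=> tpsi; rewrite distr_ofE; apply: eq_Rintegral => x _.
have [Ux|Ux] := pselect (U x); first by rewrite zero_ext_in.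
by rewrite (test_supp tpsi Ux) !mulr0.
Qed.

Lemma sqint_L2loc (f : field R) : sqint mu f -> L2loc f.
Proof.
move=> sf K cK; apply/L2P; apply: sqint_zero_ext sf.
rewrite -[K]setCK; apply: measurableC; apply: open_measurable_plane.
by apply: closed_openC; apply: compact_closed => //; exact: norm_hausdorff.
Qed.

Lemma L2norm_cvg_zero_off (U : set (plane R)) (f : nat -> field R) :
  (forall n, sqint mu (f n)) -> (forall n w, ~ U w -> f n w = 0) ->
  nq (f n) @[n --> \oo] --> 0 -> L2norm U (f n) @[n --> \oo] --> 0%E.
Proof.
move=> sf f0 c; apply/L2norm_cvg0P; first by move=> n; exact: sqint_L2 (f0 n).
by under eq_fun do rewrite (zero_ext_id (f0 _)).
Qed.

Lemma H10_of_limit (U : set (plane R)) (f : nat -> field R) (u : field R) (du : 'I_2 -> field R) :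
  (forall n, test_function U (f n)) ->
  sqint mu u -> (forall w, ~ U w -> u w = 0) ->
  (forall j, sqint mu (du j)) -> (forall j w, ~ U w -> du j w = 0) ->
  nq (fun x => f n x - u x) @[n --> \oo] --> 0 ->
  (forall j, nq (fun x => partial j (f n) x - du j x) @[n --> \oo] --> 0) ->
  H10 U u.
Proof.
move=> tf su u0 sdu du0 cu cdu.
exists du; first split; [exact: sqint_L2 u0|by move=> j; exact: sqint_L2 (du0 j)|move=> j psi tpsi|].
  rewrite /dpartial (distr_of_zero_off _ u0) (distr_of_zero_off _ (du0 j)).
  by rewrite (weak_gradient_limit tf su (sdu j) cu (cdu j) tpsi) opprK.
exists f; split=> //.
  apply: L2norm_cvg_zero_off => [n|n w nw|]; last exact: cu.
    exact: sqintB (test_sqint (tf n)) su.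
  by rewrite -[LHS]/(f n w - u w) u0// (test_supp (tf n)) ?subrr.
move=> j; apply: L2norm_cvg_zero_off => [n|n w nw|]; last exact: cdu.
  exact: sqintB (test_sqint (test_partial j (tf n))) (sdu j).
by rewrite -[LHS]/(partial j (f n) w - du j w) du0// (test_supp (test_partial j (tf n))) ?subrr.
Qed.

End StrongLimits.

Section Elasticity.
Variable R : realType.
Notation mu := (leb2 R).
Notation nq f := (ip mu f f).

Variables (U : set (plane R)) (M K l : R) (e : tfield R).
Hypotheses (oU : open U) (M0 : 0 < M) (UM : U `<=` cbox M) (scU : simply_connected U).
Hypotheses (K0 : K != 0) (l0 : 2 * l + 1 != 0).
Hypothesis se : forall i j, sqint mu (e i j).
Hypothesis e0 : forall i j w, ~ U w -> e i j w = 0.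
Hypothesis symE : forall i j w, e i j w = e j i w.

Definition hooke (i j : 'I_2) : field R :=
  fun x => K * (l * (i == j)%:R * (e 0 0 x + e 1 1 x) + e i j x).

Hypothesis equil : forall i phi dphi, H1 U phi dphi ->
  \int[mu]_(w in U) (hooke i 0 w * dphi 0 w) + \int[mu]_(w in U) (hooke i 1 w * dphi 1 w) = 0.

Lemma sqint_hooke i j : sqint mu (hooke i j).
Proof. by apply: sqintZ; apply: sqintD => //; apply: sqintZ; exact: sqintD. Qed.

Lemma hooke_out i j w : ~ U w -> hooke i j w = 0.
Proof. by move=> nw; rewrite /hooke !e0// !(addr0, mulr0). Qed.

Lemma hooke_sym i j w : hooke i j w = hooke j i w.
Proof. by rewrite /hooke (eq_sym j i) (symE j i). Qed.

Lemma ip_hooke i j f : sqint mu f ->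
  ip mu (hooke i j) f = K * (l * (i == j)%:R * (ip mu (e 0 0) f + ip mu (e 1 1) f) + ip mu (e i j) f).
Proof.
move=> sf; have s1 := sqintD (se 0 0) (se 1 1).
have s2 := sqintZ (l * (i == j)%:R) s1.
rewrite /hooke (ipZl K (sqintD s2 (se i j)) sf) (ipDl s2 (se i j) sf).
by rewrite (ipZl _ s1 sf) (ipDl (se 0 0) (se 1 1) sf).
Qed.

(** The trace coefficient of the inverse law: [tr sigma = K (2 l + 1) tr e], hence
    [e = K^-1 sigma - beta (tr sigma) I]. *)
Let beta := l / (K * (2 * l + 1)).

(** With stream functions [u i] of the stress rows, [w = beta (u 1, - u 0)] has symmetrised gradient
    [beta (sigma - (tr sigma) I)]. This absorbs the trace term of the inverse law and leaves a
    multiple of the stress. *)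
Lemma airy_displacement : exists (w : vfield R) (D : tfield R) (chi : nat -> vfield R),
  [/\ forall n i, test_function U (chi n i),
      forall i, sqint mu (w i) /\ (forall x, ~ U x -> w i x = 0),
      forall i j, sqint mu (D i j) /\ (forall x, ~ U x -> D i j x = 0),
      (forall i, nq (fun x => chi n i x - w i x) @[n --> \oo] --> 0) /\
      (forall i j, nq (fun x => partial j (chi n i) x - D i j x) @[n --> \oo] --> 0) &
      forall i j x, e i j x = 2^-1 * (D i j x + D j i x) + (K^-1 - beta) * hooke i j x].
Proof.
have /choice[u /choice[psi H]] i :=
  stream_function oU M0 UM scU (sqint_hooke i) (@hooke_out i) (@equil i).
(* [s] swaps the two stream functions, [c] carries the sign and the factor [beta], and row [i] of
   [T] is the gradient of [u i]. *)
pose s (i : 'I_2) : 'I_2 := if i == 0 then 1 else 0.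
pose c (i : 'I_2) := if i == 0 then beta else - beta.
pose T (i j : 'I_2) : field R := if j == 0 then (fun x => - hooke i 1 x) else hooke i 0.
have sT i j : sqint mu (T i j).
  rewrite /T; case: (j == 0); last exact: sqint_hooke.
  have -> : (fun x => - hooke i 1 x) = (fun x => -1 * hooke i 1 x) by apply/funext => x; rewrite mulN1r.
  exact/sqintZ/sqint_hooke.
have T0 i j x : ~ U x -> T i j x = 0.
  by move=> nx; rewrite /T; case: (j == 0); rewrite hooke_out ?oppr0.
have tpsi i n : test_function U (psi i n) by have [] := H i.
have su i : sqint mu (u i) by have [[]] := H i.
have u0 i x : ~ U x -> u i x = 0 by have [[_ h] _ _ _ _] := H i; exact: h.
have cT i j : nq (fun x => partial j (psi i n) x - T i j x) @[n --> \oo] --> 0.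
  have [_ _ _ h0 h1] := H i; have [->|->] := ord2P j; last exact: h1.
  have -> // : (fun n => nq (fun x => partial 0 (psi i n) x - T i 0 x)) =
    (fun n => nq (fun x => partial 0 (psi i n) x + hooke i 1 x)).
  by apply/funext => n; apply: eq_Rintegral => x _; rewrite /T opprK.
exists (fun i x => c i * u (s i) x), (fun i j x => c i * T (s i) j x), (fun n i => c i *: psi (s i) n).
split.
- by move=> n i; exact: testZ.
- by move=> i; split; [exact: sqintZ|move=> x /u0->; rewrite mulr0].
- by move=> i j; split; [exact: sqintZ|move=> x /T0->; rewrite mulr0].
- split=> [i|i j].
    by apply: nq_cvgZ => // [n|]; [exact: test_sqint (tpsi _ n)|have [] := H (s i)].
  have E n : partial j (c i *: psi (s i) n) = c i *: partial j (psi (s i) n).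
    by have [sp _ _] := tpsi (s i) n; exact: partialZ.
  under eq_fun do rewrite E.
  exact: nq_cvgZ (fun n => test_sqint (test_partial j (tpsi (s i) n))) (sT (s i) j) (cT (s i) j).
- move=> i j x.
  have [->|->] := ord2P i; have [->|->] := ord2P j; rewrite /c /s /T /hooke /beta /= ?(symE 1 0);
    field; by rewrite K0 l0.
Qed.

End Elasticity.

(** * Uniqueness of the Helmholtz decomposition *)

Section HelmholtzUniqueness.
Variable R : realType.
Notation mu := (leb2 R).
Notation nq f := (ip mu f f).
Implicit Types (S g D : tfield R) (phi : vfield R).

Definition solenoidal S : Prop := forall i f, test_function setT f ->
  ip mu (S i 0) (partial 0 f) + ip mu (S i 1) (partial 1 f) = 0.

Lemma test_symgradE phi i j : test_symgrad phi i j =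
  (fun x => 2^-1 * (partial j (phi i) x + partial i (phi j) x)).
Proof. by []. Qed.

Lemma test_test_symgrad phi i j : (forall k, test_function setT (phi k)) ->
  test_function setT (test_symgrad phi i j).
Proof. by move=> t; apply: testZ; apply: testD; exact: test_partial. Qed.

(** Against a symmetric tensor field the symmetrised gradient acts as the full gradient. *)
Lemma solenoidal_orthogonal S phi : (forall i j, sqint mu (S i j)) ->
  (forall i j x, S i j x = S j i x) -> solenoidal S -> (forall k, test_function setT (phi k)) ->
  ip mu (S 0 0) (test_symgrad phi 0 0) + ip mu (S 0 1) (test_symgrad phi 0 1) +
  (ip mu (S 1 0) (test_symgrad phi 1 0) + ip mu (S 1 1) (test_symgrad phi 1 1)) = 0.
Proof.
have alg (a b c d : R) : a + b = 0 -> c + d = 0 ->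
  2^-1 * (a + a) + 2^-1 * (b + c) + (2^-1 * (c + b) + 2^-1 * (d + d)) = 0 by lra.
move=> sS symS dS t.
have s j i := test_sqint (test_partial j (t i)).
have E i j : ip mu (S i j) (test_symgrad phi i j) =
    2^-1 * (ip mu (S i j) (partial j (phi i)) + ip mu (S i j) (partial i (phi j))).
  rewrite test_symgradE (ipZr 2^-1 (sqintD (s j i) (s i j)) (sS i j)).
  by rewrite (ipDr (s j i) (s i j) (sS i j)).
rewrite !E.
have S10 : S 1 0 = S 0 1 by apply/funext => x; exact: symS.
have h0 := dS 0 _ (t 0); have := dS 1 _ (t 1); rewrite !S10.
exact: alg.
Qed.

Definition dot (S D : tfield R) : R :=
  ip mu (S 0 0) (D 0 0) + ip mu (S 0 1) (D 0 1) + (ip mu (S 1 0) (D 1 0) + ip mu (S 1 1) (D 1 1)).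

Lemma dot_cvg D g (phi : nat -> vfield R) : (forall i j, sqint mu (D i j)) ->
  (forall i j, sqint mu (g i j)) -> (forall n i, test_function setT (phi n i)) ->
  (forall i j, nq (fun x => test_symgrad (phi n) i j x - g i j x) @[n --> \oo] --> 0) ->
  (forall n, dot D (test_symgrad (phi n)) = 0) -> dot D g = 0.
Proof.
move=> sD sg t c z.
have L i j : ip mu (D i j) (test_symgrad (phi n) i j) @[n --> \oo] --> ip mu (D i j) (g i j).
  rewrite ipC; under eq_fun do rewrite ipC.
  by apply: ip_cvg (c i j) => // n; exact: test_sqint (test_test_symgrad i j (t n)).
have h : dot D (test_symgrad (phi n)) @[n --> \oo] --> dot D g.
  exact: cvgD (cvgD (L 0 0) (L 0 1)) (cvgD (L 1 0) (L 1 1)).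
have c0 : (0 : R) @[n --> \oo] --> (0 : R) by exact: cvg_cst.
exact: lim_eq z h c0.
Qed.

(** The difference [D] of the potential parts is a limit of symmetrised gradients of test fields and
    also, up to sign, the difference of the two divergence free parts; these are orthogonal, so [D]
    has norm zero. *)
Lemma potential_part_unique (g g0 se se0 : tfield R) (phi phi0 : nat -> vfield R) :
  (forall i j, sqint mu (g i j)) -> (forall i j, sqint mu (g0 i j)) ->
  (forall i j, sqint mu (se i j)) -> (forall i j, sqint mu (se0 i j)) ->
  (forall i j x, se i j x = se j i x) -> (forall i j x, se0 i j x = se0 j i x) ->
  solenoidal se -> solenoidal se0 ->
  (forall n i, test_function setT (phi n i)) -> (forall n i, test_function setT (phi0 n i)) ->
  (forall i j, nq (fun x => test_symgrad (phi n) i j x - g i j x) @[n --> \oo] --> 0) ->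
  (forall i j, nq (fun x => test_symgrad (phi0 n) i j x - g0 i j x) @[n --> \oo] --> 0) ->
  (forall i j f, test_function setT f ->
     ip mu (g i j) f + ip mu (se i j) f = ip mu (g0 i j) f + ip mu (se0 i j) f) ->
  forall i j f, test_function setT f -> ip mu (g i j) f = ip mu (g0 i j) f.
Proof.
have alg (a b c d : R) : a + b = c + d -> a - c = d - b by lra.
have alg2 (a b c d a' b' c' d' : R) : a + b + (c + d) = 0 -> a' + b' + (c' + d') = 0 ->
  a' - a + (b' - b) + (c' - c + (d' - d)) = 0 by lra.
have alg3 (a b c d : R) : 0 <= a -> 0 <= b -> 0 <= c -> 0 <= d -> a + b + (c + d) = 0 ->
  [/\ a = 0, b = 0, c = 0 & d = 0] by move=> *; split; lra.
move=> sg sg0 sse sse0 symse symse0 dse dse0 t t0 c c0 eqs.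
pose D i j : field R := fun x => g i j x - g0 i j x.
have sD i j : sqint mu (D i j) by exact: sqintB.
(* The two descriptions of [D] agree only against test functions; this suffices, since symmetrised
   gradients of test fields are made of test functions. *)
have DE i j f : test_function setT f -> ip mu (D i j) f = ip mu (se0 i j) f - ip mu (se i j) f.
  move=> tf; have sf := test_sqint tf.
  apply: etrans (ipBl (sg i j) (sg0 i j) sf) _; exact: alg (eqs i j f tf).
have D0 (p : vfield R) : (forall k, test_function setT (p k)) -> dot D (test_symgrad p) = 0.
  move=> tp; rewrite /dot !DE; try exact: test_test_symgrad.
  exact: alg2 (solenoidal_orthogonal sse symse dse tp) (solenoidal_orthogonal sse0 symse0 dse0 tp).
have Dg := dot_cvg sD sg t c (fun n => D0 _ (t n)).
have Dg0 := dot_cvg sD sg0 t0 c0 (fun n => D0 _ (t0 n)).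
have E i j : ip mu (D i j) (D i j) = ip mu (D i j) (g i j) - ip mu (D i j) (g0 i j).
  exact: ipBr.
have DD : nq (D 0 0) + nq (D 0 1) + (nq (D 1 0) + nq (D 1 1)) = 0.
  rewrite !E; exact: alg2 Dg0 Dg.
have [d00 d01 d10 d11] := alg3 _ _ _ _ (ip_ge0 _ _) (ip_ge0 _ _) (ip_ge0 _ _) (ip_ge0 _ _) DD.
have nD i j : nq (D i j) = 0 by have [->|->] := ord2P i; have [->|->] := ord2P j.
move=> i j f tf; have sf := test_sqint tf.
have : ip mu (D i j) f = 0.
  apply/eqP; rewrite -sqrf_eq0 eq_le sqr_ge0 andbT.
  by apply: le_trans (CauchySchwarz (sD i j) sf) _; rewrite nD mul0r.
by rewrite (ipBl (sg i j) (sg0 i j) sf) => /eqP; rewrite subr_eq0 => /eqP.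
Qed.

End HelmholtzUniqueness.

Section Extension.
Variable R : realType.
Notation mu := (leb2 R).
Notation nq f := (ip mu f f).

Lemma L2_setT (f : field R) : L2 setT f -> sqint mu f.
Proof. by move/L2P; rewrite zero_extT. Qed.

Lemma distr_of_setT (f psi : field R) : distr_of setT f psi = ip mu f psi.
Proof. by rewrite distr_ofE zero_extT. Qed.

Lemma L2norm_setT_cvg (f : nat -> field R) : (forall n, sqint mu (f n)) ->
  L2norm setT (f n) @[n --> \oo] --> 0%E -> nq (f n) @[n --> \oo] --> 0.
Proof.
move=> sf /L2norm_cvg0P h.
have {h} : nq (zero_ext setT (f n)) @[n --> \oo] --> 0.
  by apply: h => n; apply/L2P; rewrite zero_extT.
by under eq_fun do rewrite zero_extT.
Qed.

Lemma partial_zero j : partial j (0 : field R) = 0.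
Proof. by apply/funext => x; exact: derive_cst. Qed.

Lemma H1_zero (U : set (plane R)) : open U -> H1 U 0 (fun j => partial j (0 : field R)).
Proof. by move=> oU; exact: test_H1 oU (test0 U). Qed.

(** The test field has [phi] as component [i] and zero as the other. *)
Lemma equilibrium_row (U : set (plane R)) (sigma : tfield R) : open U ->
  equilibrium_zero_traction U sigma -> forall i phi dphi, H1 U phi dphi ->
  \int[mu]_(x in U) (sigma i 0 x * dphi 0 x) + \int[mu]_(x in U) (sigma i 1 x * dphi 1 x) = 0.
Proof.
move=> oU eq i phi dphi H.
have H' (k : 'I_2) : H1 U (if k == i then phi else 0) (if k == i then dphi else fun j => partial j 0).
  by case: (k == i) => //; exact: H1_zero.
have := eq _ _ H'; rewrite !sum_ord2.
have z (f : field R) j : \int[mu]_(x in U) (f x * partial j (0 : field R) x) = 0.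
  rewrite partial_zero /Rintegral (eq_integral (cst 0%E)); first by rewrite integral0.
  by move=> x _; rewrite /= mulr0.
have [->|->] := ord2P i; rewrite /= !z addr0 ?add0r ?addr0//.
Qed.

End Extension.

Section Coefficients.
Variable R : realFieldType.

(** [2 l + 1] is, up to the factor [K], what Hooke's law multiplies the trace by: [1 / (1 - 2 nu)]
    in plane strain and [(1 + nu) / (1 - nu)] in plane stress. *)
Lemma lame_neq0 (nu : R) : - 1 < nu -> nu < 2^-1 ->
  2 * (nu / (1 - 2 * nu)) + 1 != 0 /\ 2 * (nu / (1 - nu)) + 1 != 0.
Proof.
move=> n1 n2; have a : 1 - 2 * nu != 0 by apply/eqP; lra.
have b : 1 - nu != 0 by apply/eqP; lra.
split; [have -> : 2 * (nu / (1 - 2 * nu)) + 1 = (1 - 2 * nu)^-1 by field|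
  have -> : 2 * (nu / (1 - nu)) + 1 = (1 + nu) / (1 - nu) by field].
  by rewrite invr_eq0.
by rewrite mulf_neq0// ?invr_eq0//; apply/eqP; lra.
Qed.

End Coefficients.

(** * The boundary value problem for the potential *)

Theorem mainTheorem7 (R : realType) (pc : plane_case) (E nu : R)
    (Omega : set (plane R)) (eps : tfield R)
    (omega : vfield R) (seps : tfield R) :
  0 < E -> -1 < nu -> nu < 2^-1 ->
  domain Omega -> bounded_set Omega -> simply_connected Omega ->
  lipschitz_boundary Omega ->
  L2sym Omega eps ->
  equilibrium_zero_traction Omega (contract (stiffness pc E nu) eps) ->
  helmholtz (fun i j => zero_ext Omega (eps i j)) omega seps ->
  let C := stiffness pc E nu in
  let dseps := tdistr_of Omega seps in
  let b := fun i : 'I_2 => - Div (contract C dseps) i in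
  (exists omega0 : vfield R,
     [/\ same_potential omega omega0,
         forall i, eq_distr Omega (Div (contract C (symgrad Omega omega0)) i) (b i) &
         forall i, H10 Omega (omega0 i)]) /\
  (pc = PlaneStress ->
     eq_distr Omega (b 0)
       (- (E / (1 - nu ^+ 2)) *:
          (dpartial 0 (dseps 0 0) + nu *: dpartial 0 (dseps 1 1)
           + (1 - nu) *: dpartial 1 (dseps 0 1))) /\
     eq_distr Omega (b 1)
       (- (E / (1 - nu ^+ 2)) *:
          (nu *: dpartial 1 (dseps 0 0) + dpartial 1 (dseps 1 1)
           + (1 - nu) *: dpartial 0 (dseps 0 1)))).
Proof.
have alg1 (a0 a1 b0 b1 c0 c1 : R) : a0 + b0 = c0 -> a1 + b1 = c1 -> c0 + c1 = 0 ->
  - (a0 + a1) = b0 + b1 by move=> <- <-; lra.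
have alg2 (K l d a b c a' b' c' : R) : K * (l * d * (a + b) + 2^-1 * (c + c)) +
    K * (l * d * (a' - a + (b' - b)) + 2^-1 * (c' - c + (c' - c))) =
    K * (l * d * (a' + b') + c') by field.
have alg3 (x : R) : 2^-1 * (x + x) = x by field.
have alg4 (a b : R) : 2^-1 * (- - a + - - b) = 2^-1 * (a + b) by rewrite !opprK.
move=> E0 nu1 nu2 [oU _ _] bU scU _ [L2e syme] equil [pot [L2s syms] divs dec] C dseps b.
have p0 : 1 + nu != 0 by apply/eqP; lra.
have m0 : 1 - nu != 0 by apply/eqP; lra.
split; last first.
  have sD : dseps 1 0 = dseps 0 1.
    rewrite /dseps /tdistr_of; congr distr_of; apply/funext => x; exact: syms.
  have src psi := plane_stress_source E psi p0 m0 sD.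
  by move=> pcE; rewrite /b /C pcE; split=> psi _; [exact: (src psi).1|exact: (src psi).2].
have [M M0 UM] := bounded_sub_cbox bU.
pose mu := leb2 R; pose K := E / (1 + nu); pose l := lame pc nu.
have K0 : K != 0 by rewrite mulf_neq0 ?invr_eq0// gt_eqF.
have l0 : 2 * l + 1 != 0 by rewrite /l /lame; case: (pc); have [] := lame_neq0 nu1 nu2.
pose e i j := zero_ext Omega (eps i j).
have se i j : sqint mu (e i j) by apply/L2P; exact: L2e.
have e0 i j w : ~ Omega w -> e i j w = 0 by exact: zero_ext_out.
have symE i j w : e i j w = e j i w.
  have [Uw|nw] := pselect (Omega w); last by rewrite !e0.
  by rewrite /e !zero_ext_in// syme.
pose sig := hooke K l e.
have rows i phi dphi : H1 Omega phi dphi ->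
    \int[mu]_(x in Omega) (sig i 0 x * dphi 0 x) + \int[mu]_(x in Omega) (sig i 1 x * dphi 1 x) = 0.
  move=> H; have := equilibrium_row oU equil i H.
  have r j : \int[mu]_(x in Omega) (contract (stiffness pc E nu) eps i j x * dphi j x) =
      \int[mu]_(x in Omega) (sig i j x * dphi j x).
    apply: eq_Rintegral => x; rewrite inE => Ux; congr (_ * _).
    by rewrite contract_stiffness /sig /hooke /e !zero_ext_in// (syme j i)// alg3.
  by rewrite !r.
have ssig i j : sqint mu (sig i j) := sqint_hooke K l se i j.
have sig0 i j w : ~ Omega w -> sig i j w = 0 := @hooke_out _ _ K l _ e0 i j w.
have [w [D [chi [tchi sw sD [cw cD] eD]]]] := airy_displacement oU M0 UM scU K0 l0 se e0 symE rows.
pose alpha := K^-1 - l / (K * (2 * l + 1)).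
(* A second decomposition [e = g0 + se0], with potential part from the stream functions and
   solenoidal part a multiple of the stress. *)
pose g0 i j : field R := fun x => 2^-1 * (D i j x + D j i x).
pose se0 i j : field R := fun x => alpha * sig i j x.
have sg0 i j : sqint mu (g0 i j) := sqintZ 2^-1 (sqintD (sD i j).1 (sD j i).1).
have sse0 i j : sqint mu (se0 i j) := sqintZ alpha (ssig i j).
have eg0 i j : e i j = fun x => g0 i j x + se0 i j x by apply/funext => x; exact: eD.
have sols0 : solenoidal se0.
  move=> i f tf; have s j := test_sqint (test_partial j tf).
  rewrite (ipZl alpha (ssig i 0) (s 0)) (ipZl alpha (ssig i 1) (s 1)) -mulrDr.
  by rewrite (orthogonal_test oU (@sig0 i) (rows i) tf) mulr0.
have sols : solenoidal seps.
  move=> i f tf; have /eqP := divs i f tf.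
  rewrite DivE oppr_eq0 => /eqP; rewrite /tdistr_of.
  by rewrite (distr_of_setT (seps i 0)) (distr_of_setT (seps i 1)).
have [_ [g [[L2g symg] hg [phi [tphi cphi]]]]] := pot.
have sg i j := L2_setT (L2g i j).
have sseps i j := L2_setT (L2s i j).
have stest p i j : (forall k, test_function setT (p k)) -> sqint mu (test_symgrad p i j).
  by move=> tp; exact: test_sqint (test_test_symgrad i j tp).
have eqs i j f : test_function setT f -> ip mu (g i j) f + ip mu (seps i j) f = ip mu (e i j) f.
  move=> tf; have := dec i j f tf; rewrite distr_of_setT => ->.
  by rewrite -[RHS]/(_ + distr_of setT (seps i j) f) (hg i j f tf) !distr_of_setT.
have eqs0 i j f : test_function setT f -> ip mu (e i j) f = ip mu (g0 i j) f + ip mu (se0 i j) f.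
  by move=> /test_sqint sf; rewrite eg0; exact: ipDl.
have cchi i j : ip mu (fun x => test_symgrad (chi n) i j x - g0 i j x)
    (fun x => test_symgrad (chi n) i j x - g0 i j x) @[n --> \oo] --> 0.
  apply: nq_cvgD (cD i j) (cD j i); [move=> n|move=> n|exact: (sD i j).1|exact: (sD j i).1].
    exact: test_sqint (test_partial j (tchi n i)).
  exact: test_sqint (test_partial i (tchi n j)).
have tchiT n i : test_function setT (chi n i) by exact: test_mono (tchi n i).
(* Both decompositions are of Helmholtz type on the plane, so their potential parts agree as
   distributions. *)
have uniq : forall i j f, test_function setT f -> ip mu (g i j) f = ip mu (g0 i j) f.
  apply: (potential_part_unique sg sg0 sseps sse0 _ _ sols sols0 tphi tchiT _ cchi).
  - by move=> i j x; exact: syms.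
  - by move=> i j x; rewrite /se0 /sig (hooke_sym K l symE).
  - move=> i j; apply: L2norm_setT_cvg (cphi i j) => n.
    exact: sqintB (stest _ i j (tphi n)) (sg i j).
  - by move=> i j f tf; rewrite (eqs i j f tf) (eqs0 i j f tf).
(* [V] will be both [Omega] and the plane: [w] vanishes outside [Omega], so its weak symmetrised
   gradient is [g0] in either sense. *)
have sgw V i j f : (forall k x, ~ V x -> w k x = 0) -> test_function V f ->
    symgrad V w i j f = ip mu (g0 i j) f.
  move=> w0 tf; have sf := test_sqint tf.
  have wg k m : distr_of V (w k) (partial m f) = - ip mu (D k m) f.
    rewrite (distr_of_zero_off _ (w0 k)).
    exact: weak_gradient_limit (fun n => tchi n k) (sw k).1 (sD k m).1 (cw k) (cD k m) _ _ tf.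
  rewrite (ipZl 2^-1 (sqintD (sD i j).1 (sD j i).1) sf) (ipDl (sD i j).1 (sD j i).1 sf).
  by rewrite -[LHS]/(2^-1 * (- distr_of V (w i) (partial j f) + - distr_of V (w j) (partial i f))) !wg alg4.
have potw : potential w.
  split; first by move=> i; exact: sqint_L2loc (sw i).1.
  exists g0; split.
  - split=> [i j|i j x _]; first by apply/L2P; rewrite zero_extT.
    by rewrite /g0 addrC.
  - by move=> i j f tf; rewrite distr_of_setT; apply: sgw => // k x [].
  - exists chi; split=> // i j; apply: L2norm_cvg_zero_off (cchi i j) => [n|n x []//].
    exact: sqintB (stest _ i j (tchiT n)) (sg0 i j).
exists w; split.
- split=> // i j f tf; rewrite (hg i j f tf) distr_of_setT (uniq i j f tf).
  by apply/esym; apply: sgw => // k x [].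
- move=> i psi tpsi.
  (* In [Omega] the symmetrised gradient of [w] and the solenoidal part add up to [eps], so their
     stresses add up to [sig], whose divergence is zero. *)
  have PQ j : contract C (symgrad Omega w) i j (partial j psi) +
      contract C dseps i j (partial j psi) = ip mu (sig i j) (partial j psi).
    have td := test_partial j tpsi; have tT := test_mono (@subsetT _ Omega) td.
    have A k m : symgrad Omega w k m (partial j psi) = ip mu (g0 k m) (partial j psi).
      by apply: sgw td => n x nx; exact: (sw n).2.
    have B k m : dseps k m (partial j psi) = ip mu (e k m) (partial j psi) - ip mu (g0 k m) (partial j psi).
      rewrite -(eqs k m _ tT) (uniq k m _ tT) addrAC subrr add0r; exact: distr_of_test.
    rewrite /C !contract_stiffness -/K -/l !A !B (ip_hooke K l se i j (test_sqint td)).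
    have -> : e j i = e i j by apply/funext => x; exact: symE.
    have -> : g0 j i = g0 i j by apply/funext => x; rewrite /g0 addrC.
    exact: alg2.
  rewrite DivE -[RHS]/(- Div (contract C dseps) i psi) DivE opprK.
  exact: alg1 (PQ 0) (PQ 1) (orthogonal_test oU (@sig0 i) (rows i) tpsi).
- move=> i; apply: H10_of_limit (fun n => tchi n i) (sw i).1 (sw i).2 _ _ (cw i) (cD i) => j.
    exact: (sD i j).1.
  exact: (sD i j).2.
Qed.
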